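(* Let $A$ be a UHF $C^*$-algebra with $A\otimes A\cong A$ and $\gamma$ a universal UHF flow on $A$. If $\alpha$ is an approximately inner flow on $A$ such that $\alpha\otimes\gamma$ is cocycle conjugate to $\alpha$, then the following conditions are equivalent: (1) $\alpha$ is cocycle conjugate to $\gamma$; (2) the flip automorphism of $A\otimes A$ is $\alpha$-invariantly approximately inner.
   Context: A flow on a unital $C^*$-algebra is a strongly continuous one-parameter group of *-automorphisms. For flows $\alpha$ on $A$ and $\beta$ on $B$, $\alpha\otimes\beta$ is the flow $t\mapsto\alpha_t\otimes\beta_t$ on $A\otimes B$. For a unitary $u$, $\mathrm{Ad}\,u(x)=uxu^*$. A flow $\alpha$ on $A$ is approximately inner if there is a sequence $(h_n)$ of self-adjoint elements of $A$ with $\alpha_t(x)=\lim_n\mathrm{Ad}\,e^{ih_nt}(x)$ for every $t\in\mathbb R$ and $x\in A$ (equivalently, uniformly for $t$ in compact sets, for every $x$). A flow $\alpha$ on a UHF algebra $A$ is a UHF flow if there is an increasing sequence $(A_n)$ of full matrix $C^*$-subalgebras of $A$ with $1_A\in A_1$, $A=\overline{\bigcup_nA_n}$ and $\alpha_t(A_n)=A_n$ for all $n$ and $t$. Given a flow $\alpha$ on $A$, an $\alpha$-cocycle is a norm-continuous family $u=(u_t)_{t\in\mathbb R}$ of unitaries of $A$ with $u_s\alpha_s(u_t)=u_{s+t}$ for all $s,t$; the flow $t\mapsto \mathrm{Ad}\,u_t\circ\alpha_t$ is then called a cocycle perturbation of $\alpha$. A flow $\alpha$ on $A$ is cocycle conjugate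 to a flow $\beta$ on $B$ if there is an isomorphism $\varphi:A\to B$ such that $\alpha$ is a cocycle perturbation of $t\mapsto\varphi^{-1}\beta_t\varphi$. For a UHF algebra $A$ with $A\otimes A\cong A$, a UHF flow $\gamma$ on $A$ is universal if $\gamma\otimes\alpha$ is cocycle conjugate to $\gamma$ for every UHF flow $\alpha$ on $A$. The flip automorphism $\sigma$ of $A\otimes A$ is given by $\sigma(x\otimes y)=y\otimes x$ for $x,y\in A$. It is $\alpha$-invariantly approximately inner if there is a sequence $(u_n)$ of unitaries in $A\otimes A$ such that $\sigma(z)=\lim_n\mathrm{Ad}\,u_n(z)$ for every $z\in A\otimes A$ and $\|(\alpha_t\otimes\alpha_t)(u_n)-u_n\|\to0$ for each $t\in\mathbb R$ (equivalently, uniformly for $t$ in compact subsets of $\mathbb R$). *)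

(* Defs.v *)
From HB Require Import structures.
From mathcomp Require Import all_boot all_order all_algebra.
From mathcomp Require Import all_classical all_reals all_analysis.
From mathcomp Require Export complex.

Set Implicit Arguments.
Unset Strict Implicit.
Unset Printing Implicit Defensive.

Import Order.TTheory GRing.Theory Num.Theory numFieldNormedType.Exports.

Local Open Scope classical_set_scope.
Local Open Scope ring_scope.
Local Open Scope complex_scope.

(* Nonzero unital C*-algebras. The scalar field is R[i], so the norm takes its
   values in R[i]; they are automatically real and nonnegative.
   MathComp cannot join ringType and normedModType (their only join is
   numDomainType), so the multiplication belongs to the mixin, and every
   C*-algebra is made an algType afterwards. *)
HB.mixin Record CompleteNormedModule_isCStarAlgebra (R : realType) A
    of CompleteNormedModule R[i] A := {
  cone : A;
  cmul : A -> A -> A;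
  cmulA : associative cmul;
  cmul1l : left_id cone cmul;
  cmul1r : right_id cone cmul;
  cmulDl : left_distributive cmul +%R;
  cmulDr : right_distributive cmul +%R;
  cone_neq0 : cone != 0;
  cscaleAl : forall (c : R[i]) (x y : A), c *: cmul x y = cmul (c *: x) y;
  cscaleAr : forall (c : R[i]) (x y : A), c *: cmul x y = cmul x (c *: y);
  star : A -> A;
  starD : forall x y : A, star (x + y) = star x + star y;
  starZ : forall (c : R[i]) (x : A), star (c *: x) = c^* *: star x;
  starM : forall x y : A, star (cmul x y) = cmul (star y) (star x);
  starK : forall x : A, star (star x) = x;
  cstar_normM : forall x y : A, `|cmul x y| <= `|x| * `|y|;
  cstar_identity : forall x : A, `|cmul (star x) x| = `|x| ^+ 2
}.

#[short(type="cstarAlgType")]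
HB.structure Definition CStarAlgebra (R : realType) :=
  {A of CompleteNormedModule_isCStarAlgebra R A
      & CompleteNormedModule R[i] A}.

Section CStarAlgebraRing.
Variables (R : realType) (A : cstarAlgType R).

#[export, non_forgetful_inheritance]
HB.instance Definition _ := GRing.Zmodule_isNzRing.Build A
  (@cmulA R A) (@cmul1l R A) (@cmul1r R A) (@cmulDl R A) (@cmulDr R A)
  (@cone_neq0 R A).

#[export, non_forgetful_inheritance]
HB.instance Definition _ := GRing.Lmodule_isLalgebra.Build R[i] A
  (@cscaleAl R A).

#[export, non_forgetful_inheritance]
HB.instance Definition _ := GRing.Lalgebra_isAlgebra.Build R[i] A
  (@cscaleAr R A).

End CStarAlgebraRing.

Section CStar.
Context {R : realType}.
Implicit Types A B T : cstarAlgType R.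

Definition selfadjoint A (h : A) : Prop := star h = h.

Definition unitary A (u : A) : Prop := star u * u = 1 /\ u * star u = 1.

Definition Ad A (u x : A) : A := u * x * star u.

Definition cexp A (x : A) : A :=
  lim (series (fun n : nat => (n`!%:R^-1 : R[i]) *: x ^+ n) @ \oo).

Record star_hom A B (f : A -> B) : Prop := StarHom {
  star_hom_linear : linear f;
  star_hom_monoid : monoid_morphism f;
  star_hom_star : forall x, f (star x) = star (f x)
}.

Definition star_iso A B (f : A -> B) : Prop := star_hom f /\ bijective f.

Definition isomorphic A B : Prop := exists f : A -> B, star_iso f.

(* S is a C*-subalgebra isomorphic to the algebra of k x k complex matrices
   for some k >= 1. Its unit need not be that of A. *)
Definition full_matrix_subalgebra A (S : set A) : Prop :=
  exists (k : nat) (f : 'M[R[i]]_k.+1 -> A),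
    [/\ linear f,
        {morph f : M N / M *m N >-> M * N},
        (forall M, f (map_mx (fun z : R[i] => z^*) M^T) = star (f M)),
        injective f
      & range f = S].

Definition UHF_filtration A (F : nat -> set A) : Prop :=
  [/\ (forall n, full_matrix_subalgebra (F n)),
      (forall n, F n `<=` F n.+1),
      F 0%N 1
    & closure (\bigcup_n F n) = setT].

Definition UHF_algebra A : Prop := exists F : nat -> set A, UHF_filtration F.

Record flow A (alpha : R -> A -> A) : Prop := Flow {
  flow_aut : forall t, star_iso (alpha t);
  flowD : forall s t x, alpha (s + t) x = alpha s (alpha t x);
  flow_continuous : forall x, continuous (fun t : R => alpha t x)
}.

Definition approximately_inner A (alpha : R -> A -> A) : Prop :=
  exists h : nat -> A,
    (forall n, selfadjoint (h n)) /\
    forall (t : R) (x : A),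
      Ad (cexp (('i%C * t%:C) *: h n)) x @[n --> \oo] --> alpha t x.

Definition UHF_flow A (alpha : R -> A -> A) : Prop :=
  flow alpha /\
  exists F : nat -> set A,
    UHF_filtration F /\ forall n t, alpha t @` F n = F n.

Definition cocycle A (alpha : R -> A -> A) (u : R -> A) : Prop :=
  [/\ continuous u,
      (forall t, unitary (u t))
    & forall s t, u s * alpha s (u t) = u (s + t)].

Definition cocycle_perturbation A (beta alpha : R -> A -> A) : Prop :=
  exists u : R -> A, cocycle alpha u /\
    forall t x, beta t x = Ad (u t) (alpha t x).

Definition cocycle_conjugate A B (alpha : R -> A -> A) (beta : R -> B -> B) :
    Prop :=
  exists (phi : A -> B) (phiV : B -> A),
    [/\ star_iso phi, cancel phi phiV, cancel phiV phi
      & cocycle_perturbation alpha (fun t x => phiV (beta t (phi x)))].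

(* (T, tens) is the completion of the algebraic tensor product of A and B for
   some C*-norm: tens is a bilinear map turning T into a C*-algebra generated
   by elementary tensors, and the linear map it induces on the algebraic tensor
   product is injective. The latter is Ctensor_inj, since every element of the
   algebraic tensor product is a finite sum of elementary tensors whose left
   factors are linearly independent. *)
Record Ctensor A B T (tens : A -> B -> T) : Prop := CTensor {
  Ctensor_linear_l : forall b, linear (fun a => tens a b);
  Ctensor_linear_r : forall a, linear (fun b => tens a b);
  CtensorM : forall a a' b b',
    tens (a * a') (b * b') = tens a b * tens a' b';
  Ctensor1 : tens 1 1 = 1;
  Ctensor_star : forall a b, tens (star a) (star b) = star (tens a b);
  Ctensor_inj : forall n (a : 'I_n -> A) (b : 'I_n -> B),
    (forall c : 'I_n -> R[i],
        \sum_(i < n) c i *: a i = 0 -> forall i, c i = 0) ->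
    \sum_(i < n) tens (a i) (b i) = 0 -> forall i, b i = 0;
  Ctensor_dense :
    closure [set z : T | exists n (a : 'I_n -> A) (b : 'I_n -> B),
                           z = \sum_(i < n) tens (a i) (b i)] = setT
}.

(* The C*-tensor product: the C*-norm is the least one. (For UHF algebras,
   which are nuclear, there is only one C*-norm.) *)
Definition Ctensor_product A B T (tens : A -> B -> T) : Prop :=
  Ctensor tens /\
  forall (S : cstarAlgType R) (tens' : A -> B -> S), Ctensor tens' ->
    forall n (a : 'I_n -> A) (b : 'I_n -> B),
      `|\sum_(i < n) tens (a i) (b i)| <= `|\sum_(i < n) tens' (a i) (b i)|.

(* delta is the flow alpha (x) beta; it is unique by density. *)
Definition tensor_flow A B T (tens : A -> B -> T)
    (alpha : R -> A -> A) (beta : R -> B -> B) (delta : R -> T -> T) : Prop :=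
  flow delta /\
  forall t a b, delta t (tens a b) = tens (alpha t a) (beta t b).

Definition flip A T (tens : A -> A -> T) (sigma : T -> T) : Prop :=
  star_iso sigma /\ forall x y, sigma (tens x y) = tens y x.

Definition universal_UHF_flow A T (tens : A -> A -> T)
    (gamma : R -> A -> A) : Prop :=
  UHF_flow gamma /\
  forall alpha : R -> A -> A, UHF_flow alpha ->
    exists delta : R -> T -> T,
      tensor_flow tens gamma alpha delta /\ cocycle_conjugate delta gamma.

Definition flip_invariantly_approximately_inner A T (tens : A -> A -> T)
    (alpha : R -> A -> A) : Prop :=
  exists (sigma : T -> T) (delta : R -> T -> T),
    [/\ flip tens sigma, tensor_flow tens alpha alpha delta
      & exists u : nat -> T,
          [/\ (forall n, unitary (u n)),
              (forall z, Ad (u n) z @[n --> \oo] --> sigma z)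
            & forall t,
                `|delta t (u n) - u n| @[n --> \oo] --> (0 : R[i]^o)]].

End CStar.

(* Main.v *)
Require Import Defs.
From mathcomp Require Import all_boot all_order all_algebra.
From mathcomp Require Import all_classical all_reals all_analysis.
From mathcomp Require Import ring lra.

(* (1) => (2): for matrix units e of an invariant matrix algebra of gamma, the unitary sum of the
   e i j (x) e j i implements the flip there. It does not depend on the choice of e, so it is fixed
   by gamma (x) gamma, and a cocycle w moves it by Ad (w (x) w), which the flip fixes.

   (2) => (1): since alpha is approximately inner and A (x) A = A, there is an infinite-tensor-product
   UHF flow beta on A that contains approximate copies of alpha, further and further out and hence
   asymptotically central. By universality gamma absorbs beta, so there are unitaries W k of A such
   that Ad (W k) is asymptotically central and asymptotically intertwines alpha and gamma. If u m
   are almost invariant unitaries implementing the flip, then Ad (1 (x) W k) (u m) almost commutes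
   with 1 (x) A, almost moves A (x) 1 into 1 (x) A and is almost invariant under alpha (x) gamma
   (Baire's theorem makes this uniform in time). A one-sided intertwining argument then shows that
   gamma is cocycle conjugate to alpha (x) gamma, which is cocycle conjugate to alpha. *)

Set Implicit Arguments.
Unset Strict Implicit.
Unset Printing Implicit Defensive.

Import Order.TTheory GRing.Theory Num.Theory numFieldNormedType.Exports.

Local Open Scope classical_set_scope.
Local Open Scope ring_scope.
Local Open Scope complex_scope.

(** Universality cannot be applied to [alpha], which is not assumed to leave matrix algebras
    invariant; it is applied to the UHF flow [beta], whose factors are generated by matrix
    approximants of the Hamiltonians implementing [alpha]. The cocycle that comes with this
    absorption is harmless because the copies are asymptotically central. Condition (2) gives
    unitaries almost fixed by alpha (x) alpha, whereas the intertwining needs them almost fixed by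
    alpha (x) gamma; conjugation by 1 (x) W k achieves this only in the limit k -> oo for a fixed u
    m, so m is chosen first and k depends on it. Both limits are pointwise in time, but the final
    cocycle, the limit of V n * delta t (star (V n)), must be norm continuous; this is what
    uniformity on bounded time intervals is for. Apart from exponentials, the only functional
    calculus is (1 - y)^(-1/2) for [nrm y <= 1/8]: it yields contractivity of homomorphisms,
    projections near almost-projections, and polar parts near 1. *)

Lemma near_oo_ex (P : set nat) : (\forall n \near \oo, P n) -> exists n, P n.
Proof. exact: filter_ex. Qed.

Lemma near_ooP (P : set nat) :
  (\forall n \near \oo, P n) <-> exists N, forall n, (N <= n)%N -> P n.
Proof.
split=> [[N _ h]|[N h]]; first by exists N => n; exact: h.
by exists N => // n; exact: h.
Qed.

(** * Real-valued norms, limits and closures *)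

Section RealNorm.
Context {R : realType}.

(* The norm of a C*-algebra takes its values in R[i]; [nrm] is the same number in R. *)
Definition nrm {V : normedZmodType R[i]} (x : V) : R := complex.Re `|x|.

Section Normed.
Context {V : normedZmodType R[i]}.
Implicit Types x y : V.

Lemma nrmE x : `|x| = (nrm x)%:C.
Proof. by rewrite /nrm RRe_real // ger0_real. Qed.

Lemma nrm_ge0 x : 0 <= nrm x.
Proof. by have := normr_ge0 x; rewrite nrmE lecR. Qed.

Lemma nrmD x y : nrm (x + y) <= nrm x + nrm y.
Proof. by have := ler_normD x y; rewrite !nrmE -rmorphD lecR. Qed.

Lemma nrmN x : nrm (- x) = nrm x. Proof. by rewrite /nrm normrN. Qed.

Lemma nrmB x y : nrm (x - y) <= nrm x + nrm y.
Proof. by rewrite -(nrmN y) nrmD. Qed.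

Lemma nrmC x y : nrm (x - y) = nrm (y - x).
Proof. by rewrite /nrm distrC. Qed.

Lemma nrm0 : nrm (0 : V) = 0. Proof. by rewrite /nrm normr0. Qed.

Lemma nrm_eq0 x : nrm x = 0 -> x = 0.
Proof. by move=> x0; apply/eqP; rewrite -normr_eq0 nrmE x0. Qed.

Lemma nrm_tri z x y : nrm (x - y) <= nrm (x - z) + nrm (z - y).
Proof. by apply: le_trans (nrmD _ _); rewrite addrA subrK. Qed.

Lemma nrm_dist x y : nrm x <= nrm y + nrm (x - y).
Proof. by apply: le_trans (nrmD _ _); rewrite addrC subrK. Qed.

Lemma nrm_sum (I : Type) (r : seq I) (P : pred I) (F : I -> V) :
  nrm (\sum_(i <- r | P i) F i) <= \sum_(i <- r | P i) nrm (F i).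
Proof.
elim/big_ind2: _ => [|x a y b ha hb|//]; first by rewrite nrm0.
by apply: le_trans (nrmD _ _) _; apply: lerD.
Qed.

Lemma nrm_eps x : (forall e : R, 0 < e -> nrm x <= e) -> x = 0.
Proof.
move=> h; apply: nrm_eq0; apply/eqP; rewrite eq_le nrm_ge0 andbT.
by apply/ler_addgt0Pl => e e0; rewrite addr0; exact: h.
Qed.

End Normed.

Lemma nrm_real (r : R) : nrm r%:C = `|r|.
Proof. by rewrite /nrm normc_def /= expr0n addr0 sqrtr_sqr. Qed.

Section Cvg.
Context {V : normedModType R[i]}.

Lemma nrmZ (c : R[i]) (x : V) : nrm (c *: x) = nrm c * nrm x.
Proof.
by apply: complexI; rewrite rmorphM /= -!nrmE normrZ.
Qed.

Lemma cvg_nrmP T (F : set_system T) {FF : Filter F} (f : T -> V) (l : V) :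
  (f t @[t --> F] --> l) <->
  (forall e : R, 0 < e -> \forall t \near F, nrm (l - f t) < e).
Proof.
split=> [/cvgrPdist_lt h e e0|h].
  have /h : 0 < e%:C by rewrite ltcR.
  by apply: filterS => t; rewrite nrmE ltcR.
(* In the order of [R[i]], [0 < e] forces [e] to be real, so the complex radius reduces to its real
   part. *)
apply/cvgrPdist_lt => e; rewrite ltcE => /andP[/eqP Ie Re].
apply: filterS (h _ Re) => t; rewrite nrmE ltcE /= => ->.
by rewrite Ie eqxx.
Qed.

Lemma cvg_nrm_lt T (F : set_system T) {FF : Filter F} (f : T -> V) (l : V)
    (e : R) : f t @[t --> F] --> l -> 0 < e -> \forall t \near F, nrm (l - f t) < e.
Proof. by move=> /cvg_nrmP h; exact: h. Qed.

End Cvg.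
Section Cvg2.
Context {V : normedModType R[i]}.

Lemma cvg_nrm_le T (F : set_system T) {FF : Filter F} (f : T -> V) (l : V)
    (W : normedModType R[i]) (g : T -> W) (m : W) (C : R) :
  (\forall t \near F, nrm (l - f t) <= C * nrm (m - g t)) ->
  (g t @[t --> F] --> m) -> (f t @[t --> F] --> l).
Proof.
move=> h /cvg_nrmP gm; apply/cvg_nrmP => e e0.
have C0 : 0 < `|C| + 1 by rewrite ltr_wpDl.
apply: filterS2 h (gm _ (divr_gt0 e0 C0)) => t; rewrite ltr_pdivlMr // => h1 h2.
have := nrm_ge0 (m - g t).
have := ler_norm C; nra.
Qed.

Lemma nrm_cvg_eps (u : nat -> V) (l : V) (c : R) : u n @[n --> \oo] --> l ->
  (\forall n \near \oo, nrm (u n) <= c) -> nrm l <= c.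
Proof.
move=> /cvg_nrmP h1 h2; apply/ler_addgt0Pl => e e0.
have [n [hn cn]] := near_oo_ex (filterI (h1 _ e0) h2).
have := nrm_dist l (u n); lra.
Qed.

Lemma cvg_eq (u : nat -> V) (l m : V) :
  u n @[n --> \oo] --> l -> u n @[n --> \oo] --> m -> l = m.
Proof. by move=> h1 h2; apply: (cvg_unique _ h1 h2). Qed.

Lemma cvg_eq_near (u : nat -> V) (l m : V) :
  (\forall n \near \oo, u n = m) -> u n @[n --> \oo] --> l -> l = m.
Proof.
move=> h h1; apply: cvg_eq h1 _; apply/cvg_nrmP => e e0.
by apply: filterS h => n ->; rewrite subrr nrm0.
Qed.

Lemma cvg_near_cst (u : nat -> V) (m : V) :
  (\forall n \near \oo, u n = m) -> u n @[n --> \oo] --> m.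
Proof.
by move=> h; apply/cvg_nrmP => e e0; apply: filterS h => n ->; rewrite subrr nrm0.
Qed.

Lemma closureP (S : set V) (x : V) :
  closure S x <-> forall e : R, 0 < e -> exists2 y, S y & nrm (x - y) < e.
Proof.
split=> [h e e0|h].
  have : nbhs x (ball x e%:C) by apply: nbhsx_ballx; rewrite ltcR.
  move/h => -[y [Sy]]; rewrite -ball_normE /= nrmE ltcR => hy.
  by exists y.
move=> B /nbhs_ballP[e /=]; rewrite ltcE => /andP[/eqP Ie Re] sB.
have [y Sy hy] := h _ Re.
exists y; split => //; apply: sB; rewrite -ball_normE /= nrmE ltcE /=.
by rewrite hy Ie eqxx.
Qed.

Definition seq_closed (P : set V) :=
  forall (u : nat -> V) (l : V), (forall n, P (u n)) ->
    u n @[n --> \oo] --> l -> P l.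

End Cvg2.
End RealNorm.

Section HalfPowers.
Context {R : realType}.

Definition hpow (n : nat) : R := 2^-1 ^+ n.

Lemma hpow0 : hpow 0 = 1. Proof. exact: expr0. Qed.

Lemma hpowS n : hpow n = 2 * hpow n.+1.
Proof. by rewrite /hpow exprS mulrA divff ?mul1r. Qed.

Lemma hpow_gt0 n : 0 < hpow n. Proof. by rewrite exprn_gt0. Qed.

Lemma hpow_small (C e : R) : 0 < e ->
  exists N, forall n, (N <= n)%N -> C * hpow n < e.
Proof.
move=> e0; apply/near_ooP.
have h : (C * hpow n) @[n --> \oo] --> (C * 0 : R).
  by apply: cvgMr; apply: cvg_expr; rewrite ger0_norm; lra.
rewrite mulr0 in h.
have /cvgrPdist_lt := h => /(_ _ e0); apply: filterS => n.
by rewrite sub0r normrN; apply: le_lt_trans; exact: ler_norm.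
Qed.

End HalfPowers.

Section Complete.
Context {R : realType} {V : completeNormedModType R[i]}.

Lemma nrm_cauchy (u : nat -> V) :
  (forall e : R, 0 < e ->
     exists N, forall n, (N <= n)%N -> nrm (u n - u N) < e) ->
  exists l : V, u n @[n --> \oo] --> l.
Proof.
move=> h; suff : cvg (u n @[n --> \oo]) by move=> c; exists (lim (u n @[n --> \oo])).
apply/cauchy_cvgP/cauchyP => e; rewrite ltcE => /andP[/eqP Ie Re].
have [N hN] := h _ Re; exists (u N); exists N => // n /= Nn.
by rewrite -ball_normE /= nrmE ltcE /= Ie eqxx nrmC hN.
Qed.

Lemma geo_cvg (u : nat -> V) (C : R) :
  (forall n, nrm (u n.+1 - u n) <= C * hpow n) ->
  exists l : V, (u n @[n --> \oo] --> l) /\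
    forall n, nrm (l - u n) <= 2 * C * hpow n.
Proof.
move=> h.
have C0 : 0 <= C by have := h 0%N; rewrite hpow0 mulr1; have := nrm_ge0 (u 1%N - u 0%N); lra.
have H n k : nrm (u (n + k)%N - u n) <= 2 * C * hpow n.
  (* Keeping the term [- hpow (n + k)] makes the geometric sum telescope in the induction. *)
  suff : nrm (u (n + k)%N - u n) <= 2 * C * (hpow n - hpow (n + k)%N).
    by have := hpow_gt0 (R := R) (n + k)%N; nra.
  elim: k => [|k IH]; first by rewrite addn0 !subrr nrm0 mulr0.
  rewrite addnS; have := nrm_tri (u (n + k)%N) (u (n + k).+1) (u n).
  by have := h (n + k)%N; rewrite (hpowS (n + k)%N) in IH *; nra.
have [l hl] : exists l : V, u n @[n --> \oo] --> l.
  apply: nrm_cauchy => e e0; have [N hN] := hpow_small (2 * C) e0.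
  exists N => n /subnKC <-; apply: le_lt_trans (H _ _) (hN _ (leqnn N)).
exists l; split=> // n; apply: (@nrm_cvg_eps _ _ (fun m => u m - u n)).
  by apply: cvgB hl _; exact: cvg_cst.
by apply/near_ooP; exists n => m /subnKC <-; exact: H.
Qed.

End Complete.

(** * Unitaries and *-homomorphisms *)

Section CStarBasics.
Context {R : realType} {A : cstarAlgType R}.
Implicit Types (x y u v : A) (c : R[i]).

Lemma star_add x y : star (x + y) = star x + star y. Proof. exact: starD. Qed.
Lemma star_scale c x : star (c *: x) = c^* *: star x. Proof. exact: starZ. Qed.
Lemma star_mul x y : star (x * y) = star y * star x. Proof. exact: starM. Qed.

Lemma star0 : star (0 : A) = 0.
Proof. by apply: (addrI (star 0)); rewrite -star_add !addr0. Qed.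

Lemma star_opp x : star (- x) = - star x.
Proof. by apply: (addrI (star x)); rewrite -star_add !subrr star0. Qed.

Lemma star_sub x y : star (x - y) = star x - star y.
Proof. by rewrite star_add star_opp. Qed.

Lemma star_one : star (1 : A) = 1.
Proof. by have := star_mul (star 1 : A) 1; rewrite mulr1 starK mulr1. Qed.

Lemma star_sum (I : Type) (r : seq I) (P : pred I) (F : I -> A) :
  star (\sum_(i <- r | P i) F i) = \sum_(i <- r | P i) star (F i).
Proof. by apply: (big_morph _ star_add star0). Qed.

Lemma nrmM x y : nrm (x * y) <= nrm x * nrm y.
Proof. by have := cstar_normM x y; rewrite !nrmE -rmorphM lecR. Qed.

Lemma nrm_cstar x : nrm (star x * x) = nrm x ^+ 2.
Proof.
by apply: complexI; rewrite rmorphXn /= -!nrmE; exact: cstar_identity.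
Qed.

Lemma nrm_star x : nrm (star x) = nrm x.
Proof.
have H y : nrm y <= nrm (star y).
  have := nrm_cstar y; have := nrmM (star y) y; have := nrm_ge0 y.
  have := nrm_ge0 (star y); rewrite expr2; nra.
by apply/eqP; rewrite eq_le H -{2}(starK x) H.
Qed.

Lemma nrm_one : nrm (1 : A) = 1.
Proof.
have := nrm_cstar (1 : A); rewrite star_one mulr1 expr2 => h.
have h0 : nrm (1 : A) != 0.
  by apply/eqP => /nrm_eq0; apply/eqP; exact: oner_neq0.
by apply: (mulfI h0); rewrite mulr1 -h.
Qed.

Lemma unitary1 : unitary (1 : A).
Proof. by rewrite /unitary star_one mulr1. Qed.

Lemma unitary_star u : unitary u -> unitary (star u).
Proof. by rewrite /unitary starK => -[]. Qed.

Lemma unitary_mul u v : unitary u -> unitary v -> unitary (u * v).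
Proof.
move=> [u1 u2] [v1 v2]; rewrite /unitary star_mul; split.
  by rewrite mulrA -(mulrA _ (star u)) u1 mulr1.
by rewrite mulrA -(mulrA u) v2 mulr1.
Qed.

Lemma unitary_nrm u : unitary u -> nrm u = 1.
Proof.
move=> [u1 _]; have := nrm_cstar u; rewrite u1 nrm_one => /esym/eqP.
by rewrite sqrp_eq1 ?nrm_ge0 // => /eqP.
Qed.

Lemma nrm_mul_unitaryl u x : unitary u -> nrm (u * x) = nrm x.
Proof.
move=> hu; apply/eqP; rewrite eq_le.
have := nrmM u x; rewrite (unitary_nrm hu) mul1r => -> /=.
have := nrmM (star u) (u * x).
by rewrite nrm_star (unitary_nrm hu) mul1r mulrA hu.1 mul1r.
Qed.

Lemma nrm_mul_unitaryr u x : unitary u -> nrm (x * u) = nrm x.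
Proof.
move=> hu; rewrite -nrm_star star_mul nrm_mul_unitaryl ?nrm_star //.
exact: unitary_star.
Qed.

Lemma nrm_Ad u x : unitary u -> nrm (Ad u x) = nrm x.
Proof.
by move=> hu; rewrite /Ad nrm_mul_unitaryr ?nrm_mul_unitaryl //; exact: unitary_star.
Qed.

Lemma AdD u x y : Ad u (x + y) = Ad u x + Ad u y.
Proof. by rewrite /Ad mulrDr mulrDl. Qed.

Lemma AdN u x : Ad u (- x) = - Ad u x.
Proof. by rewrite /Ad mulrN mulNr. Qed.

Lemma AdB u x y : Ad u (x - y) = Ad u x - Ad u y.
Proof. by rewrite AdD AdN. Qed.

Lemma AdZ u c x : Ad u (c *: x) = c *: Ad u x.
Proof. by rewrite /Ad -scalerAr -scalerAl. Qed.

Lemma Ad_mul u v x : Ad (u * v) x = Ad u (Ad v x).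
Proof. by rewrite /Ad star_mul !mulrA. Qed.

Lemma Ad_one x : Ad 1 x = x.
Proof. by rewrite /Ad star_one mulr1 mul1r. Qed.

Lemma AdK u x : unitary u -> Ad (star u) (Ad u x) = x.
Proof. by move=> [h _]; rewrite -Ad_mul h Ad_one. Qed.

Lemma AdVK u x : unitary u -> Ad u (Ad (star u) x) = x.
Proof. by move=> [_ h]; rewrite -Ad_mul h Ad_one. Qed.

Lemma Ad_star u x : star (Ad u x) = Ad u (star x).
Proof. by rewrite /Ad !star_mul starK mulrA. Qed.

Lemma AdM u x y : unitary u -> Ad u (x * y) = Ad u x * Ad u y.
Proof.
move=> [h _]; rewrite /Ad !mulrA; congr (_ * _ * _).
by rewrite -(mulrA (u * x)) h mulr1.
Qed.

Lemma Ad1 u : unitary u -> Ad u 1 = 1.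
Proof. by move=> [_ h]; rewrite /Ad mulr1. Qed.

Lemma Ad_unitary u v : unitary u -> unitary v -> unitary (Ad u v).
Proof.
move=> hu hv; rewrite /unitary Ad_star -!AdM //.
by case: hv => -> ->; rewrite Ad1.
Qed.

Lemma Ad_comm u x : unitary u -> u * x = x * u -> Ad u x = x.
Proof. by move=> [_ h] e; rewrite /Ad e -mulrA h mulr1. Qed.

Lemma star_hom_Ad u : unitary u -> star_hom (Ad u).
Proof.
move=> hu; split.
- by move=> c x y; rewrite AdD AdZ.
- by split; [exact: Ad1 | move=> x y; exact: AdM].
- by move=> x; rewrite Ad_star.
Qed.

Lemma cvg_mul T (F : set_system T) {FF : Filter F} (f g : T -> A) (a b : A) :
  f t @[t --> F] --> a -> g t @[t --> F] --> b ->
  f t * g t @[t --> F] --> a * b.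
Proof.
move=> /cvg_nrmP hf /cvg_nrmP hg; apply/cvg_nrmP => e e0.
have na := nrm_ge0 a; have nb := nrm_ge0 b.
set d := Num.min 1 (e / (nrm a + nrm b + 2)).
have d0 : 0 < d by rewrite lt_min ltr01 divr_gt0 //; lra.
have d1 : d <= 1 by rewrite ge_min lexx.
have d2 : d * (nrm a + nrm b + 2) <= e.
  by rewrite -ler_pdivlMr ?ge_min ?lexx ?orbT //; lra.
apply: filterS2 (hf _ d0) (hg _ d0) => t h1 h2.
have -> : a * b - f t * g t = (a - f t) * b + f t * (b - g t).
  by rewrite mulrBl mulrBr addrA subrK.
have n1 := nrmD ((a - f t) * b) (f t * (b - g t)).
have n2 := nrmM (a - f t) b; have n3 := nrmM (f t) (b - g t).
have n4 := nrm_dist (f t) a; rewrite nrmC in n4.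
have n5 := nrm_ge0 (a - f t); have n6 := nrm_ge0 (b - g t).
have n7 := nrm_ge0 (f t).
have n8 : nrm (f t) * nrm (b - g t) <= (nrm a + 1) * d by apply: ler_pM => //; lra.
have n9 : nrm (a - f t) * nrm b <= d * nrm b by apply: ler_pM => //; lra.
nra.
Qed.

Lemma cvg_star T (F : set_system T) {FF : Filter F} (f : T -> A) (a : A) :
  f t @[t --> F] --> a -> star (f t) @[t --> F] --> star a.
Proof.
apply: (@cvg_nrm_le _ _ _ _ _ _ _ _ _ _ 1); apply: nearW => t.
by rewrite mul1r -star_sub nrm_star.
Qed.

Lemma cvg_Ad T (F : set_system T) {FF : Filter F} (f g : T -> A) (a b : A) :
  f t @[t --> F] --> a -> g t @[t --> F] --> b ->
  Ad (f t) (g t) @[t --> F] --> Ad a b.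
Proof. by move=> h1 h2; apply: cvg_mul; [exact: cvg_mul | exact: cvg_star]. Qed.

End CStarBasics.

Section StarHom.
Context {R : realType} {A B : cstarAlgType R} {f : A -> B} (fh : star_hom f).

Lemma shomD x y : f (x + y) = f x + f y.
Proof. by have := star_hom_linear fh 1 x y; rewrite !scale1r. Qed.

Lemma shom0 : f 0 = 0.
Proof. by apply: (addrI (f 0)); rewrite -shomD !addr0. Qed.

Lemma shomZ c x : f (c *: x) = c *: f x.
Proof. by have := star_hom_linear fh c x 0; rewrite shom0 !addr0. Qed.

Lemma shomN x : f (- x) = - f x.
Proof. by rewrite -scaleN1r shomZ scaleN1r. Qed.

Lemma shomB x y : f (x - y) = f x - f y.
Proof. by rewrite shomD shomN. Qed.

Lemma shomM x y : f (x * y) = f x * f y.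
Proof. by case: fh => _ [_ ->]. Qed.

Lemma shom1 : f 1 = 1.
Proof. by case: fh => _ [-> _]. Qed.

Lemma shom_star x : f (star x) = star (f x).
Proof. by case: fh. Qed.

Lemma shom_sum (I : Type) (r : seq I) (P : pred I) (F : I -> A) :
  f (\sum_(i <- r | P i) F i) = \sum_(i <- r | P i) f (F i).
Proof. by apply: (big_morph _ shomD shom0). Qed.

Lemma shomX x n : f (x ^+ n) = f x ^+ n.
Proof. by elim: n => [|n IH]; rewrite ?expr0 ?shom1 // !exprS shomM IH. Qed.

Lemma shom_unitary u : unitary u -> unitary (f u).
Proof. by move=> [h1 h2]; split; rewrite -shom_star -shomM ?h1 ?h2 shom1. Qed.

Lemma shom_Ad u x : f (Ad u x) = Ad (f u) (f x).
Proof. by rewrite /Ad !shomM shom_star. Qed.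

End StarHom.

Section StarHomComp.
Context {R : realType} {A B C : cstarAlgType R}.

Lemma star_hom_comp (f : A -> B) (g : B -> C) :
  star_hom f -> star_hom g -> star_hom (g \o f).
Proof.
move=> hf hg; split.
- by move=> c x y /=; rewrite (shomD hf) (shomZ hf) (shomD hg) (shomZ hg).
- by split=> [|x y] /=; rewrite ?(shom1 hf) ?(shom1 hg) // (shomM hf) (shomM hg).
- by move=> x /=; rewrite (shom_star hf) (shom_star hg).
Qed.

Lemma star_hom_inv (f : A -> B) (g : B -> A) :
  star_hom f -> cancel f g -> cancel g f -> star_hom g.
Proof.
move=> hf fg gf; have inj := can_inj fg; split.
- by move=> c x y; apply: inj; rewrite (shomD hf) (shomZ hf) !gf.
- by split=> [|x y]; apply: inj; rewrite ?(shom1 hf) ?(shomM hf) !gf.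
- by move=> x; apply: inj; rewrite (shom_star hf) !gf.
Qed.

Lemma star_iso_inv (f : A -> B) (g : B -> A) :
  star_iso f -> cancel f g -> cancel g f -> star_iso g.
Proof.
by move=> [hf _] fg gf; split; [exact: star_hom_inv fg gf | exists f].
Qed.

Lemma star_iso_comp (f : A -> B) (g : B -> C) :
  star_iso f -> star_iso g -> star_iso (g \o f).
Proof.
by move=> [hf bf] [hg bg]; split; [exact: star_hom_comp | exact: bij_comp].
Qed.

End StarHomComp.

Lemma conjCE (R:realType) (c : R[i]): Num.conj c = conjc c.
Proof. by []. Qed.
Lemma conjC_re (R:realType) (r : R): Num.conj (r%:C) = r%:C :> R[i].
Proof. by rewrite conjCE conjc_real. Qed.
Lemma conjC_i (R:realType) : Num.conj ('i%C) = - 'i%C :> R[i].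
Proof. by apply/eqP; rewrite conjCE eq_complex /= oppr0 !eqxx. Qed.

(** * Inverse square roots and contractivity *)

Section ClosedSubalgebra.
Context {R : realType} {A : cstarAlgType R}.

Record closed_subalg (S : set A) : Prop := ClosedSubalg {
  csub_closed : seq_closed S;
  csub1 : S 1;
  csubD : forall x y, S x -> S y -> S (x + y);
  csubZ : forall (c : R[i]) x, S x -> S (c *: x);
  csubM : forall x y, S x -> S y -> S (x * y)
}.

Section Ops.
Context {S : set A} (hS : closed_subalg S).

Lemma csub0 : S 0.
Proof. by rewrite -(scale0r 1); apply: csubZ => //; exact: csub1. Qed.

Lemma csubN x : S x -> S (- x).
Proof. by rewrite -scaleN1r; exact: csubZ. Qed.

Lemma csubB x y : S x -> S y -> S (x - y).
Proof. by move=> hx hy; apply: csubD => //; exact: csubN. Qed.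

Lemma csub_sum (I : Type) (r : seq I) (P : pred I) (F : I -> A) :
  (forall i, P i -> S (F i)) -> S (\sum_(i <- r | P i) F i).
Proof. by move=> h; elim/big_ind: _ => //; [exact: csub0 | exact: csubD]. Qed.

Lemma csubX x n : S x -> S (x ^+ n).
Proof.
by move=> hx; elim: n => [|n IH]; rewrite ?expr0 ?exprS; [exact: csub1|exact: csubM].
Qed.

End Ops.

(** With a commutant as the closed subalgebra, membership of an inverse square root becomes a
    commutation rule ([isq_comm]). *)
Lemma csub_commutant (z : A) : closed_subalg [set x | z * x = x * z].
Proof.
split=> /=.
- move=> u l hu hl; apply: (@cvg_eq _ _ (fun n => z * u n)).
    by apply: cvg_mul => //; exact: cvg_cst.
  by rewrite (_ : (fun n => z * u n) = fun n => u n * z); [apply: cvg_mul => //; exact: cvg_cst|apply/funext].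
- by rewrite mulr1 mul1r.
- by move=> x y hx hy; rewrite mulrDr mulrDl hx hy.
- by move=> c x hx; rewrite -scalerAr -scalerAl hx.
- by move=> x y hx hy; rewrite mulrA hx -mulrA hy mulrA.
Qed.

End ClosedSubalgebra.

Section InverseSqrt.
Context {R : realType} {A : cstarAlgType R}.
Implicit Types (x y s : A).

(* A fixed point s satisfies 2s = y(1 + s)^2 - s^2, that is (1 - y)(1 + s)^2 = 1. *)
Definition isq_step y s : A :=
  (2^-1 : R)%:C *: (y * ((1 + s) * (1 + s)) - s * s).

Lemma nrm_half (V : normedModType R[i]) (x : V) :
  nrm ((2^-1 : R)%:C *: x) = 2^-1 * nrm x.
Proof. by rewrite nrmZ nrm_real ger0_norm. Qed.

(** The bound 1/8 makes the ball of radius [nrm y] invariant, as (81/64 + 1/8) / 2 < 1, and the step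
    a contraction there, as 9/32 + 1/4 < 1. *)
Lemma isq_step_le y s : nrm y <= 8^-1 -> nrm s <= nrm y ->
  nrm (isq_step y s) <= nrm y.
Proof.
move=> hy hs; rewrite /isq_step nrm_half.
have h1 := nrmB (y * ((1 + s) * (1 + s))) (s * s).
have h2 := nrmM y ((1 + s) * (1 + s)); have h3 := nrmM (1 + s) (1 + s).
have h4 := nrmM s s; have h5 := nrmD (1 : A) s; rewrite nrm_one in h5.
have n1 := nrm_ge0 y; have n2 := nrm_ge0 s; have n3 := nrm_ge0 (1 + s).
have h6 : nrm (1 + s) * nrm (1 + s) <= (9/8) * (9/8) by apply: ler_pM => //; lra.
have h7 : nrm y * nrm ((1 + s) * (1 + s)) <= nrm y * (81/64).
  by apply: ler_wpM2l => //; lra.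
have h8 : nrm s * nrm s <= nrm y * (1/8) by apply: ler_pM => //; lra.
lra.
Qed.

Lemma isq_step_contract y s s' : nrm y <= 8^-1 ->
  nrm s <= nrm y -> nrm s' <= nrm y ->
  nrm (isq_step y s - isq_step y s') <= 2^-1 * nrm (s - s').
Proof.
move=> hy hs hs'.
have -> : isq_step y s - isq_step y s' = (2^-1 : R)%:C *:
   (y * ((1 + s) * (s - s') + (s - s') * (1 + s')) - (s * (s - s') + (s - s') * s')).
  rewrite /isq_step -scalerBr; congr (_ *: _).
  have -> : s * (s - s') + (s - s') * s' = s * s - s' * s'.
    by rewrite mulrBr mulrBl addrA subrK.
  have -> : (1 + s) * (s - s') + (s - s') * (1 + s') =
     (1 + s) * (1 + s) - (1 + s') * (1 + s').
    have -> : s - s' = (1 + s) - (1 + s') by rewrite opprD addrACA subrr add0r.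
    by rewrite mulrBr mulrBl addrA subrK.
  by rewrite mulrBr !opprB addrACA [RHS]addrACA; congr (_ + _); rewrite addrC.
rewrite nrm_half ler_pM2l //.
have n0 := nrm_ge0 (s - s'); have n1 := nrm_ge0 y.
have h1 := nrmB (y * ((1 + s) * (s - s') + (s - s') * (1 + s')))
                 (s * (s - s') + (s - s') * s').
have h2 := nrmM y ((1 + s) * (s - s') + (s - s') * (1 + s')).
have h3 := nrmD ((1 + s) * (s - s')) ((s - s') * (1 + s')).
have h4 := nrmM (1 + s) (s - s'); have h5 := nrmM (s - s') (1 + s').
have h6 := nrmD (s * (s - s')) ((s - s') * s').
have h7 := nrmM s (s - s'); have h8 := nrmM (s - s') s'.
have h9 := nrmD (1 : A) s; have h10 := nrmD (1 : A) s'; rewrite nrm_one in h9 h10.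
have g1 : nrm (1 + s) * nrm (s - s') <= (9/8) * nrm (s - s').
  by apply: ler_wpM2r => //; lra.
have g2 : nrm (s - s') * nrm (1 + s') <= nrm (s - s') * (9/8).
  by apply: ler_wpM2l => //; lra.
have g3 : nrm s * nrm (s - s') <= (1/8) * nrm (s - s').
  by apply: ler_wpM2r => //; lra.
have g4 : nrm (s - s') * nrm s' <= nrm (s - s') * (1/8).
  by apply: ler_wpM2l => //; lra.
have g5 : nrm y * nrm ((1 + s) * (s - s') + (s - s') * (1 + s')) <=
   (1/8) * (9/4 * nrm (s - s')).
  by apply: ler_pM; rewrite ?nrm_ge0 //; lra.
lra.
Qed.

(** The last clause records that [s] is the limit of the iterates started at 0: every property
    closed under limits and under the step passes to [s]. Membership in closed subalgebras,
    commutation and self-adjointness are all derived from it. *)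
Lemma isq_exists y : nrm y <= 8^-1 -> exists s, [/\ nrm s <= nrm y,
  (1 - y) * ((1 + s) * (1 + s)) = 1 &
  forall P : set A, seq_closed P -> P 0 ->
    (forall z, P z -> P (isq_step y z)) -> P s].
Proof.
move=> hy; pose u n := iter n (isq_step y) 0.
have hu n : nrm (u n) <= nrm y.
  elim: n => [|n IH]; first by rewrite nrm0 nrm_ge0.
  by rewrite /u iterS; exact: isq_step_le.
have hc n : nrm (u n.+1 - u n) <= 1 * hpow n.
  rewrite mul1r; elim: n => [|n IH].
    rewrite hpow0 subr0; apply: le_trans (hu _) _; lra.
  have := isq_step_contract hy (hu n.+1) (hu n); rewrite -!iterS -/(u n.+2) -/(u n.+1).
  by rewrite (hpowS n) in IH; lra.
have [s [us hs]] := geo_cvg hc.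
have sy : nrm s <= nrm y by apply: nrm_cvg_eps us _; exact: nearW.
have es : isq_step y s = s.
  apply/eqP; rewrite -subr_eq0; apply/eqP/nrm_eps => e e0.
  have [N hN] := @hpow_small R 4 e e0.
  have h1 := isq_step_contract hy sy (hu N).
  rewrite -[isq_step y (u N)]/(u N.+1) in h1.
  have h2 := nrm_tri (u N.+1) (isq_step y s) s.
  have h3 := hs N.+1; have h4 := hs N; have h5 := hN _ (leqnn _).
  rewrite (nrmC (u N.+1) s) in h2; rewrite (hpowS N) in h4 h5.
  by have := hpow_gt0 (R := R) N.+1; lra.
exists s; split=> //.
  have e2 : y * ((1 + s) * (1 + s)) = s + s + s * s.
    rewrite -{3 4}es /isq_step -scalerDl -rmorphD /=.
    by rewrite (_ : 2^-1 + 2^-1 = 1 :> R) ?scale1r ?subrK //; lra.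
  rewrite mulrBl mul1r e2 mulrDl mul1r mulrDr mulr1.
  by apply/eqP; rewrite subr_eq -!addrA.
move=> P cP P0 PG; apply: cP us => n.
by elim: n => // n IH; exact: PG.
Qed.

(* [isq y] is (1 - y)^{-1/2}; a junk value when [nrm y > 1/8], as s need not exist. *)
Definition isq y : A := 1 + xget 0 [set s : A | [/\ nrm s <= nrm y,
  (1 - y) * ((1 + s) * (1 + s)) = 1 &
  forall P : set A, seq_closed P -> P 0 ->
    (forall z, P z -> P (isq_step y z)) -> P s]].

Section IsqSpec.
Context (y : A) (hy : nrm y <= 8^-1).

Lemma isq_spec : [/\ nrm (isq y - 1) <= nrm y,
  (1 - y) * (isq y * isq y) = 1 &
  forall P : set A, seq_closed P -> P 0 ->
    (forall z, P z -> P (isq_step y z)) -> P (isq y - 1)].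
Proof.
rewrite /isq; case: xgetP => [s _ [h1 h2 h3]|h].
  by split=> //; rewrite addrC addKr.
by have [s hs] := isq_exists hy; have := h s.
Qed.

Lemma isq_csub S : closed_subalg S -> S y -> S (isq y).
Proof.
move=> hS Sy; have [_ _ h] := isq_spec.
rewrite -(subrK 1 (isq y)); apply: csubD => //; last exact: csub1.
apply: h => [||z Sz]; [exact: csub_closed | exact: csub0 |].
have S1z : S (1 + z) by apply: csubD => //; exact: csub1.
by apply: csubZ => //; apply: csubB => //; do !apply: csubM => //.
Qed.

Lemma isq_comm x : x * y = y * x -> x * isq y = isq y * x.
Proof. exact: isq_csub (csub_commutant x). Qed.

Lemma isq_star : star y = y -> star (isq y) = isq y.
Proof.
move=> ys; have [_ _ h] := isq_spec.
(* The step does not preserve self-adjointness by itself, since the adjoint of y (1 + z)^2 is (1 +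
   z)^2 y; commutation with [y] is therefore carried along. *)
suff [] : star (isq y - 1) = isq y - 1 /\ y * (isq y - 1) = (isq y - 1) * y.
  by rewrite star_sub star_one => /addIr.
apply: (h [set x : A | star x = x /\ y * x = x * y]) => [u l hu ul||z [zs zy]] /=.
- split.
    apply: cvg_eq (ul); rewrite (_ : u = fun n => star (u n)).
      exact: cvg_star.
    by apply/funext => n; case: (hu n).
  have [c _ _ _ _] := csub_commutant y; apply: (c u l) => // n.
  by case: (hu n).
- by rewrite star0 mulr0 mul0r.
have y1z : y * (1 + z) = (1 + z) * y by rewrite mulrDr mulrDl zy mulr1 mul1r.
have y2z : y * ((1 + z) * (1 + z)) = ((1 + z) * (1 + z)) * y.
  by rewrite mulrA y1z -mulrA y1z mulrA.
split.
  rewrite /isq_step star_scale conjC_re star_sub !star_mul star_add star_one zs ys.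
  by rewrite y2z.
rewrite /isq_step -scalerAr -scalerAl mulrBr mulrBl -mulrA -y2z.
by congr (_ *: (_ - _)); rewrite mulrA zy -mulrA zy mulrA.
Qed.

Lemma isq_nrm : nrm (isq y - 1) <= nrm y. Proof. by case: isq_spec. Qed.

Lemma isqP : (1 - y) * (isq y * isq y) = 1. Proof. by case: isq_spec. Qed.

Lemma isqP2 : isq y * (1 - y) * isq y = 1.
Proof.
have c : (1 - y) * isq y = isq y * (1 - y).
  by apply: isq_comm; rewrite mulrBr mulrBl mul1r mulr1.
by rewrite -c -mulrA isqP.
Qed.

End IsqSpec.

Lemma cvg_isq (u : nat -> A) : u n @[n --> \oo] --> (0 : A) ->
  isq (u n) @[n --> \oo] --> (1 : A).
Proof.
move=> hu; apply: (cvg_nrm_le (C := 1)) (hu).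
have : \forall n \near \oo, nrm (0 - u n) < 8^-1.
  by apply: cvg_nrm_lt => //; lra.
apply: filterS => n; rewrite sub0r nrmN => hn.
by rewrite mul1r nrmC isq_nrm // ltW.
Qed.

End InverseSqrt.

Section Contractive.
Context {R : realType}.

(* v = h + i (1 - h^2)^{1/2} *)
Lemma half_unitary (A : cstarAlgType R) (h : A) : selfadjoint h ->
  nrm h <= 4^-1 -> exists2 v, unitary v & h = (2^-1 : R)%:C *: (v + star v).
Proof.
move=> hs hn; set y := h * h.
have hy : nrm y <= 8^-1.
  have := nrmM h h; have := nrm_ge0 h; rewrite -/y; nra.
have ys : star y = y by rewrite /y star_mul hs.
have hc : h * isq y = isq y * h by apply: isq_comm => //; rewrite /y mulrA.
have rs := isq_star hy ys.
have yc : (1 - y) * isq y = isq y * (1 - y).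
  by apply: isq_comm => //; rewrite mulrBr mulrBl mul1r mulr1.
set k := (1 - y) * isq y.
have ks : star k = k.
  by rewrite /k star_mul rs star_sub star_one ys yc.
have kk : k * k = 1 - y.
  by rewrite {1}/k /k -mulrA (mulrA (isq y)) -yc -!mulrA isqP // mulr1.
have hk : h * k = k * h.
  rewrite /k mulrA -[RHS]mulrA -hc [RHS]mulrA; congr (_ * _).
  by rewrite mulrBr mulrBl mulr1 mul1r /y mulrA.
have vs : star (h + 'i%C *: k) = h - 'i%C *: k.
  by rewrite star_add hs star_scale ks conjC_i scaleNr.
have ii : ('i%C * 'i%C : R[i]) = -1 by rewrite -expr2 sqr_i.
exists (h + 'i%C *: k).
  rewrite /unitary vs; split.
    rewrite mulrBl !mulrDr -!scalerAl -!scalerAr scalerA ii kk hk scaleN1r.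
    by rewrite opprB addrACA subrr addr0 -/y addrC subrK.
  rewrite mulrBr !mulrDl -!scalerAl -!scalerAr scalerA ii kk hk scaleN1r.
  by rewrite opprB addrACA subrr addr0 -/y addrC subrK.
rewrite vs addrACA subrr addr0 scalerDr -scalerDl -rmorphD /=.
by rewrite (_ : 2^-1 + 2^-1 = 1 :> R) ?scale1r //; lra.
Qed.

(** If a > b, Bernoulli's inequality makes (a / b)^(2^n) exceed any C. The exponents 2^n are those
    at which the C*-identity computes the norm of a power of a self-adjoint element. *)
Lemma pow2_le (a b C : R) : 0 <= a -> 0 <= b ->
  (forall n, a ^+ (2 ^ n) <= C * b ^+ (2 ^ n)) -> a <= b.
Proof.
move=> a0 b0 h; rewrite leNgt; apply/negP => ab.
case: (eqVneq b 0) => [bz|bz].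
  by have := h 0%N; rewrite bz expn0 !expr1; lra.
have bp : 0 < b by rewrite lt_neqAle eq_sym bz.
set d := a / b - 1.
have d0 : 0 < d by rewrite subr_gt0 ltr_pdivlMr // mul1r.
have B n : 1 + n%:R * d <= (1 + d) ^+ n.
  elim: n => [|n IH]; first by rewrite mul0r addr0 expr0.
  rewrite exprS -natr1; have : 0 <= n%:R :> R by [].
  by move: (n%:R : R) ((1 + d) ^+ n) IH => x y; nra.
pose n := Num.bound `|C / d|.
have hn : C < n%:R * d.
  rewrite -ltr_pdivrMr //; apply: le_lt_trans (ler_norm _) _.
  exact: archi_boundP (normr_ge0 _).
have := h n; rewrite -ler_pdivrMr ?exprn_gt0 // -expr_div_n.
have -> : a / b = 1 + d by rewrite /d addrC subrK.
have h1 := B (2 ^ n)%N; have : n%:R * d <= (2 ^ n)%:R * d.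
  by apply: ler_wpM2r; [exact: ltW | rewrite ler_nat ltnW // ltn_expl].
lra.
Qed.

Lemma sa_pow (A : cstarAlgType R) (h : A) n : selfadjoint h -> selfadjoint (h ^+ n).
Proof.
rewrite /selfadjoint => hs; elim: n => [|n IH]; first by rewrite expr0 star_one.
by rewrite exprSr star_mul IH hs -exprS exprSr.
Qed.

Section StarHomNorm.
Context {A B : cstarAlgType R} {f : A -> B} (fh : star_hom f).

(** Unitaries go to unitaries, of norm 1. The factor 4 comes from [half_unitary], which asks for
    norm at most 1/4. *)
Lemma shom_sa_bound h : selfadjoint h -> nrm (f h) <= 4 * nrm h.
Proof.
move=> hs; case: (eqVneq (nrm h) 0) => [/nrm_eq0 ->|h0].
  by rewrite (shom0 fh) !nrm0 mulr0 lexx.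
have hp : 0 < nrm h by rewrite lt_neqAle eq_sym h0 nrm_ge0.
set c := (4 * nrm h)^-1.
have cp : 0 < c by rewrite invr_gt0; lra.
have [] := @half_unitary _ (c%:C *: h).
- by rewrite /selfadjoint star_scale conjC_re hs.
- by rewrite nrmZ nrm_real gtr0_norm // /c invfM -mulrA mulVf // mulr1.
move=> v hv e.
have : nrm (f (c%:C *: h)) <= 1.
  rewrite e (shomZ fh) (shomD fh) (shom_star fh) nrm_half.
  have := nrmD (f v) (star (f v)); rewrite nrm_star.
  by rewrite (unitary_nrm (shom_unitary fh hv)); lra.
rewrite (shomZ fh) nrmZ nrm_real gtr0_norm // /c -ler_pdivlMl ?invr_gt0; last by lra.
by rewrite invrK mulr1.
Qed.

Lemma nrm_sa_pow (D : cstarAlgType R) (h : D) n : selfadjoint h ->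
  nrm (h ^+ (2 ^ n)) = nrm h ^+ (2 ^ n).
Proof.
move=> hs; elim: n => [|n IH]; first by rewrite expn0 !expr1.
by rewrite expnSr !exprM -IH -nrm_cstar (sa_pow _ hs) expr2.
Qed.

(* The C*-identity at h^(2^n) turns the constant 4 into 4^(2^-n). *)
Lemma shom_sa_le h : selfadjoint h -> nrm (f h) <= nrm h.
Proof.
move=> hs; apply: (@pow2_le _ _ 4) => [||n]; rewrite ?nrm_ge0 //.
have fs : selfadjoint (f h) by rewrite /selfadjoint -(shom_star fh) hs.
rewrite -!nrm_sa_pow // -(shomX fh); apply: shom_sa_bound; exact: sa_pow.
Qed.

Lemma shom_le x : nrm (f x) <= nrm x.
Proof.
rewrite -(@ler_pXn2r _ 2) ?nnegrE ?nrm_ge0 // -!nrm_cstar.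
rewrite -(shom_star fh) -(shomM fh); apply: shom_sa_le.
by rewrite /selfadjoint star_mul starK.
Qed.

Lemma cvg_shom T (F : set_system T) {FF : Filter F} (g : T -> A) (a : A) :
  g t @[t --> F] --> a -> f (g t) @[t --> F] --> f a.
Proof.
apply: (cvg_nrm_le (C := 1)); apply: nearW => t.
by rewrite mul1r -(shomB fh) shom_le.
Qed.

End StarHomNorm.

Lemma siso_nrm (A B : cstarAlgType R) (f : A -> B) x : star_iso f ->
  nrm (f x) = nrm x.
Proof.
move=> [fh [g fg gf]]; apply/eqP; rewrite eq_le (shom_le fh) /=.
by rewrite -{1}(fg x); apply: shom_le; exact: star_hom_inv fg gf.
Qed.

End Contractive.

(** * Exponentials *)

Section CauchyProduct.

(** The right-hand side collects the pairs i, j < n with i + j >= n. Over a general ring the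
    identity serves both the series in [A] and the real series that dominates it. *)
Lemma cauchy_product_tail (K : pzRingType) (f g : nat -> K) n :
  (\sum_(0 <= i < n) f i) * (\sum_(0 <= i < n) g i)
    - \sum_(0 <= k < n) \sum_(0 <= i < k.+1) f (k - i)%N * g i
  = \sum_(0 <= i < n) \sum_(n - i <= j < n) f j * g i.
Proof.
have -> : \sum_(0 <= k < n) \sum_(0 <= i < k.+1) f (k - i)%N * g i =
          \sum_(0 <= i < n) \sum_(0 <= j < n - i) f j * g i.
  rewrite (eq_big_nat _ _ (F2 := fun k => \sum_(0 <= i < n | (i < k.+1)%N) f (k - i)%N * g i)); last first.
    move=> k /andP[_ kn]; rewrite (big_nat_widen _ _ n) //.
  rewrite (exchange_big_dep_nat predT) //=.
  apply: eq_big_nat => i /andP[_ lin].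
  rewrite -(big_nat_widenl i 0 n predT (fun k => f (k - i)%N * g i)) //.
  rewrite -{1}(add0n i) big_addn; apply: eq_bigr => j _.
  by rewrite addnK.
rewrite mulr_sumr -sumrB; apply: eq_big_nat => i /andP[_ lin].
by rewrite mulr_suml (big_cat_nat (n := (n - i)%N)) ?leq_subr //= addrAC subrr add0r.
Qed.

(** This is the binomial theorem in the shape of a Cauchy product; it is used for [A] over [R[i]]
    and for [R] over itself. *)
Lemma exp_termD (F : numFieldType) (L : algType F) (x y : L) n : x * y = y * x ->
  (n`!%:R^-1 : F) *: (x + y) ^+ n =
  \sum_(0 <= i < n.+1) ((n - i)`!%:R^-1 *: x ^+ (n - i)) * (i`!%:R^-1 *: y ^+ i).
Proof.
move=> xy; rewrite exprDn_comm // big_mkord scaler_sumr.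
apply: eq_bigr => i _; have lin : (i <= n)%N by rewrite -ltnS.
rewrite -scalerAl -scalerAr scalerA -scalerMnr scalerMnl -mulr_natr; congr (_ *: _).
have u k : (k`!%:R : F) != 0 by rewrite pnatr_eq0 -lt0n fact_gt0.
apply: (mulfI (u n)); rewrite mulrA divff // mul1r.
by rewrite -(bin_fact lin) !natrM; field; rewrite !u.
Qed.

End CauchyProduct.

Section Exponential.
Context {R : realType}.

Lemma expR_term (a : R) n : exp_coeff a n = n`!%:R^-1 * a ^+ n.
Proof. by rewrite /exp_coeff /= mulrC. Qed.

Lemma expR_series_le (a : R) n : 0 <= a -> series (exp_coeff a) n <= expR a.
Proof.
move=> a0; apply: nondecreasing_cvgn_le; last exact: is_cvg_series_exp_coeff.
apply: nondecreasing_series => k _ _; exact: exp_coeff_ge0.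
Qed.

Context {A : cstarAlgType R}.
Implicit Types x y h : A.

Definition cexp_term x (n : nat) : A := (n`!%:R^-1 : R[i]) *: x ^+ n.

Lemma nrm_pow x n : nrm (x ^+ n) <= nrm x ^+ n.
Proof.
elim: n => [|n IH]; first by rewrite !expr0 nrm_one.
rewrite !exprS; apply: le_trans (nrmM _ _) _.
by apply: ler_wpM2l => //; exact: nrm_ge0.
Qed.

Lemma nrm_invn n : nrm (n%:R^-1 : R[i]) = n%:R^-1 :> R.
Proof.
have -> : (n%:R^-1 : R[i]) = (n%:R^-1 : R)%:C by rewrite fmorphV rmorph_nat.
by rewrite nrm_real ger0_norm // invr_ge0.
Qed.

Lemma nrm_cexp_term x n : nrm (cexp_term x n) <= exp_coeff (nrm x) n.
Proof.
rewrite /cexp_term nrmZ nrm_invn expR_term; apply: ler_wpM2l.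
  by rewrite invr_ge0.
exact: nrm_pow.
Qed.

Lemma cvg_cexp x : series (cexp_term x) n @[n --> \oo] --> cexp x.
Proof.
suff : cvg (series (cexp_term x) n @[n --> \oo]) by [].
have [|l] := @nrm_cauchy R A (series (cexp_term x)); last by move=> h; apply/cvg_ex; exists l.
move=> e e0; have /cvgrPdist_lt := @is_cvg_series_exp_coeff R (nrm x).
have e2 : 0 < e / 2 by lra.
move=> /(_ _ e2)/near_ooP[N hN]; exists N => n Nn.
rewrite sub_series_geq //; apply: le_lt_trans (nrm_sum _ _ _) _.
apply: (@le_lt_trans _ _ (series (exp_coeff (nrm x)) n - series (exp_coeff (nrm x)) N)).
  by rewrite sub_series_geq //; apply: ler_sum => i _; exact: nrm_cexp_term.
have := hN n Nn; have := hN N (leqnn N).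
rewrite -!/(expR (nrm x)) !ltr_norml => /andP[a1 a2] /andP[b1 b2].
lra.
Qed.

Lemma nrm_powB x y (M : R) n : nrm x <= M -> nrm y <= M ->
  nrm (x ^+ n.+1 - y ^+ n.+1) <= n.+1%:R * M ^+ n * nrm (x - y).
Proof.
move=> hx hy; have M0 : 0 <= M by apply: le_trans hx; exact: nrm_ge0.
elim: n => [|n IH]; first by rewrite !expr1 expr0 !mul1r.
have -> : x ^+ n.+2 - y ^+ n.+2 = x * (x ^+ n.+1 - y ^+ n.+1) + (x - y) * y ^+ n.+1.
  by rewrite (exprS x) (exprS y) mulrBr mulrBl addrA subrK.
apply: le_trans (nrmD _ _) _.
have h1 := nrmM x (x ^+ n.+1 - y ^+ n.+1); have h2 := nrmM (x - y) (y ^+ n.+1).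
have h3 : nrm x * nrm (x ^+ n.+1 - y ^+ n.+1) <= M * (n.+1%:R * M ^+ n * nrm (x - y)).
  by apply: ler_pM => //; exact: nrm_ge0.
have h4 : nrm (x - y) * nrm (y ^+ n.+1) <= nrm (x - y) * M ^+ n.+1.
  apply: ler_wpM2l; first exact: nrm_ge0.
  by apply: le_trans (nrm_pow _ _) _; rewrite lerXn2r // ?nnegrE // nrm_ge0.
have -> : n.+2%:R * M ^+ n.+1 * nrm (x - y) =
    M * (n.+1%:R * M ^+ n * nrm (x - y)) + nrm (x - y) * M ^+ n.+1.
  by rewrite -(natr1 n.+1) exprS; ring.
lra.
Qed.

Lemma cexp_lip x y (M : R) : nrm x <= M -> nrm y <= M ->
  nrm (cexp x - cexp y) <= expR M * nrm (x - y).
Proof.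
move=> hx hy; have M0 : 0 <= M by apply: le_trans hx; exact: nrm_ge0.
apply: (@nrm_cvg_eps _ _ (fun n => series (cexp_term x) n - series (cexp_term y) n)).
  by apply: cvgB; exact: cvg_cexp.
(* The terms of order 0 cancel, so the sum starts at order 1, where (i + 1) M^i / (i + 1)! = M^i /
   i!. *)
apply/near_ooP; exists 1%N => -[//|n] _.
rewrite /series /= -sumrB big_nat_recl //= /cexp_term !expr0 subrr add0r.
apply: le_trans (nrm_sum _ _ _) _.
apply: (@le_trans _ _ (series (exp_coeff M) n * nrm (x - y))); last first.
  by apply: ler_wpM2r; [exact: nrm_ge0 | exact: expR_series_le].
rewrite /series /= mulr_suml; apply: ler_sum => i _.
rewrite -scalerBr nrmZ nrm_invn expR_term.
apply: (@le_trans _ _ ((i.+1)`!%:R^-1 * (i.+1%:R * M ^+ i * nrm (x - y)))).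
  by apply: ler_wpM2l; [rewrite invr_ge0 | exact: nrm_powB].
rewrite factS natrM invfM; have : (i.+1%:R : R) != 0 by rewrite pnatr_eq0.
move: (i.+1%:R : R) (i`!%:R^-1 : R) (M ^+ i) => a b c a0.
rewrite [leLHS](_ : _ = b * c * nrm (x - y)) //.
by field.
Qed.

(* The tail of the Cauchy product is dominated by that of exp(|x|) exp(|y|), which tends to 0. *)
Lemma cexpD x y : x * y = y * x -> cexp (x + y) = cexp x * cexp y.
Proof.
move=> xy; apply/esym/eqP; rewrite -subr_eq0; apply/eqP.
pose u n := series (cexp_term x) n * series (cexp_term y) n - series (cexp_term (x + y)) n.
have hu : u n @[n --> \oo] --> cexp x * cexp y - cexp (x + y).
  by apply: cvgB; [apply: cvg_mul|]; exact: cvg_cexp.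
apply: (cvg_eq hu); pose a := nrm x; pose b := nrm y.
pose v (n : nat) : R := series (exp_coeff a) n * series (exp_coeff b) n - series (exp_coeff (a + b)) n.
have hv : v n @[n --> \oo] --> (0 : R).
  rewrite -(subrr (expR (a + b))) {1}expRD.
  by apply: cvgB; [apply: cvgM|]; exact: is_cvg_series_exp_coeff.
apply/cvg_nrmP => e e0; have /cvgrPdist_lt := hv => /(_ _ e0).
apply: filterS => n; rewrite !sub0r nrmN normrN; apply: le_lt_trans.
apply: le_trans (ler_norm _).
have -> : u n = \sum_(0 <= i < n) \sum_(n - i <= j < n) cexp_term x j * cexp_term y i.
  rewrite -cauchy_product_tail /u; congr (_ - _); apply: eq_bigr => i _.
  exact: exp_termD.
have -> : v n = \sum_(0 <= i < n) \sum_(n - i <= j < n) exp_coeff a j * exp_coeff b i.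
  rewrite -cauchy_product_tail /v; congr (_ - _); apply: eq_bigr => i _.
  rewrite expR_term; apply: etrans (@exp_termD R R^o a b i (mulrC a b)) _.
  by apply: eq_bigr => j _; rewrite !expR_term.
apply: le_trans (nrm_sum _ _ _) _; apply: ler_sum => i _.
apply: le_trans (nrm_sum _ _ _) _; apply: ler_sum => j _.
apply: le_trans (nrmM _ _) _.
by apply: ler_pM; rewrite ?nrm_ge0 ?nrm_cexp_term.
Qed.

Lemma cexp0 : cexp (0 : A) = 1.
Proof.
apply: (cvg_eq (@cvg_cexp 0)); apply: cvg_near_cst; apply/near_ooP; exists 1%N => -[//|n] _.
rewrite /series /= big_nat_recl //= big1 ?addr0 => [|i _]; rewrite /cexp_term.
  by rewrite expr0 invr1 scale1r.
by rewrite expr0n /= scaler0.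
Qed.

Lemma star_cexp x : star (cexp x) = cexp (star x).
Proof.
apply: cvg_eq (@cvg_cexp (star x)).
rewrite (_ : series _ = fun n => star (series (cexp_term x) n)).
  by apply: cvg_star; exact: cvg_cexp.
apply/funext => n; rewrite /series /= star_sum; apply: eq_bigr => i _.
rewrite /cexp_term star_scale; congr (_ *: _).
  by rewrite fmorphV rmorph_nat.
by elim: i => [|i IH]; rewrite ?expr0 ?star_one // exprS exprSr star_mul IH.
Qed.

Lemma csub_cexp S x : closed_subalg S -> S x -> S (cexp x).
Proof.
move=> hS Sx; apply: (csub_closed hS) (@cvg_cexp x) => n.
by apply: csub_sum => // i _; apply: csubZ => //; exact: csubX.
Qed.

Definition uexp h (t : R) : A := cexp (('i%C * t%:C) *: h).

Lemma uexp0 h : uexp h 0 = 1.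
Proof. by rewrite /uexp mulr0 scale0r cexp0. Qed.

Lemma uexpD h s t : uexp h (s + t) = uexp h s * uexp h t.
Proof.
rewrite /uexp rmorphD mulrDr scalerDl cexpD //.
by rewrite -!scalerAr -!scalerAl scalerA scalerA mulrC.
Qed.

Lemma star_uexp h t : selfadjoint h -> star (uexp h t) = uexp h (- t).
Proof.
move=> hs; rewrite /uexp star_cexp star_scale hs rmorphM /= conjC_i conjC_re.
by rewrite rmorphN mulrN mulNr.
Qed.

Lemma uexp_unitary h t : selfadjoint h -> unitary (uexp h t).
Proof.
by move=> hs; split; rewrite star_uexp // -uexpD ?addNr ?subrr uexp0.
Qed.

Lemma nrm_it (t : R) h : nrm (('i%C * t%:C) *: h) = `|t| * nrm h.
Proof.
rewrite nrmZ; congr (_ * _); rewrite /nrm normc_def /= !(mul0r, mul1r, addr0, add0r, mulr0, subr0).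
by rewrite oppr0 expr0n add0r sqrtr_sqr.
Qed.

Lemma uexp_lip_t h (T s t : R) : `|s| <= T -> `|t| <= T ->
  nrm (uexp h s - uexp h t) <= expR (T * nrm h) * (`|s - t| * nrm h).
Proof.
move=> hs ht; have n0 := nrm_ge0 h; have -> : `|s - t| * nrm h =
    nrm (('i%C * s%:C) *: h - ('i%C * t%:C) *: h).
  by rewrite -scalerBl -mulrBr -rmorphB nrm_it.
by apply: cexp_lip; rewrite nrm_it; exact: ler_wpM2r.
Qed.

Lemma uexp_lip_h h k (T M t : R) : `|t| <= T -> nrm h <= M -> nrm k <= M ->
  nrm (uexp h t - uexp k t) <= expR (T * M) * (T * nrm (h - k)).
Proof.
move=> ht hh hk; have n0 := nrm_ge0 h; have T0 := normr_ge0 t.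
apply: (@le_trans _ _ (expR (T * M) * nrm (('i%C * t%:C) *: h - ('i%C * t%:C) *: k))).
  by apply: cexp_lip; rewrite nrm_it; apply: ler_pM => //; exact: nrm_ge0.
rewrite -scalerBr nrm_it; apply: ler_wpM2l; first exact: expR_ge0.
by apply: ler_wpM2r => //; exact: nrm_ge0.
Qed.

Lemma uexp_continuous h : continuous (uexp h).
Proof.
move=> t; apply/cvg_nrmP => e e0.
have n0 := nrm_ge0 h; set K := expR ((`|t| + 1) * nrm h) * nrm h + 1.
have K0 : 0 < K by rewrite ltr_wpDl // mulr_ge0 // expR_ge0.
near=> s.
have st : `|t - s| < Num.min 1 (e / K).
  near: s; apply: (cvgrPdist_lt _ _).1; first exact: cvg_id.
  by rewrite lt_min ltr01 divr_gt0.
move: st; rewrite lt_min ltr_pdivlMr // => /andP[h1 h2].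
have hs : `|s| <= `|t| + 1.
  have := ler_normD t (s - t); rewrite addrC subrK distrC; lra.
apply: le_lt_trans (uexp_lip_t h _ hs) _; first by lra.
apply: le_lt_trans h2; rewrite mulrCA; apply: ler_wpM2l => //.
by rewrite /K; lra.
Unshelve. all: by end_near.
Qed.

End Exponential.

(** * Matrix units *)

Section MatrixUnits.
Context {R : realType}.

Lemma cvg_bigsum (V : normedModType R[i]) T (F : set_system T) {FF : Filter F}
    (J : Type) (r : seq J) (f : J -> T -> V) (l : J -> V) :
  (forall j, f j t @[t --> F] --> l j) ->
  (\sum_(j <- r) f j t) @[t --> F] --> \sum_(j <- r) l j.
Proof.
move=> h; elim: r => [|j r IH].
  by rewrite big_nil; under eq_fun do rewrite big_nil; exact: cvg_cst.
by rewrite big_cons; under eq_fun do rewrite big_cons; exact: cvgD.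
Qed.

Lemma nrm_ge_Re (z : R[i]) : `|complex.Re z| <= nrm z.
Proof. by rewrite /nrm normc_def /= -sqrtr_sqr ler_wsqrtr // lerDl sqr_ge0. Qed.

Lemma nrm_ge_Im (z : R[i]) : `|complex.Im z| <= nrm z.
Proof. by rewrite /nrm normc_def /= -sqrtr_sqr ler_wsqrtr // lerDr sqr_ge0. Qed.

Lemma nrm_le_ReIm (z : R[i]) : nrm z <= `|complex.Re z| + `|complex.Im z|.
Proof.
have i1 : nrm ('i%C : R[i]) = 1.
  by rewrite /nrm normc_def /= expr0n add0r expr1n sqrtr1.
rewrite {1}(complexE z); apply: le_trans (nrmD _ _) _; rewrite nrm_real lerD2l.
have := @nrmZ R R[i]^o 'i%C (complex.Im z)%:C.
by rewrite i1 mul1r nrm_real => <-.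
Qed.

(** A general finite index type lets tensor products of systems be indexed by pairs. *)
Record munits (A : cstarAlgType R) (I : finType) (e : I -> I -> A) : Prop :=
  MUnits {
    mu_mul : forall i j k l, e i j * e k l = if j == k then e i l else 0;
    mu_star : forall i j, star (e i j) = e j i;
    mu_one : \sum_i e i i = 1
  }.

Definition mspan (A : cstarAlgType R) (I : finType) (e : I -> I -> A) : set A :=
  [set x | exists c : I -> I -> R[i], x = \sum_i \sum_j c i j *: e i j].

Lemma sum_if_eq (V : nmodType) (I : finType) (k : I) (F : I -> V) :
  \sum_i (if i == k then F i else 0) = F k.
Proof. by rewrite -big_mkcond big_pred1_eq. Qed.

Lemma sum_if_eq' (V : nmodType) (I : finType) (k : I) (F : I -> V) :
  \sum_i (if k == i then F i else 0) = F k.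
Proof. by under eq_bigr do rewrite eq_sym; exact: sum_if_eq. Qed.

Section Basic.
Context {A : cstarAlgType R} {I : finType} {e : I -> I -> A} (he : munits e).

Lemma mu_mulr i j k : e i j * e j k = e i k.
Proof. by rewrite (mu_mul he) eqxx. Qed.

Lemma mu_mul0 i j k l : j != k -> e i j * e k l = 0.
Proof. by rewrite (mu_mul he) => /negPf ->. Qed.

Lemma mspan_unit i j : mspan e (e i j).
Proof.
exists (fun k l => ((k == i) && (l == j))%:R).
rewrite (bigD1 i) //= (bigD1 j) //= !eqxx scale1r big1 => [|l /negPf lj].
  rewrite big1 ?addr0 // => k /negPf ki; rewrite big1 // => l _.
  by rewrite ki scale0r.
by rewrite lj andbF scale0r.
Qed.

(** This expansion holds on the whole algebra, with coefficients in the commutant of [e] in place of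
    scalars. They depend continuously on [x], which gives closedness of the span and, later, norm
    estimates through a homomorphism. *)
Lemma mspan_decomp x : x = \sum_i \sum_j (\sum_p e p i * x * e j p) * e i j.
Proof.
transitivity (\sum_i \sum_j e i i * x * e j j).
  under eq_bigr do rewrite -mulr_sumr (mu_one he) mulr1.
  by rewrite -mulr_suml (mu_one he) mul1r.
apply: eq_bigr => i _; apply: eq_bigr => j _; rewrite mulr_suml.
rewrite -(sum_if_eq i (fun p => e i i * x * e j j)); apply: eq_bigr => p _.
rewrite -[RHS]mulrA (mu_mul he); case: eqP => [->//|_].
by rewrite mulr0.
Qed.

Lemma mspanD x y : mspan e x -> mspan e y -> mspan e (x + y).
Proof.
move=> [c ->] [d ->]; exists (fun i j => c i j + d i j).
rewrite -big_split; apply: eq_bigr => i _; rewrite -big_split.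
by apply: eq_bigr => j _; rewrite scalerDl.
Qed.

Lemma mspanZ a x : mspan e x -> mspan e (a *: x).
Proof.
move=> [c ->]; exists (fun i j => a * c i j); rewrite scaler_sumr.
apply: eq_bigr => i _; rewrite scaler_sumr.
by apply: eq_bigr => j _; rewrite scalerA.
Qed.

Lemma mspan0 : mspan e 0.
Proof.
exists (fun _ _ => 0); rewrite big1 // => i _; rewrite big1 // => j _.
by rewrite scale0r.
Qed.

Lemma mspan_bigsum (J : Type) (r : seq J) (P : pred J) (F : J -> A) :
  (forall i, P i -> mspan e (F i)) -> mspan e (\sum_(i <- r | P i) F i).
Proof. by move=> h; elim/big_ind: _ => //; [exact: mspan0 | exact: mspanD]. Qed.

Lemma mspan_ind (P : A -> Prop) :
  P 0 -> (forall x y, P x -> P y -> P (x + y)) ->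
  (forall (a : R[i]) x, P x -> P (a *: x)) -> (forall i j, P (e i j)) ->
  forall x, mspan e x -> P x.
Proof.
move=> P0 PD PZ Pe _ [c ->]; elim/big_ind: _ => // i _.
by elim/big_ind: _ => // j _; exact: PZ.
Qed.

Lemma mspan_mul x y : mspan e x -> mspan e y -> mspan e (x * y).
Proof.
move=> hx; move: y; apply: mspan_ind => [|y z|a y|k l].
- by rewrite mulr0; exact: mspan0.
- by rewrite mulrDr; exact: mspanD.
- by rewrite -scalerAr; exact: mspanZ.
move: x hx; apply: mspan_ind => [|y z|a y|i j].
- by rewrite mul0r; exact: mspan0.
- by rewrite mulrDl; exact: mspanD.
- by rewrite -scalerAl; exact: mspanZ.
by rewrite (mu_mul he); case: eqP => _; [exact: mspan_unit | exact: mspan0].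
Qed.

Lemma mspan_one : mspan e 1.
Proof. by rewrite -(mu_one he); apply: mspan_bigsum => i _; exact: mspan_unit. Qed.

Lemma mspan_star x : mspan e x -> mspan e (star x).
Proof.
move: x; apply: mspan_ind => [|x y|a x|i j].
- by rewrite star0; exact: mspan0.
- by rewrite star_add; exact: mspanD.
- by rewrite star_scale; exact: mspanZ.
by rewrite (mu_star he); exact: mspan_unit.
Qed.

Lemma mspan_coef x i j : mspan e x ->
  exists c : R[i], \sum_p e p i * x * e j p = c *: 1.
Proof.
move: x; apply: mspan_ind => [|x y [c hc] [d hd]|a x [c hc]|k l].
- by exists 0; rewrite scale0r big1 // => p _; rewrite mulr0 mul0r.
- exists (c + d); rewrite scalerDl -hc -hd -big_split.
  by apply: eq_bigr => p _; rewrite mulrDr mulrDl.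
- exists (a * c); rewrite -scalerA -hc scaler_sumr.
  by apply: eq_bigr => p _; rewrite -scalerAr -scalerAl.
exists ((i == k) && (l == j))%:R; case: eqP => [->|/eqP ik] /=; last first.
  by rewrite scale0r big1 // => p _; rewrite mu_mul0 ?mul0r.
case: eqP => [->|/eqP lj] /=.
  rewrite scale1r -(mu_one he); apply: eq_bigr => p _.
  by rewrite !mu_mulr.
by rewrite scale0r big1 // => p _; rewrite mu_mulr mu_mul0.
Qed.

(** As [nrm (c *: 1) = nrm c], the scalars form a Cauchy sequence; their real and imaginary parts
    converge separately. *)
Lemma scalars_closed : seq_closed [set x : A | exists c : R[i], x = c *: 1].
Proof.
move=> u l hu ul; have [c hc] := choice hu.
have Cau (f : R[i] -> R) : (forall x y, `|f x - f y| <= nrm (x - y)) ->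
    exists a : R, (f (c n) @[n --> \oo] --> a).
  move=> hf; suff : cvg (f (c n) @[n --> \oo]) by move=> h; exists (lim (f (c n) @[n --> \oo])).
  apply/cauchy_cvgP/cauchyP => eps eps0.
  have /near_ooP[N hN] := cvg_nrm_lt ul (e := eps / 2) ltac:(by lra).
  exists (f (c N)); exists N => // n /= Nn.
  rewrite -ball_normE /=; apply: le_lt_trans (hf _ _) _.
  have := hN N (leqnn N); have := hN n Nn; rewrite !hc => h1 h2.
  have := nrm_tri l (c N *: 1) (c n *: 1).
  rewrite -scalerBl nrmZ nrm_one mulr1 (nrmC _ l).
  by move: h1 h2 => /[swap]; lra.
have [a ha] := Cau (@complex.Re R) (fun x y => ltac:(rewrite -raddfB; exact: nrm_ge_Re)).
have [b hb] := Cau (@complex.Im R) (fun x y => ltac:(rewrite -raddfB; exact: nrm_ge_Im)).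
exists (a +i* b); apply: (cvg_eq ul); apply/cvg_nrmP => eps eps0.
have e2 : 0 < eps / 2 by lra.
have /cvgrPdist_lt/(_ _ e2) := ha; have /cvgrPdist_lt/(_ _ e2) := hb.
apply: filterS2 => n h1 h2; rewrite hc -scalerBl nrmZ nrm_one mulr1.
have := nrm_le_ReIm ((a +i* b) - c n); case: (c n) h1 h2 => p q /=; lra.
Qed.

(** The coefficients of the limit are limits of scalars, hence scalars. *)
Lemma mspan_closed : seq_closed (mspan e).
Proof.
move=> u l hu ul.
have H i j : exists c : R[i], \sum_p e p i * l * e j p = c *: 1.
  apply: (@scalars_closed (fun n => \sum_p e p i * u n * e j p)).
    by move=> n; exact: mspan_coef.
  apply: cvg_bigsum => p; apply: cvg_mul; last exact: cvg_cst.
  by apply: cvg_mul => //; exact: cvg_cst.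
rewrite (mspan_decomp l); apply: mspan_bigsum => i _; apply: mspan_bigsum => j _.
have [c ->] := H i j; rewrite -scalerAl mul1r; apply: mspanZ; exact: mspan_unit.
Qed.

Lemma csub_mspan : closed_subalg (mspan e).
Proof.
split; [exact: mspan_closed | exact: mspan_one | exact: mspanD | | exact: mspan_mul].
exact: mspanZ.
Qed.

Lemma mspan_comm z : (forall i j, z * e i j = e i j * z) ->
  forall x, mspan e x -> z * x = x * z.
Proof.
move=> h; apply: mspan_ind => [|x y hx hy|a x hx|//].
- by rewrite mulr0 mul0r.
- by rewrite mulrDr mulrDl hx hy.
- by rewrite -scalerAr -scalerAl hx.
Qed.

End Basic.

Lemma munits_shom (A B : cstarAlgType R) (I : finType) (e : I -> I -> A)
    (f : A -> B) : munits e -> star_hom f -> munits (fun i j => f (e i j)).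
Proof.
move=> he fh; split=> [i j k l|i j|].
- by rewrite -(shomM fh) (mu_mul he); case: eqP => // _; exact: shom0.
- by rewrite -(shom_star fh) (mu_star he).
- by rewrite -(shom_sum fh) (mu_one he) (shom1 fh).
Qed.

(* For commuting systems e and g this unitary exchanges e i j and g i j. *)
Definition mflip (A : cstarAlgType R) (I : finType) (e g : I -> I -> A) : A :=
  \sum_i \sum_j g i j * e j i.

Section Flip.
Context {A : cstarAlgType R} {I : finType}.
Implicit Types e g : I -> I -> A.

Lemma mflip_sym e g : (forall i j k l, e i j * g k l = g k l * e i j) ->
  mflip e g = mflip g e.
Proof.
move=> eg; rewrite /mflip exchange_big; apply: eq_bigr => j _ /=.
by apply: eq_bigr => i _; rewrite eg.
Qed.

Lemma mflip_e e g : munits e -> forall k l, mflip e g * e k l = \sum_j g k j * e j l.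
Proof.
move=> he k l.
rewrite /mflip mulr_suml -(sum_if_eq k (fun i => \sum_j g i j * e j l)).
apply: eq_bigr => i _; rewrite mulr_suml.
case: eqP => [->|/eqP ik]; first by apply: eq_bigr => j _; rewrite -mulrA (mu_mulr he).
by rewrite big1 // => j _; rewrite -mulrA (mu_mul0 he) ?mulr0.
Qed.

Lemma mflip_comm e g : munits e -> munits g ->
  forall k l, mflip e g * e k l = g k l * mflip e g.
Proof.
move=> he hg k l; rewrite mflip_e // /mflip mulr_sumr.
rewrite -(sum_if_eq l (fun i => \sum_j g k j * e j i)).
apply: eq_bigr => i _; rewrite mulr_sumr.
case: eqP => [->|/eqP il]; first by apply: eq_bigr => j _; rewrite mulrA (mu_mulr hg).
by rewrite big1 // => j _; rewrite mulrA (mu_mul0 hg) ?mul0r // eq_sym.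
Qed.

Context {e g : I -> I -> A} (he : munits e) (hg : munits g).
Context (eg : forall i j k l, e i j * g k l = g k l * e i j).

Lemma mflip_star : star (mflip e g) = mflip e g.
Proof.
rewrite (mflip_sym eg) /mflip star_sum exchange_big; apply: eq_bigr => j _ /=.
rewrite star_sum; apply: eq_bigr => i _.
by rewrite star_mul (mu_star he) (mu_star hg) eg.
Qed.

Lemma mflip_sq : mflip e g * mflip e g = 1.
Proof.
have ge i j k l : g i j * e k l = e k l * g i j by rewrite eg.
rewrite {2}/mflip exchange_big mulr_sumr /= -[RHS]mulr1.
rewrite -{1}(mu_one hg) -(mu_one he) mulr_suml; apply: eq_bigr => j _.
rewrite !mulr_sumr; apply: eq_bigr => i _.
rewrite mulrA {1}(mflip_sym eg) (mflip_comm hg he) -(mflip_sym eg) -mulrA.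
rewrite (mflip_e g he) mulr_sumr -(sum_if_eq j (fun k => g j j * e i i)).
apply: eq_bigr => k _; case: eqP => [->|/eqP kj].
  by rewrite mulrA -ge -mulrA (mu_mulr he).
by rewrite mulrA -ge -mulrA (mu_mul0 he) ?mulr0 // eq_sym.
Qed.

Lemma mflip_unitary : unitary (mflip e g).
Proof. by rewrite /unitary mflip_star mflip_sq. Qed.

Lemma Ad_mflip i j : Ad (mflip e g) (e i j) = g i j.
Proof. by rewrite /Ad mflip_star mflip_comm // -mulrA mflip_sq mulr1. Qed.

End Flip.
End MatrixUnits.

(** * Unitary conjugacy of matrix units in a matrix algebra *)

Section MatrixConjugacy.
Local Open Scope sesquilinear_scope.
Context {C : numClosedFieldType}.

Lemma trmxC_mul m n p (A : 'M[C]_(m, n)) (B : 'M[C]_(n, p)) :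
  (A *m B) ^t Num.conj = B ^t Num.conj *m A ^t Num.conj.
Proof. by rewrite trmx_mul map_mxM. Qed.

(** Gram-Schmidt turns a basis of the row space of [p] into the rows of [Q]; a self-adjoint
    projection is determined by its range. *)
Lemma mx_proj_factor n (p : 'M[C]_n) : p *m p = p -> p ^t Num.conj = p ->
  exists r (Q : 'M[C]_(r, n)), Q *m Q ^t Num.conj = 1%:M /\ Q ^t Num.conj *m Q = p.
Proof.
move=> pp ps; pose V := row_base p; pose Q := schmidt V; exists (\rank p), Q.
have QQ : Q *m Q ^t Num.conj = 1%:M.
  by apply/unitarymxP/schmidt_unitarymx; exact: rank_leq_row.
split=> //.
have eQ : (Q :=: p)%MS.
  by apply: eqmx_trans (eq_row_base p); apply: eqmx_schmidt_free; exact: row_base_free.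
have Qp : Q *m p = Q.
  have /submxP[D ->] : (Q <= p)%MS by rewrite eQ.
  by rewrite -mulmxA pp.
have pQQ : p *m (Q ^t Num.conj *m Q) = p.
  have /submxP[D eD] : (p <= Q)%MS by rewrite eQ.
  have -> : p *m (Q ^t Num.conj *m Q) = D *m Q *m (Q ^t Num.conj *m Q) by rewrite -eD.
  by rewrite -mulmxA (mulmxA Q) QQ mul1mx -eD.
(* The adjoint of [pQQ], together with [Qp], identifies the two projections. *)
have : (p *m (Q ^t Num.conj *m Q)) ^t Num.conj = p by rewrite pQQ.
by rewrite !trmxC_mul trmxCK ps -mulmxA Qp.
Qed.

(* The projections M a0 a0 and N a0 a0 have the same rank n / #|I| by a trace count, so some
   partial isometry v maps one onto the other, and U is the sum of the N a a0 v M a0 a. *)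
Lemma mx_units_conj n (I : finType) (M N : I -> I -> 'M[C]_n) (a0 : I) :
  (forall i j k l, M i j *m M k l = if j == k then M i l else 0) ->
  (forall i j, (M i j) ^t Num.conj = M j i) -> \sum_i M i i = 1%:M ->
  (forall i j k l, N i j *m N k l = if j == k then N i l else 0) ->
  (forall i j, (N i j) ^t Num.conj = N j i) -> \sum_i N i i = 1%:M ->
  exists U : 'M[C]_n, [/\ U *m U ^t Num.conj = 1%:M, U ^t Num.conj *m U = 1%:M &
    forall a b, U *m M a b = N a b *m U].
Proof.
move=> Mm Ms M1 Nm Ns N1.
have rk (P : I -> I -> 'M[C]_n) r (Q : 'M[C]_(r, n)) :
    (forall i j k l, P i j *m P k l = if j == k then P i l else 0) ->
    \sum_i P i i = 1%:M -> Q *m Q ^t Num.conj = 1%:M ->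
    Q ^t Num.conj *m Q = P a0 a0 -> (#|I| * r = n)%N.
  move=> Pm P1 Q1 Q2; apply/eqP; rewrite -(eqr_nat C) -(mxtrace1 C n) -P1 raddf_sum /=.
  rewrite (eq_bigr (fun _ => r%:R)) => [|a _].
    by rewrite sumr_const natrM mulr_natl.
  have -> : P a a = P a a0 *m P a0 a by rewrite Pm eqxx.
  by rewrite mxtrace_mulC Pm eqxx -Q2 mxtrace_mulC Q1 mxtrace1.
have [r [Q [Q1 Q2]]] : exists r (Q : 'M[C]_(r, n)),
    Q *m Q ^t Num.conj = 1%:M /\ Q ^t Num.conj *m Q = M a0 a0.
  by apply: mx_proj_factor; rewrite ?Mm ?eqxx ?Ms.
have [r' [S [S1 S2]]] : exists r (Q : 'M[C]_(r, n)),
    Q *m Q ^t Num.conj = 1%:M /\ Q ^t Num.conj *m Q = N a0 a0.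
  by apply: mx_proj_factor; rewrite ?Nm ?eqxx ?Ns.
have I0 : (0 < #|I|)%N by apply/card_gt0P; exists a0.
have er : r' = r.
  apply/eqP; rewrite -(eqn_pmul2l I0).
  by rewrite (rk _ _ _ Mm M1 Q1 Q2) (rk _ _ _ Nm N1 S1 S2).
case: _ / er in Q Q1 Q2.
pose v := S ^t Num.conj *m Q.
pose U := \sum_a N a a0 *m v *m M a0 a.
have Us : U ^t Num.conj = \sum_a M a a0 *m v ^t Num.conj *m N a0 a.
  rewrite /U raddf_sum /= raddf_sum /=; apply: eq_bigr => a _.
  by rewrite -[LHS]/((_ *m _) ^t Num.conj) !trmxC_mul Ms Ns mulmxA.
have vs : v ^t Num.conj = Q ^t Num.conj *m S by rewrite /v trmxC_mul trmxCK.
have UM a b : U *m M a b = N a a0 *m v *m M a0 b.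
  rewrite /U mulmx_suml -(sum_if_eq a (fun i => N a a0 *m v *m M a0 b)).
  apply: eq_bigr => c _; rewrite -mulmxA Mm; case: eqP => [->//|_].
  by rewrite mulmx0.
have NU a b : N a b *m U = N a a0 *m v *m M a0 b.
  rewrite /U mulmx_sumr -(sum_if_eq' b (fun i => N a a0 *m v *m M a0 b)).
  apply: eq_bigr => c _; rewrite !mulmxA Nm; case: eqP => [->//|_].
  by rewrite !mul0mx.
have UU : U *m U ^t Num.conj = 1%:M.
  rewrite Us mulmx_sumr -N1; apply: eq_bigr => a _.
  rewrite !mulmxA UM.
  rewrite -[_ *m M a0 a0 *m _]mulmxA -[_ *m (_ *m _)]mulmxA.
  have -> : M a0 a0 *m v ^t Num.conj = v ^t Num.conj.
    by rewrite -Q2 vs !mulmxA -(mulmxA _ Q) Q1 mulmx1.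
  have -> : v *m v ^t Num.conj = N a0 a0.
    by rewrite vs /v mulmxA -(mulmxA _ Q) Q1 mulmx1.
  by rewrite !Nm eqxx Nm eqxx.
exists U; split=> //; last by move=> a b; rewrite UM NU.
exact: mulmx1C.
Qed.

End MatrixConjugacy.

Lemma cvg_nat_lt (R : realType) (V : normedModType R[i]) (u : nat -> V) (l : V) (e : R) :
  u n @[n --> \oo] --> l -> 0 < e -> \forall n \near \oo, nrm (l - u n) < e.
Proof. exact: cvg_nrm_lt. Qed.

Section FullMatrix.
Context {R : realType} {A : cstarAlgType R} {S : set A}.
Hypotheses (hS : full_matrix_subalgebra S) (S1 : S 1).

Lemma full_matrix_units : exists (k : nat) (e : 'I_k.+1 -> 'I_k.+1 -> A),
  munits e /\ mspan e = S.
Proof.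
have [k [f [fl fm fs fi fS]]] := hS; exists k, (fun i j => f (delta_mx i j)).
have fD x y : f (x + y) = f x + f y by have := fl 1 x y; rewrite !scale1r.
have f0 : f 0 = 0 by apply: (addrI (f 0)); rewrite -fD !addr0.
have fZ c x : f (c *: x) = c *: f x by have := fl c x 0; rewrite f0 !addr0.
have fsum := big_morph f fD f0.
(* [f] is not unital by definition; since 1 lies in its range, [f 1%:M] is a unit for that range and
   hence equals 1. *)
have f1 : f 1%:M = 1.
  have [M _ fM] : range f 1 by rewrite fS.
  by rewrite -[LHS]mulr1 -fM -fm mul1mx.
split; first split.
- by move=> i j k' l; rewrite -fm mul_delta_mx_cond; case: eqP => _.
- by move=> i j; rewrite -fs trmx_delta map_delta_mx.
- by rewrite -fsum -mx1_sum_delta.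
rewrite -fS; apply/seteqP; split=> [_ [c ->]|_ [M _ <-]].
  exists (\matrix_(i, j) c i j) => //; rewrite [X in f X]matrix_sum_delta fsum.
  apply: eq_bigr => i _; rewrite fsum; apply: eq_bigr => j _.
  by rewrite fZ mxE.
exists M; rewrite [X in f X]matrix_sum_delta fsum.
by apply: eq_bigr => i _; rewrite fsum; apply: eq_bigr => j _; rewrite fZ.
Qed.

Lemma csub_full_matrix : closed_subalg S.
Proof. by have [k [e [he <-]]] := full_matrix_units; exact: csub_mspan. Qed.

Lemma full_matrix_star x : S x -> S (star x).
Proof. by have [k [e [he <-]]] := full_matrix_units; exact: mspan_star. Qed.

(** An empty system would give 1 = 0. The conclusion is an index rather than an existence statement,
    so that it can serve directly as the base index [a0]. *)
Lemma munits_inh (I : finType) (e : I -> I -> A) : munits e -> I.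
Proof.
move=> he; case: (pickP (fun _ : I => true)) => [//|h].
suff : false by [].
have := mu_one he; rewrite big1 => [/esym/eqP|i]; last by have := h i.
by rewrite oner_eq0.
Qed.

Lemma full_matrix_conj (I : finType) (e g : I -> I -> A) :
  munits e -> munits g -> (forall i j, S (e i j)) -> (forall i j, S (g i j)) ->
  exists W, [/\ S W, unitary W & forall i j, Ad W (e i j) = g i j].
Proof.
move=> he hg Se Sg; have [k [f [fl fm fs fi fS]]] := hS.
have fD x y : f (x + y) = f x + f y by have := fl 1 x y; rewrite !scale1r.
have f0 : f 0 = 0 by apply: (addrI (f 0)); rewrite -fD !addr0.
have fsum := big_morph f fD f0.
have f1 : f 1%:M = 1.
  have [M _ fM] : range f 1 by rewrite fS.
  by rewrite -[LHS]mulr1 -fM -fm mul1mx.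
have lift (h : I -> I -> A) : munits h -> (forall i j, S (h i j)) ->
    exists M : I -> I -> 'M[R[i]]_k.+1, [/\ forall i j, f (M i j) = h i j,
      forall i j k l, M i j *m M k l = if j == k then M i l else 0,
      forall i j, map_mx Num.conj (M i j)^T = M j i & \sum_i M i i = 1%:M].
  move=> hh Sh; have : forall p : I * I, exists N, f N = h p.1 p.2.
    by move=> [i j]; have := Sh i j; rewrite -fS => -[N _ <-]; exists N.
  move=> /choice[M hM]; exists (fun i j => M (i, j)).
  have hM' i j : f (M (i, j)) = h i j by rewrite hM.
  split=> // [i j k' l|i j|].
  - by apply: fi; rewrite fm !hM' (mu_mul hh); case: eqP.
  - by apply: fi; rewrite fs !hM' (mu_star hh).
  - by apply: fi; rewrite fsum f1 -(mu_one hh); apply: eq_bigr.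
have [M [fM M1 M2 M3]] := lift e he Se; have [N [fN N1 N2 N3]] := lift g hg Sg.
have [U [U1 U2 U3]] := mx_units_conj (munits_inh he) M1 M2 M3 N1 N2 N3.
have hU : unitary (f U) by split; rewrite -fs -fm -?U1 -?U2 ?f1 // ?U1 ?U2 f1.
exists (f U); split=> // [|i j]; first by rewrite -fS; exists U.
by rewrite /Ad -fM -fm U3 fm fN -mulrA hU.2 mulr1.
Qed.

End FullMatrix.

(** * Perturbation of matrix units into a filtration *)

Section Perturbation.
Context {R : realType} {A : cstarAlgType R} {F : nat -> set A}.
Hypothesis filt : UHF_filtration F.

Lemma filt_le m n x : (m <= n)%N -> F m x -> F n x.
Proof.
case: filt => _ h _ _ /subnKC <-; elim: (n - m)%N => [|k IH]; first by rewrite addn0.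
by rewrite addnS => /IH; exact: h.
Qed.

Lemma filt1 n : F n 1.
Proof. by apply: (@filt_le 0) => //; case: filt. Qed.

Lemma filt_mx n : full_matrix_subalgebra (F n). Proof. by case: filt. Qed.

Lemma csub_filt n : closed_subalg (F n).
Proof. exact: csub_full_matrix (filt_mx n) (filt1 n). Qed.

Lemma filt_star n x : F n x -> F n (star x).
Proof. exact: full_matrix_star (filt_mx n) (filt1 n) x. Qed.

Lemma filt_approx x (e : R) : 0 < e -> exists n y, F n y /\ nrm (x - y) < e.
Proof.
case: filt => _ _ _ h e0; have := (closureP (\bigcup_n F n) x).1.
by rewrite h => /(_ I _ e0)[y [n _ Fy] hy]; exists n, y.
Qed.

Lemma filt_approx_fin (J : finType) (x : J -> A) :
  exists (l : nat -> nat) (u : nat -> J -> A),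
    (forall m a, F (l m) (u m a)) /\ forall a, u m a @[m --> \oo] --> x a.
Proof.
have H (p : nat * J) : exists ny : nat * A, F ny.1 ny.2 /\ nrm (x p.2 - ny.2) < hpow p.1.
  by have [n [y hy]] := filt_approx (x p.2) (hpow_gt0 (R := R) p.1); exists (n, y).
have [s hs] := choice H.
exists (fun m => \max_(a : J) (s (m, a)).1), (fun m a => (s (m, a)).2); split.
  move=> m a; have [h _] := hs (m, a); apply: filt_le h.
  exact: (leq_bigmax a).
move=> a; apply/cvg_nrmP => e e0; have [N hN] := hpow_small 1 e0.
apply/near_ooP; exists N => n /hN; rewrite mul1r; apply: lt_trans.
by have [_] := hs (n, a).
Qed.

Lemma half_double (V : normedModType R[i]) (x : V) : (2^-1 : R)%:C *: (x + x) = x.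
Proof.
rewrite scalerDr -scalerDl -rmorphD /=.
by rewrite (_ : 2^-1 + 2^-1 = 1 :> R) ?scale1r //; lra.
Qed.

(** Since [D] is its own square, a bound [d * hpow n] on the entries improves to
    [#|J| * d * (d * hpow n)], which is at most [d * hpow n.+1]. *)
Lemma idempotent_mx_small (J : finType) (D : J -> J -> A) (d : R) :
  (forall a b, \sum_c D a c * D c b = D a b) ->
  (forall a b, nrm (D a b) <= d) -> #|J|%:R * d <= 2^-1 ->
  forall a b, D a b = 0.
Proof.
move=> DD hd Kd a b; apply: nrm_eps => e e0.
have d0 : 0 <= d by apply: le_trans (hd a b); exact: nrm_ge0.
have H n : forall a b, nrm (D a b) <= d * hpow n.
  elim: n => [|n IH] {}a {}b; first by rewrite hpow0 mulr1.
  rewrite -DD; apply: le_trans (nrm_sum _ _ _) _.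
  apply: (@le_trans _ _ (\sum_(c : J) d * (d * hpow n))).
    apply: ler_sum => c _; apply: le_trans (nrmM _ _) _.
    by apply: ler_pM => //; exact: nrm_ge0.
  rewrite sumr_const -mulr_natl (hpowS n).
  have h0 := hpow_gt0 (R := R) n.+1; move: (hpow n.+1) h0 => h h0.
  have dh : 0 <= 2 * (d * h) by rewrite !mulr_ge0 // ltW.
  have := ler_wpM2r dh Kd; move: (#|J|%:R : R) => K.
  by rewrite (_ : K * (d * (d * (2 * h))) = K * d * (2 * (d * h))); [lra | ring].
have [N hN] := hpow_small d e0.
by apply: le_trans (H N a b) _; apply/ltW/hN.
Qed.

(** [P] is an idempotent matrix below diag(q), and [D] is its complement there. *)
Lemma idempotent_mx_compl (J : finType) (q : A) (P : J -> J -> A) :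
  q * q = q -> (forall a b, q * P a b = P a b) -> (forall a b, P a b * q = P a b) ->
  (forall a b, \sum_c P a c * P c b = P a b) ->
  let D a b := (if a == b then q else 0) - P a b in
  forall a b, \sum_c D a c * D c b = D a b.
Proof.
move=> qq qP Pq PP D a b.
have qD : q * D a b = D a b.
  by rewrite /D mulrBr qP; case: eqP => _; rewrite ?qq ?mulr0.
transitivity (\sum_c ((if a == c then q * D c b else 0)
    - ((if c == b then P a c * q else 0) - P a c * P c b))).
  apply: eq_bigr => c _; rewrite {1}/D mulrBl; congr (_ - _).
    by case: eqP => _; rewrite ?mul0r.
  by rewrite /D mulrBr; congr (_ - _); case: eqP => _; rewrite ?mulr0.
by rewrite !sumrB sum_if_eq' sum_if_eq PP qD Pq subrr subr0.
Qed.

(* Let x_a in F l be close to E a a0. Then q, the spectral projection of the self-adjoint part of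
   x_{a0}, is obtained from the sign z (z^2)^{-1/2} of z = 2 Re x_{a0} - 1. With T the sum of the
   x_a q x_a^*, put s_a = T^{-1/2} x_a q. Then the sum of the s_a s_a^* is 1, so the matrix
   (s_a^* s_b) is idempotent; being close to diag(q), it equals diag(q), because the difference
   D is idempotent and small. Hence the s_a s_b^* are matrix units. *)
Lemma munits_perturb (J : finType) (E : J -> J -> A) (eps : R) : munits E ->
  0 < eps -> exists l e, [/\ munits e, forall a b, F l (e a b) &
    forall a b, nrm (E a b - e a b) < eps].
Proof.
move=> hE eps0; have a0 := munits_inh hE.
have [l [x [Fx xE]]] := filt_approx_fin (fun a => E a a0).
pose p := E a0 a0; have pp : p * p = p by rewrite /p (mu_mulr hE).
have ps : star p = p by rewrite /p (mu_star hE).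
pose z m := x m a0 + star (x m a0) - 1.
have Fz m : F (l m) (z m).
  have c := csub_filt (l m); apply: csubB => //; last exact: csub1.
  by apply: csubD => //; exact: filt_star.
have zs m : star (z m) = z m.
  by rewrite /z star_sub star_add starK star_one (addrC (star _)).
have cz : z m @[m --> \oo] --> p + p - 1.
  apply: cvgB; last exact: cvg_cst; apply: cvgD; first exact: xE.
  by rewrite -{1}ps; apply: cvg_star; exact: xE.
pose y m := 1 - z m * z m.
have Fy m : F (l m) (y m).
  have c := csub_filt (l m); apply: csubB => //; first exact: csub1.
  exact: csubM.
have ys m : star (y m) = y m by rewrite /y star_sub star_mul star_one zs.
have cy : y m @[m --> \oo] --> (0 : A).
  have zp : (p + p - 1) * p = p by rewrite mulrBl mulrDl pp mul1r addrK.
  have -> : 0 = 1 - (p + p - 1) * (p + p - 1).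
    by rewrite [X in 1 - X]mulrBr mulrDr zp mulr1 subKr subrr.
  apply: cvgB; first exact: cvg_cst; exact: cvg_mul.
pose r m := isq (y m); pose q m := (2^-1 : R)%:C *: (1 + z m * r m).
have cr : r m @[m --> \oo] --> (1 : A) by exact: cvg_isq.
have cq : q m @[m --> \oo] --> p.
  have -> : p = (2^-1 : R)%:C *: (1 + (p + p - 1) * 1).
    by rewrite mulr1 addrC subrK half_double.
  apply: cvgZr; apply: cvgD; first exact: cvg_cst; exact: cvg_mul.
pose T m := \sum_a x m a * q m * star (x m a).
pose y' m := 1 - T m; pose r' m := isq (y' m).
have cT : T m @[m --> \oo] --> (1 : A).
  have -> : 1 = \sum_a E a a0 * p * star (E a a0).
    rewrite -(mu_one hE); apply: eq_bigr => a _.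
    by rewrite (mu_star hE) /p !(mu_mulr hE).
  apply: cvg_bigsum => a; apply: cvg_mul; last by apply: cvg_star; exact: xE.
  by apply: cvg_mul => //; exact: xE.
have cy' : y' m @[m --> \oo] --> (0 : A).
  by rewrite -(subrr 1); apply: cvgB => //; exact: cvg_cst.
have cr' : r' m @[m --> \oo] --> (1 : A) by exact: cvg_isq.
pose s m a := r' m * x m a * q m.
have cs a : s m a @[m --> \oo] --> E a a0.
  have -> : E a a0 = 1 * E a a0 * p by rewrite mul1r /p (mu_mulr hE).
  by apply: cvg_mul => //; apply: cvg_mul => //; exact: xE.
pose D m a b := (if a == b then q m else 0) - star (s m a) * s m b.
have cD a b : D m a b @[m --> \oo] --> (0 : A).
  have -> : 0 = (if a == b then p else 0) - star (E a a0) * E b a0.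
    by rewrite (mu_star hE) (mu_mul hE); case: eqP => _; rewrite subrr.
  apply: cvgB; first by case: eqP => _ //; exact: cvg_cst.
  by apply: cvg_mul => //; exact: cvg_star.
have ce a b : s m a * star (s m b) @[m --> \oo] --> E a b.
  have -> : E a b = E a a0 * star (E b a0) by rewrite (mu_star hE) (mu_mulr hE).
  by apply: cvg_mul => //; exact: cvg_star.
pose K := #|J|%:R : R; have K0 : 0 < K by rewrite ltr0n; apply/card_gt0P; exists a0.
(* [(2 * K)^-1] is the threshold of [idempotent_mx_small], and [8^-1] below is the domain of
   [isq]. *)
have d0 : 0 < (2 * K)^-1 by rewrite invr_gt0; lra.
have e8 : (0 : R) < 8^-1 by rewrite invr_gt0.
have N1 := cvg_nat_lt cy e8; have N2 := cvg_nat_lt cy' e8.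
have N3 : \forall m \near \oo, forall ab : J * J, nrm (0 - D m ab.1 ab.2) < (2 * K)^-1.
  by apply: filter_forall => -[a b]; exact: cvg_nrm_lt.
have N4 : \forall m \near \oo, forall ab : J * J,
    nrm (E ab.1 ab.2 - s m ab.1 * star (s m ab.2)) < eps.
  by apply: filter_forall => -[a b]; exact: cvg_nrm_lt (ce a b) eps0.
have [m [[h1 h2] [h3 h4]]] := near_oo_ex (filterI (filterI N1 N2) (filterI N3 N4)).
rewrite sub0r nrmN in h1; rewrite sub0r nrmN in h2.
have {}h1 := ltW h1; have {}h2 := ltW h2.
have zr : z m * r m = r m * z m.
  apply: isq_comm => //; rewrite /y; move: (z m) => t.
  by rewrite mulrBr mulrBl mulr1 mul1r mulrA.
have zz : z m * z m = 1 - y m by rewrite /y subKr.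
pose w := z m * r m.
have ww : w * w = 1 by rewrite /w mulrA -(mulrA (z m)) -zr mulrA zz -mulrA isqP.
have ws : star w = w by rewrite /w star_mul zs isq_star.
have qq : q m * q m = q m.
  rewrite /q -/w -scalerAl -scalerAr; congr (_ *: _).
  by rewrite mulrDr mulr1 mulrDl mul1r ww (addrC w) half_double.
have qs : star (q m) = q m by rewrite /q -/w star_scale conjC_re star_add star_one ws.
have c := csub_filt (l m).
have Fq : F (l m) (q m).
  apply: csubZ => //; apply: csubD => //; first exact: csub1.
  by apply: csubM => //; exact: isq_csub.
have FT : F (l m) (T m).
  apply: csub_sum => // a _; apply: csubM => //; last exact: filt_star.
  exact: csubM.
have Fr' : F (l m) (r' m).
  by apply: isq_csub => //; apply: csubB => //; exact: csub1.
have Ts : star (T m) = T m.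
  rewrite /T star_sum; apply: eq_bigr => a _.
  by rewrite !star_mul starK qs mulrA.
have rs' : star (r' m) = r' m by apply: isq_star; rewrite // star_sub star_one Ts.
have rTr : r' m * T m * r' m = 1 by have := isqP2 h2; rewrite /y' subKr.
have sq a : s m a * q m = s m a by rewrite /s -mulrA qq.
have qs' a : q m * star (s m a) = star (s m a) by rewrite -{1}qs -star_mul sq.
have ss : \sum_a s m a * star (s m a) = 1.
  rewrite -rTr /T mulr_sumr mulr_suml; apply: eq_bigr => a _.
  by rewrite /s !star_mul qs rs' !mulrA -(mulrA _ (q m) (q m)) qq.
have PP a b : \sum_c (star (s m a) * s m c) * (star (s m c) * s m b) = star (s m a) * s m b.
  under eq_bigr => e _ do rewrite mulrA -(mulrA (star (s m a))).
  by rewrite -mulr_suml -mulr_sumr ss mulr1.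
have D0 : forall a b, D m a b = 0.
  apply: (@idempotent_mx_small _ _ (2 * K)^-1) => [a b|a b|].
  - apply: (idempotent_mx_compl (P := fun a b => star (s m a) * s m b)) => // {}a {}b.
      by rewrite mulrA qs'.
    by rewrite -mulrA sq.
  - by have := h3 (a, b); rewrite /= sub0r nrmN => /ltW.
  by rewrite invfM mulrCA mulfV ?mulr1 // gt_eqF.
have sab a b : star (s m a) * s m b = if a == b then q m else 0.
  by have := D0 a b; rewrite /D => /eqP; rewrite subr_eq0 => /eqP.
exists (l m), (fun a b => s m a * star (s m b)); split.
- split=> [a b a' b'|a b|//].
    rewrite mulrA -(mulrA (s m a)) sab; case: eqP => _.
      by rewrite -mulrA qs'.
    by rewrite mulr0 mul0r.
  by rewrite star_mul starK.
- move=> a b; have Fs d : F (l m) (s m d) by apply: csubM => //; exact: csubM.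
  by apply: csubM => //; exact: filt_star.
by move=> a b; exact: h4 (a, b).
Qed.

End Perturbation.

(** * Unitary equivalence of matrix units in a UHF algebra *)

Section UHFConjugacy.
Context {R : realType} {A : cstarAlgType R}.

(** The defect [1 - v * star v] is a projection, and a nonzero projection has norm 1. *)
Lemma isometry_close_unitary (v : A) : star v * v = 1 -> nrm (1 - v * star v) < 1 ->
  unitary v.
Proof.
move=> vv h; split=> //; set d := 1 - v * star v.
have dd : d * d = d.
  by rewrite {1}/d mulrBl mul1r /d mulrBr mulr1 mulrA -(mulrA v) vv mulr1 subrr subr0.
have ds : star d = d by rewrite /d star_sub star_one star_mul starK.
suff /nrm_eq0/eqP : nrm d = 0 by rewrite subr_eq0 => /eqP.
have := nrm_cstar d; rewrite ds dd expr2 => /eqP.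
rewrite -subr_eq0 -{1}(mulr1 (nrm d)) -mulrBr mulf_eq0 => /orP[/eqP//|].
by rewrite subr_eq0 => /eqP e; move: h; rewrite -/d -e ltxx.
Qed.

(** [X m] intertwines [E] with [e m] and tends to 1. As [star (X m) * X m] commutes with [E], the
    polar part [Y m] still intertwines; it is an isometry close to 1, hence unitary. *)
Lemma munits_close_conj (J : finType) (E : J -> J -> A) (e : nat -> J -> J -> A) :
  munits E -> (forall m, munits (e m)) ->
  (forall a b, e m a b @[m --> \oo] --> E a b) ->
  exists m W, unitary W /\ forall a b, Ad W (E a b) = e m a b.
Proof.
move=> hE he ce; have a0 := munits_inh hE.
pose X m := \sum_a e m a a0 * E a0 a.
have cX : X m @[m --> \oo] --> (1 : A).
  have -> : 1 = \sum_a E a a0 * E a0 a.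
    by rewrite -(mu_one hE); apply: eq_bigr => a _; rewrite (mu_mulr hE).
  by apply: cvg_bigsum => a; apply: cvg_mul => //; exact: cvg_cst.
have XE m a b : X m * E a b = e m a b * X m.
  transitivity (e m a a0 * E a0 b).
    rewrite /X mulr_suml -(sum_if_eq a (fun c => e m a a0 * E a0 b)).
    apply: eq_bigr => c _; rewrite -mulrA (mu_mul hE); case: eqP => [->//|_].
    by rewrite mulr0.
  rewrite /X mulr_sumr -(sum_if_eq' b (fun c => e m a a0 * E a0 b)).
  apply: eq_bigr => c _; rewrite mulrA (mu_mul (he m)); case: eqP => [->//|_].
  by rewrite mul0r.
pose y m := 1 - star (X m) * X m.
have cy : y m @[m --> \oo] --> (0 : A).
  have -> : 0 = 1 - star (1 : A) * 1 by rewrite star_one mulr1 subrr.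
  apply: cvgB; first exact: cvg_cst; apply: cvg_mul => //; exact: cvg_star.
pose r m := isq (y m).
have cr : r m @[m --> \oo] --> (1 : A) by exact: cvg_isq.
pose Y m := X m * r m.
have cY : 1 - Y m * star (Y m) @[m --> \oo] --> (0 : A).
  have -> : 0 = 1 - (1 * 1) * star (1 * 1 : A) by rewrite !mulr1 star_one mulr1 subrr.
  apply: cvgB; first exact: cvg_cst; apply: cvg_mul; first exact: cvg_mul.
  by apply: cvg_star; exact: cvg_mul.
have e8 : (0 : R) < 8^-1 by rewrite invr_gt0.
have N1 := cvg_nat_lt cy e8; have N2 := cvg_nat_lt cY ltr01.
have [m [h1 h2]] := near_oo_ex (filterI N1 N2).
rewrite /= sub0r nrmN in h1; rewrite /= sub0r nrmN in h2; move/ltW in h1.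
have ys : star (y m) = y m by rewrite /y star_sub star_one star_mul starK.
have rs := isq_star h1 ys.
have hY : unitary (Y m).
  apply: isometry_close_unitary h2; rewrite /Y star_mul rs.
  by have := isqP2 h1; rewrite /y subKr !mulrA.
exists m, (Y m); split=> // a b.
have rE : E a b * r m = r m * E a b.
  apply: isq_comm => //; rewrite /y mulrBr mulrBl mulr1 mul1r; congr (_ - _).
  have XsE : star (X m) * e m a b = E a b * star (X m).
    apply: (can_inj (@starK _ _)); rewrite !star_mul !starK (mu_star hE) (mu_star (he m)).
    by rewrite XE.
  by rewrite -mulrA XE !mulrA XsE.
have YE : Y m * E a b = e m a b * Y m by rewrite /Y -mulrA -rE mulrA XE mulrA.
by rewrite /Ad YE -mulrA hY.2 mulr1.
Qed.

Context {F : nat -> set A} (filt : UHF_filtration F).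

Lemma munits_approx (J : finType) (E : J -> J -> A) : munits E ->
  exists l W, unitary W /\ forall a b, F l (Ad W (E a b)).
Proof.
move=> hE.
have H m : exists le : nat * (J -> J -> A), [/\ munits le.2,
    forall a b, F le.1 (le.2 a b) & forall a b, nrm (E a b - le.2 a b) < hpow m].
  by have [l [e h]] := munits_perturb filt hE (hpow_gt0 (R := R) m); exists (l, e).
have [s hs] := choice H.
have [||m [W [hW WE]]] := @munits_close_conj _ E (fun m => (s m).2) hE.
- by move=> m; have [] := hs m.
- move=> a b; apply/cvg_nrmP => e e0; have [N hN] := hpow_small 1 e0.
  apply/near_ooP; exists N => n /hN; rewrite mul1r; apply: lt_trans.
  by have [_ _] := hs n.
exists (s m).1, W; split=> // a b; rewrite WE.
by have [_ h _] := hs m.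
Qed.

(** Both systems are first moved into a common [F n], where systems with the same index set are
    conjugate by linear algebra. *)
Lemma uhf_munits_conj (J : finType) (E G : J -> J -> A) : munits E -> munits G ->
  exists W, unitary W /\ forall a b, Ad W (E a b) = G a b.
Proof.
move=> hE hG; have [l [W [hW WE]]] := munits_approx hE.
have [l' [W' [hW' WG]]] := munits_approx hG; pose n := maxn l l'.
have [||||U [_ hU UE]] := @full_matrix_conj _ _ (F n) (filt_mx filt n) (filt1 filt n) _
    (fun i j => Ad W (E i j)) (fun i j => Ad W' (G i j)).
- exact: munits_shom hE (star_hom_Ad hW).
- exact: munits_shom hG (star_hom_Ad hW').
- by move=> i j; apply: (filt_le filt) (WE i j); exact: leq_maxl.
- by move=> i j; apply: (filt_le filt) (WG i j); exact: leq_maxr.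
exists (star W' * (U * W)); split.
  by apply: unitary_mul; [exact: unitary_star | exact: unitary_mul].
by move=> a b; rewrite !Ad_mul UE AdK.
Qed.

(** Wherever [f] sends the matrix units of [F n], it sends them to a system with the same index set.
    This is the source of all inner approximations below. *)
Lemma uhf_inner_on (f : A -> A) n : star_hom f ->
  exists W, unitary W /\ forall x, F n x -> Ad W x = f x.
Proof.
move=> fh; have [k [e [he eF]]] := full_matrix_units (filt_mx filt n) (filt1 filt n).
have [W [hW We]] := uhf_munits_conj he (munits_shom he fh).
exists W; split=> // x; rewrite -eF => -[c ->].
have h := star_hom_Ad hW.
rewrite (shom_sum h) (shom_sum fh); apply: eq_bigr => i _.
rewrite (shom_sum h) (shom_sum fh); apply: eq_bigr => j _.
by rewrite (shomZ h) (shomZ fh) We.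
Qed.

End UHFConjugacy.

(** * Tensor products *)

Section Tensor.
Context {R : realType} {A B T : cstarAlgType R} {tens : A -> B -> T}.
Hypothesis ht : Ctensor tens.

Lemma tensDl a a' b : tens (a + a') b = tens a b + tens a' b.
Proof. by have := Ctensor_linear_l ht b 1 a a'; rewrite !scale1r. Qed.

Lemma tensDr a b b' : tens a (b + b') = tens a b + tens a b'.
Proof. by have := Ctensor_linear_r ht a 1 b b'; rewrite !scale1r. Qed.

Lemma tens0l b : tens 0 b = 0.
Proof. by apply: (addrI (tens 0 b)); rewrite -tensDl !addr0. Qed.

Lemma tens0r a : tens a 0 = 0.
Proof. by apply: (addrI (tens a 0)); rewrite -tensDr !addr0. Qed.

Lemma tensZl c a b : tens (c *: a) b = c *: tens a b.
Proof. by have := Ctensor_linear_l ht b c a 0; rewrite !addr0 tens0l addr0. Qed.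

Lemma tensZr c a b : tens a (c *: b) = c *: tens a b.
Proof. by have := Ctensor_linear_r ht a c b 0; rewrite !addr0 tens0r addr0. Qed.

Lemma tensBr a b b' : tens a (b - b') = tens a b - tens a b'.
Proof. by rewrite tensDr -scaleN1r tensZr scaleN1r. Qed.

Lemma tensBl a a' b : tens (a - a') b = tens a b - tens a' b.
Proof. by rewrite tensDl -scaleN1r tensZl scaleN1r. Qed.

Lemma tensM a a' b b' : tens a b * tens a' b' = tens (a * a') (b * b').
Proof. by rewrite (CtensorM ht). Qed.

Lemma tens_suml (I : Type) (r : seq I) (P : pred I) (f : I -> A) b :
  tens (\sum_(i <- r | P i) f i) b = \sum_(i <- r | P i) tens (f i) b.
Proof. by apply: (big_morph (tens^~ b)); [move=> x y; exact: tensDl | exact: tens0l]. Qed.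

Lemma tens_sumr (I : Type) (r : seq I) (P : pred I) a (f : I -> B) :
  tens a (\sum_(i <- r | P i) f i) = \sum_(i <- r | P i) tens a (f i).
Proof. by apply: (big_morph (tens a)); [move=> x y; exact: tensDr | exact: tens0r]. Qed.

Lemma star_hom_tensl : star_hom (fun a => tens a 1).
Proof.
split; first exact: Ctensor_linear_l.
  by split; [exact: Ctensor1 | move=> x y; rewrite tensM mulr1].
by move=> x; rewrite -(Ctensor_star ht) star_one.
Qed.

Lemma star_hom_tensr : star_hom (fun b => tens 1 b).
Proof.
split; first exact: Ctensor_linear_r.
  by split; [exact: Ctensor1 | move=> x y; rewrite tensM mulr1].
by move=> x; rewrite -(Ctensor_star ht) star_one.
Qed.

Lemma tensE a b : tens a b = tens a 1 * tens 1 b.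
Proof. by rewrite tensM mulr1 mul1r. Qed.

Lemma tensE' a b : tens a b = tens 1 b * tens a 1.
Proof. by rewrite tensM mulr1 mul1r. Qed.

(** Each tensor factor embeds by a homomorphism, and homomorphisms are contractive. *)
Lemma nrm_tens a b : nrm (tens a b) <= nrm a * nrm b.
Proof.
rewrite tensE; apply: le_trans (nrmM _ _) _.
have h1 := shom_le star_hom_tensl a; have h2 := shom_le star_hom_tensr b.
by apply: ler_pM; rewrite ?nrm_ge0.
Qed.

Lemma tens_unitary u v : unitary u -> unitary v -> unitary (tens u v).
Proof.
by move=> [u1 u2] [v1 v2]; split; rewrite -(Ctensor_star ht) tensM ?u1 ?u2 ?v1 ?v2 (Ctensor1 ht).
Qed.

Lemma Ad_tens u v a b : Ad (tens u v) (tens a b) = tens (Ad u a) (Ad v b).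
Proof. by rewrite /Ad -(Ctensor_star ht) !tensM. Qed.

Lemma cvg_tens S (F : set_system S) {FF : Filter F} (f : S -> A) (g : S -> B) a b :
  f t @[t --> F] --> a -> g t @[t --> F] --> b ->
  tens (f t) (g t) @[t --> F] --> tens a b.
Proof.
move=> h1 h2; rewrite tensE; under eq_fun do rewrite tensE.
apply: cvg_mul; first exact: (cvg_shom star_hom_tensl).
exact: (cvg_shom star_hom_tensr).
Qed.

Lemma tens_ind (P : T -> Prop) :
  (forall z, (forall e : R, 0 < e -> exists2 z', P z' & nrm (z - z') < e) -> P z) ->
  P 0 -> (forall x y, P x -> P y -> P (x + y)) -> (forall a b, P (tens a b)) ->
  forall z, P z.
Proof.
move=> Pc P0 PD Pt z; apply: Pc => e e0.
have : closure [set z : T | exists n (a : 'I_n -> A) (b : 'I_n -> B),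
    z = \sum_(i < n) tens (a i) (b i)] z by rewrite (Ctensor_dense ht).
move=> /closureP/(_ _ e0)[_ [n [a [b ->]]] h]; exists (\sum_(i < n) tens (a i) (b i)) => //.
by elim/big_ind: _.
Qed.

Lemma munits_tens (I J : finType) (e : I -> I -> A) (g : J -> J -> B) :
  munits e -> munits g ->
  munits (fun p q : I * J => tens (e p.1 q.1) (g p.2 q.2)).
Proof.
move=> he hg; split=> [[i j] [k l] [i' j'] [k' l']|[i j] [k l]|] /=.
- rewrite tensM (mu_mul he) (mu_mul hg) xpair_eqE.
  by case: eqP => _ /=; [case: eqP => _; rewrite ?tens0r | rewrite tens0l].
- by rewrite -(Ctensor_star ht) (mu_star he) (mu_star hg).
rewrite -(pair_bigA _ (fun i j => tens (e i i) (g j j))) /= -(Ctensor1 ht) -(mu_one he).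
by rewrite tens_suml; apply: eq_bigr => i _; rewrite -tens_sumr (mu_one hg).
Qed.

End Tensor.

Section LimitStarHom.
Context {R : realType} {B T : cstarAlgType R} {Phi : nat -> B -> T}.
Hypothesis hPhi : forall n, star_hom (Phi n).

(** Contractive maps are equicontinuous, so convergence has to be checked only on a dense set. *)
Lemma shom_cvg_closed (x : B) :
  (forall e : R, 0 < e ->
    exists2 x', (exists l : T, Phi n x' @[n --> \oo] --> l) & nrm (x - x') < e) ->
  exists l : T, Phi n x @[n --> \oo] --> l.
Proof.
move=> h; apply: nrm_cauchy => e e0.
have e4 : 0 < e / 4 by lra.
have [x' [l hl] hx] := h _ e4; have [N hN] := (near_ooP _).1 (cvg_nat_lt hl e4).
exists N => n Nn.
have h1 := hN n Nn; have h2 := hN N (leqnn N).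
have h3 := shom_le (hPhi n) (x - x'); have h4 := shom_le (hPhi N) (x - x').
rewrite (shomB (hPhi n)) in h3; rewrite (shomB (hPhi N)) nrmC in h4.
have h5 := nrm_tri (Phi n x') (Phi n x) (Phi N x).
have h6 := nrm_tri (Phi N x') (Phi n x') (Phi N x).
have h7 := nrm_tri l (Phi n x') (Phi N x').
rewrite (nrmC (Phi n x') l) in h7; lra.
Qed.

Lemma lim_star_hom : (forall x, exists l : T, Phi n x @[n --> \oo] --> l) ->
  exists f, star_hom f /\ forall x, Phi n x @[n --> \oo] --> f x.
Proof.
move=> /choice[f hf]; exists f; split=> //; split.
- move=> c x y; apply: (cvg_eq (hf _)).
  under eq_fun do rewrite (shomD (hPhi _)) (shomZ (hPhi _)).
  by apply: cvgD; [apply: cvgZr|].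
- split=> [|x y]; apply: (cvg_eq (hf _)).
    under eq_fun do rewrite (shom1 (hPhi _)); exact: cvg_cst.
  by under eq_fun do rewrite (shomM (hPhi _)); exact: cvg_mul.
- move=> x; apply: (cvg_eq (hf _)).
  by under eq_fun do rewrite (shom_star (hPhi _)); exact: cvg_star.
Qed.

End LimitStarHom.

Section Flows.
Context {R : realType}.

Lemma flow_shom (A : cstarAlgType R) (alpha : R -> A -> A) t : flow alpha ->
  star_hom (alpha t).
Proof. by case=> h _ _; case: (h t). Qed.

Lemma flow0 (A : cstarAlgType R) (alpha : R -> A -> A) x : flow alpha -> alpha 0 x = x.
Proof.
move=> [h1 h2 _]; have [_ /bij_inj inj] := h1 0; apply: inj.
by rewrite -h2 addr0.
Qed.

Lemma flowVK (A : cstarAlgType R) (alpha : R -> A -> A) t : flow alpha ->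
  cancel (alpha (- t)) (alpha t).
Proof. by move=> h x; rewrite -(flowD h) addrN flow0. Qed.

Lemma flow_nrm (A : cstarAlgType R) (alpha : R -> A -> A) t x : flow alpha ->
  nrm (alpha t x) = nrm x.
Proof. by case=> h _ _; rewrite siso_nrm. Qed.

Lemma flow_intro (A : cstarAlgType R) (alpha : R -> A -> A) :
  (forall t, star_hom (alpha t)) -> (forall x, alpha 0 x = x) ->
  (forall s t x, alpha (s + t) x = alpha s (alpha t x)) ->
  (forall x, continuous (fun t => alpha t x)) -> flow alpha.
Proof.
move=> h1 h0 h2 h3; split=> // t; split=> //; exists (alpha (- t)) => x.
  by rewrite -h2 addNr h0.
by rewrite -h2 addrN h0.
Qed.

Lemma shom_continuous_closed (A B : cstarAlgType R) (f : R -> A -> B) x :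
  (forall t, star_hom (f t)) ->
  (forall e : R, 0 < e ->
    exists2 x', continuous (fun t => f t x') & nrm (x - x') < e) ->
  continuous (fun t => f t x).
Proof.
move=> fh h t; apply/cvg_nrmP => e e0; have e3 : 0 < e / 3 by lra.
have [x' c hx] := h _ e3; apply: filterS (cvg_nrm_lt (c t) e3) => s hs.
have h1 := shom_le (fh t) (x - x'); have h2 := shom_le (fh s) (x - x').
rewrite (shomB (fh t)) in h1; rewrite (shomB (fh s)) nrmC in h2.
have h3 := nrm_tri (f t x') (f t x) (f s x).
have h4 := nrm_tri (f s x') (f t x') (f s x); lra.
Qed.

Lemma shom_eq_closed (A B : cstarAlgType R) (f g : A -> B) x :
  star_hom f -> star_hom g ->
  (forall e : R, 0 < e -> exists2 x', f x' = g x' & nrm (x - x') < e) ->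
  f x = g x.
Proof.
move=> fh gh h; apply/eqP; rewrite -subr_eq0; apply/eqP/nrm_eps => e e0.
have e2 : 0 < e / 2 by lra.
have [x' fg hx] := h _ e2.
have h1 := shom_le fh (x - x'); have h2 := shom_le gh (x - x').
rewrite (shomB fh) in h1; rewrite (shomB gh) nrmC in h2.
have h3 := nrm_tri (f x') (f x) (g x); rewrite fg in h3 h1; lra.
Qed.

End Flows.

Section UHFInduction.
Context {R : realType} {A : cstarAlgType R} {F : nat -> set A}.
Hypothesis filt : UHF_filtration F.

Lemma uhf_ind (P : A -> Prop) :
  (forall z, (forall e : R, 0 < e -> exists2 z', P z' & nrm (z - z') < e) -> P z) ->
  (forall n x, F n x -> P x) -> forall x, P x.
Proof.
move=> Pc PF x; apply: Pc => e e0; have [n [y [Fy hy]]] := filt_approx filt x e0.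
by exists y => //; exact: PF Fy.
Qed.

End UHFInduction.

Section TensorHom.
Context {R : realType} {A B T : cstarAlgType R} {tens : A -> B -> T}.
Hypothesis ht : Ctensor tens.

Lemma tens_shom_eq (S : cstarAlgType R) (f g : T -> S) : star_hom f -> star_hom g ->
  (forall a b, f (tens a b) = g (tens a b)) -> forall z, f z = g z.
Proof.
move=> fh gh fg; apply: (tens_ind ht) => // [z|| x y hx hy].
- exact: shom_eq_closed.
- by rewrite (shom0 fh) (shom0 gh).
- by rewrite (shomD fh) (shomD gh) hx hy.
Qed.

Context {F : nat -> set A} (filtA : UHF_filtration F).
Context {G : nat -> set B} (filtB : UHF_filtration G).

(* f (x) g is the pointwise limit of inner automorphisms, since f and g are inner on each F n. *)
Lemma tens_hom_exists (f : A -> A) (g : B -> B) : star_hom f -> star_hom g ->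
  exists h : T -> T, star_hom h /\ forall a b, h (tens a b) = tens (f a) (g b).
Proof.
move=> fh gh.
have [W hW] := choice (fun n => uhf_inner_on filtA n fh).
have [V hV] := choice (fun n => uhf_inner_on filtB n gh).
have hWV n : unitary (tens (W n) (V n)).
  by apply: (tens_unitary ht); [case: (hW n) | case: (hV n)].
pose Phi n := Ad (tens (W n) (V n)).
have hPhi n : star_hom (Phi n) by exact: star_hom_Ad.
have hl n : star_hom (Phi n \o (fun a => tens a 1)).
  by apply: star_hom_comp => //; exact: star_hom_tensl.
have hr n : star_hom (Phi n \o (fun b => tens 1 b)).
  by apply: star_hom_comp => //; exact: star_hom_tensr.
have Pl k a : F k a -> \forall n \near \oo, Phi n (tens a 1) = tens (f a) 1.
  move=> Fa; apply/near_ooP; exists k => n kn.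
  have [_ h] := hW n; have [hu _] := hV n.
  by rewrite /Phi (Ad_tens ht) Ad1 // h //; exact: (filt_le filtA kn).
have Pr k b : G k b -> \forall n \near \oo, Phi n (tens 1 b) = tens 1 (g b).
  move=> Gb; apply/near_ooP; exists k => n kn.
  have [_ h] := hV n; have [hu _] := hW n.
  by rewrite /Phi (Ad_tens ht) Ad1 // h //; exact: (filt_le filtB kn).
have cl a : exists l : T, Phi n (tens a 1) @[n --> \oo] --> l.
  move: a; apply: (uhf_ind filtA) => [z h|k a Fa]; first exact: (shom_cvg_closed hl).
  by exists (tens (f a) 1); apply: cvg_near_cst; exact: Pl Fa.
have cr b : exists l : T, Phi n (tens 1 b) @[n --> \oo] --> l.
  move: b; apply: (uhf_ind filtB) => [z h|k a Fa]; first exact: (shom_cvg_closed hr).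
  by exists (tens 1 (g a)); apply: cvg_near_cst; exact: Pr Fa.
have [|h [hh ch]] := lim_star_hom hPhi.
  apply: (tens_ind ht) => [z H||x y [l hx] [m hy]|a b].
  - exact: (shom_cvg_closed hPhi).
  - by exists 0; under eq_fun do rewrite (shom0 (hPhi _)); exact: cvg_cst.
  - by exists (l + m); under eq_fun do rewrite (shomD (hPhi _)); exact: cvgD.
  - have [l hx] := cl a; have [m hy] := cr b; exists (l * m).
    by under eq_fun do rewrite (tensE ht) (shomM (hPhi _)); exact: cvg_mul.
exists h; split=> // a b.
rewrite (tensE ht) (shomM hh) (tensE ht (f a)); congr (_ * _).
  move: a; apply: (uhf_ind filtA) => [z|k a Fa].
    apply: (@shom_eq_closed _ _ _ (h \o (fun a => tens a 1)) ((fun a => tens a 1) \o f)).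
      by apply: star_hom_comp => //; exact: star_hom_tensl.
    by apply: star_hom_comp => //; exact: star_hom_tensl.
  exact: cvg_eq_near (Pl _ _ Fa) (ch _).
move: b; apply: (uhf_ind filtB) => [z|k b Gb].
  apply: (@shom_eq_closed _ _ _ (h \o (fun a => tens 1 a)) ((fun a => tens 1 a) \o g)).
    by apply: star_hom_comp => //; exact: star_hom_tensr.
  by apply: star_hom_comp => //; exact: star_hom_tensr.
exact: cvg_eq_near (Pr _ _ Gb) (ch _).
Qed.

(** The maps [delta t] are chosen separately for each time; the group law holds because
    homomorphisms that agree on elementary tensors are equal. *)
Lemma tensor_flow_exists (alpha : R -> A -> A) (beta : R -> B -> B) :
  flow alpha -> flow beta -> exists delta, tensor_flow tens alpha beta delta.
Proof.
move=> ha hb.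
have [delta hd] := choice (fun t => tens_hom_exists (flow_shom t ha) (flow_shom t hb)).
have dh t : star_hom (delta t) by case: (hd t).
have dt t a b : delta t (tens a b) = tens (alpha t a) (beta t b) by case: (hd t).
exists delta; split=> //; apply: flow_intro => //.
- apply: (@tens_shom_eq _ (delta 0) id) => //.
  by move=> a b; rewrite dt !flow0.
- move=> s t; apply: (@tens_shom_eq _ (delta (s + t)) (delta s \o delta t)) => // [|a b].
    exact: star_hom_comp.
  by rewrite /= !dt (flowD ha) (flowD hb).
apply: (tens_ind ht) => [z|| x y hx hy|a b].
- exact: shom_continuous_closed.
- have -> : (fun t => delta t 0) = fun=> 0 by apply/funext => t; exact: shom0.
  by move=> t; exact: cvg_cst.
- have -> : (fun t => delta t (x + y)) = fun t => delta t x + delta t y.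
    by apply/funext => t; exact: shomD.
  by move=> t; apply: cvgD; [exact: hx | exact: hy].
- have -> : (fun t => delta t (tens a b)) = fun t => tens (alpha t a) (beta t b).
    exact/funext.
  by move=> t; apply: (cvg_tens ht); exact: flow_continuous.
Qed.

End TensorHom.

Section SelfTensor.
Context {R : realType} {A AA : cstarAlgType R} {tens : A -> A -> AA}.
Context {F : nat -> set A}.

(* A (x) A = A provides two commuting copies of F n, hence, by perturbation, two copies inside
   some F l; a unitary of F l moves the first one onto F n. *)
Lemma uhf_self_commute n : Ctensor tens -> isomorphic AA A -> UHF_filtration F ->
  exists l W, [/\ unitary W, F l W &
    forall a b, F n a -> F n b -> Ad W a * b = b * Ad W a].
Proof.
move=> ht [theta [th _]] filt.
have [k [e [he eF]]] := full_matrix_units (filt_mx filt n) (filt1 filt n).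
pose E p q := theta (tens (e p.1 q.1) (e p.2 q.2)).
have hE : munits E by exact: munits_shom (munits_tens ht he he) th.
have [l0 [W [hW FW]]] := munits_approx filt hE; pose l := maxn n l0.
have c := csub_filt filt l.
have hAd := star_hom_Ad hW.
have EFl p q : F l (Ad W (E p q)) by apply: (filt_le filt) (FW p q); exact: leq_maxr.
have Fe i j : F l (e i j).
  by apply: (filt_le filt (leq_maxl _ _)); rewrite -eF; exact: mspan_unit.
pose L i j := Ad W (theta (tens (e i j) 1)); pose P i j := Ad W (theta (tens 1 (e i j))).
have hL : munits L.
  by apply: munits_shom hAd; apply: munits_shom th; exact: munits_shom he (star_hom_tensl ht).
have hP : munits P.
  by apply: munits_shom hAd; apply: munits_shom th; exact: munits_shom he (star_hom_tensr ht).
have LP i j p q : L i j * P p q = P p q * L i j.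
  by rewrite /L /P -!AdM // -!(shomM th) -(tensE ht) -(tensE' ht).
have FL i j : F l (L i j).
  rewrite /L -(mu_one he) (tens_sumr ht) (shom_sum th) (shom_sum hAd).
  by apply: csub_sum => // p _; exact: EFl (i, p) (j, p).
have FP i j : F l (P i j).
  rewrite /P -(mu_one he) (tens_suml ht) (shom_sum th) (shom_sum hAd).
  by apply: csub_sum => // p _; exact: EFl (p, i) (p, j).
have [V [FV hV VL]] := full_matrix_conj (filt_mx filt l) (filt1 filt l) hL he FL Fe.
pose Q i j := Ad V (P i j).
have hQ : munits Q by exact: munits_shom hP (star_hom_Ad hV).
have eQ i j p q : e i j * Q p q = Q p q * e i j.
  by rewrite -(VL i j) /Q -(AdM (L i j) (P p q) hV) -(AdM (P p q) (L i j) hV) LP.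
have FQ i j : F l (Q i j).
  by apply: csubM => //; [apply: csubM | exact: filt_star].
(* The flip unitary of [e] and [Q] carries [F n] onto the span of [Q], which commutes with [F n]. *)
exists l, (mflip e Q); split.
- exact: mflip_unitary.
- by apply: csub_sum => // i _; apply: csub_sum => // j _; exact: csubM.
have hU : unitary (mflip e Q) by exact: mflip_unitary.
rewrite -eF => a b ha hb.
move: b hb; apply: mspan_comm => i j.
apply/esym; move: a ha; apply: mspan_ind => [|x y hx hy|s x hx|p q].
- by rewrite (shom0 (star_hom_Ad hU)) mulr0 mul0r.
- by rewrite AdD mulrDl mulrDr hx hy.
- by rewrite AdZ -scalerAr -scalerAl hx.
- by rewrite (Ad_mflip he hQ).
Qed.

End SelfTensor.

(** * Central approximate copies of alpha in gamma *)

Section Null.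
Context {R : realType}.

(** The common Lipschitz constant gives equicontinuity; asymptotic identities thus reduce to a dense
    set. *)
Lemma null_closed (V W : normedModType R[i]) (f : nat -> V -> W) (C : R) x :
  (forall n x y, nrm (f n x - f n y) <= C * nrm (x - y)) ->
  (forall e : R, 0 < e ->
    exists2 x', f n x' @[n --> \oo] --> (0 : W) & nrm (x - x') < e) ->
  f n x @[n --> \oo] --> (0 : W).
Proof.
move=> fl h; apply/cvg_nrmP => e e0.
have C0 : 0 < `|C| + 1 by rewrite ltr_wpDl.
have e2 : 0 < e / 2 / (`|C| + 1) by rewrite divr_gt0 //; lra.
have [x' hx' hx] := h _ e2; have e3 : 0 < e / 2 by lra.
apply: filterS (cvg_nat_lt hx' e3) => n; rewrite !sub0r !nrmN => hn.
have h1 := fl n x x'; have h2 := nrm_dist (f n x) (f n x').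
move: hx; rewrite ltr_pdivlMr // => hx.
have h3 : C * nrm (x - x') <= nrm (x - x') * (`|C| + 1).
  by rewrite mulrC; apply: ler_wpM2l; [exact: nrm_ge0 | have := ler_norm C; lra].
lra.
Qed.

Lemma null_le (V W : normedModType R[i]) (u : nat -> V) (v : nat -> W) (C : R) :
  (\forall n \near \oo, nrm (u n) <= C * nrm (v n)) ->
  v n @[n --> \oo] --> (0 : W) -> u n @[n --> \oo] --> (0 : V).
Proof.
move=> h; apply: (cvg_nrm_le (C := C)); apply: filterS h => n.
by rewrite !sub0r !nrmN.
Qed.

Lemma nullD (V : normedModType R[i]) (u v : nat -> V) :
  u n @[n --> \oo] --> (0 : V) -> v n @[n --> \oo] --> (0 : V) ->
  u n + v n @[n --> \oo] --> (0 : V).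
Proof. by move=> hu hv; rewrite -(addr0 0); exact: cvgD. Qed.

Lemma null_cvg (V : normedModType R[i]) (u : nat -> V) (l : V) :
  u n @[n --> \oo] --> l <-> (u n - l) @[n --> \oo] --> (0 : V).
Proof.
split=> h; first by rewrite -(subrr l); apply: cvgB => //; exact: cvg_cst.
rewrite -[l]add0r; have -> : u = fun n => (u n - l) + l.
  by apply/funext => n; rewrite subrK.
by apply: cvgD => //; exact: cvg_cst.
Qed.

Context {A : cstarAlgType R}.

Lemma nrm_Ad_sub (u v x : A) : unitary u -> unitary v ->
  nrm (Ad u x - Ad v x) <= 2 * nrm x * nrm (u - v).
Proof.
move=> hu hv; have -> : Ad u x - Ad v x = (u - v) * (x * star u) + v * x * star (u - v).
  by rewrite /Ad star_sub mulrBl mulrBr !mulrA addrA subrK.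
apply: le_trans (nrmD _ _) _.
have h1 := nrmM (u - v) (x * star u); have h2 := nrmM (v * x) (star (u - v)).
rewrite nrm_star (nrm_mul_unitaryl x hv) in h2.
rewrite (nrm_mul_unitaryr x (unitary_star hu)) in h1.
lra.
Qed.

Lemma nrm_Ad_comm (u x : A) : unitary u -> nrm (Ad u x - x) = nrm (u * x - x * u).
Proof.
move=> hu; rewrite -(nrm_mul_unitaryr (Ad u x - x) hu) mulrBl; congr (nrm (_ - _)).
by rewrite /Ad -(mulrA (u * x)) hu.1 mulr1.
Qed.

End Null.

Lemma mulr_comm4 (K : pzRingType) (a b c d : K) : b * c = c * b ->
  a * b * (c * d) = a * c * (b * d).
Proof. by move=> h; rewrite mulrA -(mulrA a) h !mulrA. Qed.

(** * The infinite product flow *)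

Section ModelFlow.
Context {R : realType} {A : cstarAlgType R} {G : nat -> set A}.
Hypothesis filt : UHF_filtration G.
Context {k W : nat -> A}.
Hypotheses (ks : forall m, selfadjoint (k m)) (Gk : forall m, G m (k m)).
Hypotheses (hW : forall m, unitary (W m)) (GW : forall m, G m.+1 (W m)).
Hypothesis WG : forall m a b, G m a -> G m b -> Ad (W m) a * b = b * Ad (W m) a.

Let U m t := uexp (k m) t.
Let K m t := Ad (W m) (U m t).

(** The factor [K n t] lies in [G n.+1] and commutes with [G n], so the product of the first m
    factors lies in [G m] and all later factors act trivially on [G m]. The same commutation makes
    the product a one-parameter group. *)
Fixpoint partial_unitary m t : A :=
  if m is n.+1 then partial_unitary n t * K n t else 1.
Let P := partial_unitary.

Let hU m t : unitary (U m t). Proof. exact: uexp_unitary. Qed.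
Let hK m t : unitary (K m t). Proof. exact: Ad_unitary. Qed.

Let GU m t : G m (U m t).
Proof.
have c := csub_filt filt m; apply: csub_cexp => //; exact: csubZ.
Qed.

Let G_Ad m u x : G m u -> G m x -> G m (Ad u x).
Proof.
move=> Gu Gx; have c := csub_filt filt m.
by apply: csubM; [| exact: csubM | exact: filt_star].
Qed.

Let GS m x : G m x -> G m.+1 x. Proof. by apply: (filt_le filt). Qed.

Let GK m t : G m.+1 (K m t). Proof. by apply: G_Ad => //; exact: GS. Qed.

Let KG m t x : G m x -> K m t * x = x * K m t.
Proof. by move=> Gx; apply: WG. Qed.

Let GP m t : G m (P m t).
Proof.
elim: m => [|m IH] /=; first exact: filt1.
by apply: (csubM (csub_filt filt _)) => //; exact: GS.
Qed.

Let hP m t : unitary (P m t).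
Proof. by elim: m => [|m IH] /=; [exact: unitary1 | exact: unitary_mul]. Qed.

Let P0 m : P m 0 = 1.
Proof. by elim: m => //= m ->; rewrite /K /U uexp0 Ad1 // mulr1. Qed.

Let PD m s t : P m (s + t) = P m s * P m t.
Proof.
elim: m => [|m IH] /=; first by rewrite mulr1.
have KD : K m (s + t) = K m s * K m t by rewrite /K /U uexpD AdM.
by rewrite -/P IH KD; apply: mulr_comm4; rewrite KG.
Qed.

Let P_continuous m : continuous (P m).
Proof.
elim: m => [|m IH] t /=; first exact: cvg_cst.
apply: cvg_mul; first exact: IH.
apply: cvg_Ad; first exact: cvg_cst; exact: uexp_continuous.
Qed.

Let P_stable m n t x : (m <= n)%N -> G m x -> Ad (P n t) x = Ad (P m t) x.
Proof.
move=> /subnKC <- Gx; elim: (n - m)%N => [|j IH]; first by rewrite addn0.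
rewrite addnS /= Ad_mul (Ad_comm (hK _ _)) //; apply: KG.
exact: (filt_le filt (leq_addr _ _)).
Qed.

Lemma model_flow_exists : exists beta : R -> A -> A,
  [/\ flow beta, forall n t, beta t @` G n = G n &
    forall m t a, G m a -> beta t (Ad (W m) a) = Ad (W m) (Ad (uexp (k m) t) a)].
Proof.
have H t : exists f : A -> A, star_hom f /\ forall m x, G m x -> f x = Ad (P m t) x.
  have hPhi n : star_hom (Ad (P n t)) by exact: star_hom_Ad.
  have near m x : G m x -> \forall n \near \oo, Ad (P n t) x = Ad (P m t) x.
    by move=> Gx; apply/near_ooP; exists m => n mn; exact: P_stable.
  have [|f [fh cf]] := lim_star_hom hPhi.
    apply: (uhf_ind filt) => [z|m x Gx]; first exact: (shom_cvg_closed hPhi).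
    by exists (Ad (P m t) x); apply: cvg_near_cst; exact: near.
  by exists f; split=> // m x Gx; exact: cvg_eq_near (near _ _ Gx) (cf x).
have [beta hb] := choice H.
have bh t : star_hom (beta t) by case: (hb t).
have bE t m x : G m x -> beta t x = Ad (P m t) x by case: (hb t) => _; apply.
have fb : flow beta.
  apply: flow_intro => //.
  - apply: (uhf_ind filt) => [z|m x Gx]; last by rewrite (bE _ m) // P0 Ad_one.
    exact: (@shom_eq_closed _ _ _ (beta 0) id).
  - move=> s t; apply: (uhf_ind filt) => [z|m x Gx].
      apply: (@shom_eq_closed _ _ _ (beta (s + t)) (beta s \o beta t)) => //.
      exact: star_hom_comp.
    rewrite (bE (s + t) m) // (bE t m) // (bE s m) -?Ad_mul -?PD //.
    exact: G_Ad.
  - apply: (uhf_ind filt) => [z|m x Gx]; first exact: shom_continuous_closed.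
    have -> : (fun t => beta t x) = fun t => Ad (P m t) x.
      by apply/funext => t; exact: bE.
    by move=> t; apply: cvg_Ad; [exact: P_continuous | exact: cvg_cst].
exists beta; split=> // [n t|m t a Ga].
  apply/seteqP; split=> [_ [x Gx <-]|x Gx].
    by rewrite (bE _ n) //; exact: G_Ad.
  exists (beta (- t) x); last by rewrite flowVK.
  by rewrite (bE _ n) //; exact: G_Ad.
(* On the copy [Ad (W m)] of [G m] only the last factor [K m t] acts, and it acts inside this copy;
   the remaining [P m t] lies in [G m] and commutes with the copy. *)
rewrite (bE _ m.+1); last by apply: G_Ad => //; exact: GS.
rewrite /= Ad_mul -/P /K -(shom_Ad (star_hom_Ad (hW m))) Ad_comm //.
by rewrite WG //; exact: G_Ad.
Qed.

End ModelFlow.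

Lemma subr_telescope (V : zmodType) (p q r s : V) :
  p - q + (r - p + (q - s)) = r - s.
Proof.
have e : p - q + (r - p) = r - q by rewrite addrC addrA subrK.
by rewrite addrA e addrA subrK.
Qed.

Section KeyLemma.
Context {R : realType} {A : cstarAlgType R} {F : nat -> set A}.
Hypothesis filt : UHF_filtration F.

(** The self-adjoint part of an approximant is no farther from [h], and the exponential is Lipschitz
    on bounded sets. Unlike [h], the new generator lies in a matrix algebra, and so do its
    exponentials. *)
Lemma uexp_perturb (h : A) (T eps : R) : selfadjoint h -> 0 <= T -> 0 < eps ->
  exists l k, [/\ F l k, selfadjoint k &
    forall t, `|t| <= T -> nrm (uexp k t - uexp h t) <= eps].
Proof.
move=> hs T0 e0; pose M := nrm h + 1; pose C := expR (T * M) * T + 1.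
have C0 : 0 < C by rewrite ltr_wpDl // mulr_ge0 // expR_ge0.
have d0 : 0 < Num.min 1 (eps / C) by rewrite lt_min ltr01 divr_gt0.
have [l [y [Fy hy]]] := filt_approx filt h d0.
pose k := (2^-1 : R)%:C *: (y + star y).
have hk : nrm (h - k) <= nrm (h - y).
  have -> : h - k = (2^-1 : R)%:C *: ((h - y) + star (h - y)).
    by rewrite star_sub hs addrACA -opprD scalerBr half_double.
  by rewrite nrm_half; have := nrmD (h - y) (star (h - y)); rewrite nrm_star; lra.
have c := csub_filt filt l.
exists l, k; split=> [||t ht].
- by apply: csubZ => //; apply: csubD => //; exact: filt_star.
- by rewrite /selfadjoint star_scale conjC_re star_add starK addrC.
move: hy; rewrite lt_min ltr_pdivlMr // => /andP[h1 h2].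
have n1 : nrm k <= M by have := nrm_dist k h; rewrite nrmC /M; lra.
have n2 : nrm h <= M by rewrite /M; lra.
apply: le_trans (uexp_lip_h ht n1 n2) _; rewrite nrmC.
have h3 : expR (T * M) * (T * nrm (h - k)) <= expR (T * M) * (T * nrm (h - y)).
  by apply: ler_wpM2l; [exact: expR_ge0 | exact: ler_wpM2l].
apply: le_trans h3 _; apply: ltW; apply: le_lt_trans h2.
have := nrm_ge0 (h - y); rewrite /C mulrDr mulr1 mulrA mulrC; lra.
Qed.

Context {AA : cstarAlgType R} {tens : A -> A -> AA} (ht : Ctensor tens).
Hypothesis iso : isomorphic AA A.

Lemma model_flow (alpha : R -> A -> A) : approximately_inner alpha ->
  exists (G : nat -> set A) (beta : R -> A -> A) (W : nat -> A) (U : nat -> R -> A),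
  [/\ UHF_filtration G, flow beta, forall n t, beta t @` G n = G n,
      forall m, unitary (W m) &
      [/\ forall m a b, G m a -> G m b -> Ad (W m) a * b = b * Ad (W m) a,
          forall m t a, G m a -> beta t (Ad (W m) a) = Ad (W m) (Ad (U m t) a),
          forall m t, G m (U m t) &
          forall t x, Ad (U m t) x @[m --> \oo] --> alpha t x]].
Proof.
move=> [h [hs hc]].
(* The time window grows with m, so that every fixed time is eventually covered. *)
have H m : exists lk : nat * A, [/\ F lk.1 lk.2, selfadjoint lk.2 &
    forall t, `|t| <= m%:R -> nrm (uexp lk.2 t - uexp (h m) t) <= hpow m].
  have [l [k hk]] := @uexp_perturb (h m) m%:R (hpow m) (hs m) (ler0n _ _) (hpow_gt0 m).
  by exists (l, k).
have [lk hlk] := choice H.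
have H2 n : exists lW : nat * A, [/\ unitary lW.2, F lW.1 lW.2 &
    forall a b, F n a -> F n b -> Ad lW.2 a * b = b * Ad lW.2 a].
  by have [l [W hW]] := uhf_self_commute n ht iso filt; exists (l, W).
have [lW hlW] := choice H2.
(* Level [l m.+1] lies beyond [l m] and contains both the unitary that makes a commuting copy of
   [F (l m)] and the next generator. *)
pose l := fix l m := if m is n.+1 then maxn (l n).+1 (maxn (lW (l n)).1 (lk m).1)
                     else (lk 0%N).1.
have lS m : (l m < l m.+1)%N by rewrite /= leq_maxl.
have lWl m : ((lW (l m)).1 <= l m.+1)%N by rewrite /= (leq_trans _ (leq_maxr _ _)) // leq_maxl.
have lkl m : ((lk m).1 <= l m)%N.
  by case: m => //= m; rewrite (leq_trans _ (leq_maxr _ _)) // leq_maxr.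
have lm m : (m <= l m)%N by elim: m => // m IH; exact: leq_ltn_trans IH (lS m).
pose G m := F (l m).
have filtG : UHF_filtration G.
  split=> [n|n x|| ].
  - exact: (filt_mx filt).
  - by apply: (filt_le filt); exact: ltnW.
  - exact: (filt1 filt).
  - case: (filt) => _ _ _ hd; apply/seteqP; split=> // x _.
    apply/closureP => e e0; have [n [y [Fy hy]]] := filt_approx filt x e0.
    by exists y => //; exists n => //; exact: (filt_le filt (lm n)).
pose k m := (lk m).2; pose W m := (lW (l m)).2.
have ks m : selfadjoint (k m) by case: (hlk m).
have Gk m : G m (k m) by have [h1 _ _] := hlk m; exact: (filt_le filt) h1.
have hW m : unitary (W m) by case: (hlW (l m)).
have GW m : G m.+1 (W m).
  by have [_ h1 _] := hlW (l m); apply: (filt_le filt) h1.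
have WG m a b : G m a -> G m b -> Ad (W m) a * b = b * Ad (W m) a.
  by have [_ _ h1] := hlW (l m); exact: h1.
have [beta [b1 b2 b3]] := model_flow_exists filtG ks Gk hW GW WG.
exists G, beta, W, (fun m t => uexp (k m) t).
split; [exact: filtG | exact: b1 | exact: b2 | exact: hW |].
split; [exact: WG | exact: b3 | move=> m t | move=> t x].
  by apply: csub_cexp (csub_filt filtG m) _; apply: csubZ (csub_filt filtG m) _ _ _.
apply/null_cvg; have hA := (null_cvg _ _).1 (hc t x).
have -> : (fun m => Ad (uexp (k m) t) x - alpha t x) = fun m =>
    (Ad (uexp (k m) t) x - Ad (uexp (h m) t) x) + (Ad (uexp (h m) t) x - alpha t x).
  by apply/funext => m; rewrite addrA subrK.
apply: nullD hA; apply/cvg_nrmP => e e0.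
have [N hN] := hpow_small (2 * nrm x) e0.
apply/near_ooP; exists (maxn N (Num.bound `|t|)) => n; rewrite geq_max => /andP[Nn tn].
rewrite sub0r nrmN; apply: le_lt_trans (hN n Nn).
apply: le_trans (nrm_Ad_sub _ (uexp_unitary _ (ks n)) (uexp_unitary _ (hs n))) _.
apply: ler_wpM2l; first by rewrite mulr_ge0 ?nrm_ge0.
have [_ _] := hlk n; apply.
apply: ltW; apply: lt_le_trans (archi_boundP (normr_ge0 t)) _.
by rewrite ler_nat.
Qed.

Lemma comm_null_closed (B : cstarAlgType R) (f : nat -> A -> B) (z : B) :
  (forall n, star_hom (f n)) -> forall x,
  (forall e : R, 0 < e -> exists2 x',
    (f n x' * z - z * f n x') @[n --> \oo] --> (0 : B) & nrm (x - x') < e) ->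
  (f n x * z - z * f n x) @[n --> \oo] --> (0 : B).
Proof.
move=> fh x; apply: (@null_closed _ _ _ (fun n x => f n x * z - z * f n x) (2 * nrm z)).
move=> n {}x y.
have -> : f n x * z - z * f n x - (f n y * z - z * f n y) =
    f n (x - y) * z - z * f n (x - y).
  by rewrite (shomB (fh n)) mulrBl mulrBr !opprB addrACA [RHS]addrACA; congr (_ + _); rewrite addrC.
apply: le_trans (nrmB _ _) _.
have h1 := nrmM (f n (x - y)) z; have h2 := nrmM z (f n (x - y)).
have h3 := shom_le (fh n) (x - y); have := nrm_ge0 z; nra.
Qed.

Lemma comm_null_closed' (B : cstarAlgType R) (v : nat -> B) (C : R) :
  (forall n, nrm (v n) <= C) -> forall z,
  (forall e : R, 0 < e -> exists2 z',
    (v n * z' - z' * v n) @[n --> \oo] --> (0 : B) & nrm (z - z') < e) ->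
  (v n * z - z * v n) @[n --> \oo] --> (0 : B).
Proof.
move=> hv z; apply: (@null_closed _ _ _ (fun n z => v n * z - z * v n) (2 * C)).
move=> n {}z y.
have -> : v n * z - z * v n - (v n * y - y * v n) = v n * (z - y) - (z - y) * v n.
  by rewrite mulrBl mulrBr !opprB addrACA [RHS]addrACA; congr (_ + _); rewrite addrC.
apply: le_trans (nrmB _ _) _.
have h1 := nrmM (v n) (z - y); have h2 := nrmM (z - y) (v n).
have := nrm_ge0 (z - y); have := hv n; nra.
Qed.

(** The embeddings are [kappa m x = phi (1 (x) Ad (W m) x)], with [phi] the isomorphism given by
    universality; on [G m] they are implemented by unitaries [W' m]. On their images [gamma] acts as
    [beta] up to [Ad (star (u t))], and this correction vanishes asymptotically because the elements
    1 (x) Ad (W m) x are asymptotically central. *)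
Lemma central_model_embedding (alpha gamma : R -> A -> A) :
  flow alpha -> approximately_inner alpha -> universal_UHF_flow tens gamma ->
  exists W : nat -> A, [/\ forall k, unitary (W k),
    forall a b, (Ad (W k) a * b - b * Ad (W k) a) @[k --> \oo] --> (0 : A) &
    forall t a, (gamma t (Ad (W k) a) - Ad (W k) (alpha t a)) @[k --> \oo] --> (0 : A)].
Proof.
move=> fa ia [[fg _] univ].
have [G [beta [W [U [filtG fb bG hW [WG bW GU cU]]]]]] := model_flow ia.
have [|delta [[fd dE] [phi [phiV [phi_iso phiK phiVK [u [[_ hu _] du]]]]]]] := univ beta.
  by split=> //; exists G.
have ph : star_hom phi by case: phi_iso.
have gE t z : gamma t (phi z) = phi (Ad (star (u t)) (delta t z)).
  by rewrite du AdK // phiVK.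
have hr := star_hom_tensr ht.
have hk m : star_hom (fun x => tens 1 (Ad (W m) x)).
  by apply: (star_hom_comp (star_hom_Ad (hW m)) hr).
pose kappa m x := phi (tens 1 (Ad (W m) x)).
have hkappa m : star_hom (kappa m) by exact: (star_hom_comp (hk m) ph).
have [W' hW'] := choice (fun m => uhf_inner_on filtG m (hkappa m)).
have uW' m : unitary (W' m) by case: (hW' m).
have W'E m x : G m x -> Ad (W' m) x = kappa m x by case: (hW' m) => _; apply.
have central c z : (tens 1 (Ad (W n) c) * z - z * tens 1 (Ad (W n) c)) @[n --> \oo] --> (0 : AA).
  move: c z; apply: (uhf_ind filtG) => [c h z|m c Gc].
    apply: (comm_null_closed hk) => e /h[x' hx' hx]; exists x' => //.
  apply: (tens_ind ht) => [z||x y hx hy|x y].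
  - apply: (@comm_null_closed' _ (fun n => tens 1 (Ad (W n) c)) (nrm c)) => n.
    exact: shom_le (hk n) c.
  - by apply: cvg_near_cst; apply: nearW => n; rewrite mulr0 mul0r subrr.
  - have -> : (fun n => tens 1 (Ad (W n) c) * (x + y) - (x + y) * tens 1 (Ad (W n) c)) = fun n =>
      (tens 1 (Ad (W n) c) * x - x * tens 1 (Ad (W n) c)) +
      (tens 1 (Ad (W n) c) * y - y * tens 1 (Ad (W n) c)).
      by apply/funext => n; rewrite mulrDr mulrDl opprD addrACA.
    exact: nullD.
  have -> : (fun n => tens 1 (Ad (W n) c) * tens x y - tens x y * tens 1 (Ad (W n) c)) =
      fun n => tens x (Ad (W n) c * y - y * Ad (W n) c).
    by apply/funext => n; rewrite !(tensM ht) mul1r mulr1 (tensBr ht).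
  apply: (@null_le _ _ _ _ (fun n => Ad (W n) c * y - y * Ad (W n) c) (nrm x)).
    by apply: nearW => n; exact: nrm_tens.
  move: y; apply: (uhf_ind filtG) => [y|m' y Gy].
    apply: (@comm_null_closed' _ (fun n => Ad (W n) c) (nrm c)) => n.
    by rewrite nrm_Ad.
  apply: cvg_near_cst; apply/near_ooP; exists (maxn m m') => n.
  rewrite geq_max => /andP[mn m'n].
  by rewrite WG ?subrr //; [exact: (filt_le filtG) Gc | exact: (filt_le filtG) Gy].
exists W'; split=> // [a b|t a].
  move: a b; apply: (uhf_ind filtG) => [a h b|m a Ga b].
    apply: (@comm_null_closed _ (fun n => Ad (W' n))) => [n|e /h[x' hx' hx]].
      exact: star_hom_Ad.
    by exists x'.
  apply: (@null_le _ _ _ _ (fun n => tens 1 (Ad (W n) a) * phiV b - phiV b * tens 1 (Ad (W n) a)) 1);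
    last exact: central.
  apply/near_ooP; exists m => n mn; rewrite W'E; last exact: (filt_le filtG) Ga.
  by rewrite mul1r -(siso_nrm _ phi_iso) (shomB ph) !(shomM ph) phiVK.
move: a; apply: (uhf_ind filtG) => [a|m a Ga].
  apply: (@null_closed _ _ _ (fun k a => gamma t (Ad (W' k) a) - Ad (W' k) (alpha t a)) 2).
  move=> n x y.
  have -> : gamma t (Ad (W' n) x) - Ad (W' n) (alpha t x) - (gamma t (Ad (W' n) y) - Ad (W' n) (alpha t y))
      = gamma t (Ad (W' n) (x - y)) - Ad (W' n) (alpha t (x - y)).
    rewrite AdB (shomB (flow_shom t fg)) (shomB (flow_shom t fa)) AdB !opprB.
    by rewrite addrACA [RHS]addrACA; congr (_ + _); rewrite addrC.
  apply: le_trans (nrmB _ _) _.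
  rewrite flow_nrm // !nrm_Ad // flow_nrm //; lra.
(* [central] concerns a fixed element, whereas [Ad (U n t) a] varies with n; it is replaced by its
   limit [alpha t a], to which [central] applies. *)
pose X n := tens 1 (Ad (W n) (Ad (U n t) a)).
pose Y n := tens 1 (Ad (W n) (alpha t a)).
have cUa := (null_cvg _ _).1 (cU t a).
have XY : X n - Y n @[n --> \oo] --> (0 : AA).
  apply: (@null_le _ _ _ _ (fun n => Ad (U n t) a - alpha t a) 1) => //.
  apply: nearW => n; rewrite mul1r /X /Y -(shomB (hk n)).
  exact: (shom_le (hk n)).
have Xu : (star (u t) * X n - X n * star (u t)) @[n --> \oo] --> (0 : AA).
  have -> : (fun n => star (u t) * X n - X n * star (u t)) = fun n =>
      - (Y n * star (u t) - star (u t) * Y n) +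
      (star (u t) * (X n - Y n) - (X n - Y n) * star (u t)).
    apply/funext => n; rewrite mulrBl mulrBr opprB opprB.
    exact/esym/subr_telescope.
  apply: nullD; first by rewrite -oppr0; apply: cvgN; exact: central.
  apply: (@null_le _ _ _ _ (fun n => X n - Y n) 2) => //.
  apply: nearW => n; apply: le_trans (nrmB _ _) _.
  have hs := unitary_star (hu t).
  by rewrite nrm_mul_unitaryl // nrm_mul_unitaryr //; lra.
apply: (@null_le _ _ _ _ (fun n => phi (Ad (star (u t)) (X n) - X n) +
    Ad (W' n) (Ad (U n t) a - alpha t a)) 1).
  apply/near_ooP; exists m => n mn.
  have Gna : G n a by exact: (filt_le filtG) Ga.
  have e1 : gamma t (Ad (W' n) a) = phi (Ad (star (u t)) (X n)).
    by rewrite W'E // gE dE (shom1 (flow_shom t fg)) bW.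
  have e2 : Ad (W' n) (Ad (U n t) a) = phi (X n).
    rewrite W'E //; have c := csub_filt filtG n.
    by apply: csubM => //; [exact: csubM | exact: (filt_star filtG)].
  by rewrite mul1r e1 (shomB ph) AdB e2 addrA subrK.
apply: nullD.
  apply: (@null_le _ _ _ _ (fun n => star (u t) * X n - X n * star (u t)) 1) => //.
  apply: nearW => n; rewrite mul1r siso_nrm // nrm_Ad_comm //.
  exact: unitary_star.
apply: (@null_le _ _ _ _ (fun n => Ad (U n t) a - alpha t a) 1) => //.
by apply: nearW => n; rewrite mul1r nrm_Ad.
Qed.

End KeyLemma.

(** * Local uniformity in time *)

Section Baire.
Context {R : realType}.

(** Otherwise every [O N] is open and dense, and Baire gives a time in all of them within the ball
    of radius T, against the pointwise bound. The times beyond T belong to [O N] to make it dense in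
    the whole line. *)
Lemma eventual_uniform_somewhere (f : nat -> R -> R) (c T : R) : 0 < T ->
  (forall k, continuous (f k)) ->
  (forall t, `|t| <= T -> \forall k \near \oo, f k t <= c) ->
  exists (N : nat) (t0 r : R), [/\ 0 < r, `|t0| <= T &
    forall s k, `|s| < r -> (N <= k)%N -> f k (t0 + s) <= c].
Proof.
move=> T0 fc fs; apply: contrapT => h.
pose O (N : nat) : set R := [set t | T < `|t| \/ exists2 k, (N <= k)%N & c < f k t].
have oO N : open (O N).
  rewrite openE => t [tT|[k Nk ck]]; rewrite /interior.
    have : (`|s| @[s --> t] --> `|t|) by exact: norm_continuous.
    by move=> /cvgr_gt/(_ _ tT); apply: filterS => s; left.
  by have /cvgr_gt/(_ _ ck) := fc k t; apply: filterS => s ?; right; exists k.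
have dO N : dense (O N).
  move=> D [t0 Dt0] oD; apply: contrapT => hD; apply: h.
  have hO t : D t -> `|t| <= T /\ forall k, (N <= k)%N -> f k t <= c.
    move=> Dt; split=> [|k Nk].
      by rewrite leNgt; apply/negP => tT; apply: hD; exists t; split=> //; left.
    by rewrite leNgt; apply/negP => tT; apply: hD; exists t; split=> //; right; exists k.
  have /nbhs_ballP[r /= r0 rD] : nbhs t0 D by apply: open_nbhs_nbhs.
  exists N, t0, r; split=> // [|s k sr]; first by case: (hO _ Dt0).
  have [_] : `|t0 + s| <= T /\ forall k, (N <= k)%N -> f k (t0 + s) <= c.
    by apply: hO; apply: rD; rewrite -ball_normE /= opprD addrA subrr sub0r normrN.
  exact.
have /Baire : forall N, open (O N : set R^o) /\ dense (O N : set R^o) by [].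
move=> /(_ (ball (0 : R) T)) [||t []].
- by exists 0; exact: ballxx.
- exact: ball_open.
rewrite -ball_normE /= sub0r normrN => tT tO.
have [N hN] := (near_ooP _).1 (fs t (ltW tT)).
have [] := tO N I; first by rewrite ltNge ltW.
by move=> [k Nk]; rewrite ltNge hN.
Qed.

(** The good interval around [t0] is moved to 0 by [f k s <= f k (t0 + s) + f k (- t0)], at the cost
    of 2c. The third c pays for the largest multiple of [d] below the time considered; only finitely
    many multiples occur. *)
Lemma subadditive_uniform (f : nat -> R -> R) (c T : R) : 0 < T ->
  (forall k, continuous (f k)) ->
  (forall k s t, f k (s + t) <= f k s + f k t) ->
  (forall k t, f k (- t) = f k t) ->
  (forall t, `|t| <= T -> \forall k \near \oo, f k t <= c) ->
  \forall k \near \oo, forall t, `|t| <= T -> f k t <= 3 * c.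
Proof.
move=> T0 fc fD fN fs.
have [N [t0 [r [r0 t0T hr]]]] := eventual_uniform_somewhere T0 fc fs.
pose d := r / 2; have d0 : 0 < d by rewrite /d; lra.
pose n := Num.bound (T / d).
have nT : T < n%:R * d.
  by rewrite -ltr_pdivrMr //; apply: archi_boundP; rewrite divr_ge0 // ltW.
have H1 : \forall k \near \oo, forall j : 'I_n, j%:R * d <= T -> f k (j%:R * d) <= c.
  apply: filter_forall => j; have [jT|jT] := leP (j%:R * d) T; last exact: nearW.
  have : `|j%:R * d| <= T by rewrite ger0_norm // mulr_ge0 // ltW.
  by move=> /fs; apply: filterS => k hk _.
have H2 := fs t0 t0T.
have H3 : \forall k \near \oo, (N <= k)%N by apply/near_ooP; exists N.
apply: filterS (filterI H1 (filterI H2 H3)) => k [h1 [h2 h3]] t tT.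
have -> : f k t = f k `|t| by case: (ger0P t) => // _; rewrite fN.
move: (normr_ge0 t) tT; move: (`|t|) => {}t t_ge0 tT.
have td : 0 <= t / d by rewrite divr_ge0 // ltW.
pose j := Num.truncn (t / d).
have /andP[j1 j2] := truncn_itv td; rewrite -/j in j1 j2.
rewrite ler_pdivlMr // in j1; rewrite ltr_pdivrMr // -natr1 mulrDl mul1r in j2.
have jn : (j < n)%N.
  rewrite -(ltr_nat R); have : j%:R * d < n%:R * d by lra.
  by rewrite ltr_pM2r.
have g1 : f k (j%:R * d) <= c by apply: (h1 (Ordinal jn)); lra.
have g2 : f k (t - j%:R * d) <= f k (t0 + (t - j%:R * d)) + f k t0.
  have := fD k (t0 + (t - j%:R * d)) (- t0).
  by rewrite fN (addrC t0) addrK.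
have g3 : f k (t0 + (t - j%:R * d)) <= c.
  by apply: hr h3; rewrite ger0_norm /d; rewrite /d in d0 j1 j2 *; lra.
have := fD k (t - j%:R * d) (j%:R * d); rewrite subrK; lra.
Qed.

Lemma nrm_continuous (V : normedModType R[i]) (g : R -> V) :
  continuous g -> continuous (fun t => nrm (g t)).
Proof.
move=> hg t; apply/cvgrPdist_lt => e e0.
apply: filterS (cvg_nrm_lt (hg t) e0) => s; apply: le_lt_trans.
rewrite ler_norml; have := nrm_dist (g t) (g s); have := nrm_dist (g s) (g t).
rewrite (nrmC (g s)); lra.
Qed.

(** A flow is isometric, so the displacement [nrm (delta t w - w)] is even and subadditive in t. *)
Lemma flow_uniform (B : cstarAlgType R) (delta : R -> B -> B) (w : nat -> B) (c T : R) :
  flow delta -> 0 < T ->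
  (forall t, `|t| <= T -> \forall k \near \oo, nrm (delta t (w k) - w k) <= c) ->
  \forall k \near \oo, forall t, `|t| <= T -> nrm (delta t (w k) - w k) <= 3 * c.
Proof.
move=> fd T0; apply: subadditive_uniform => // [k|k s t|k t].
- apply: nrm_continuous => t; apply: cvgB; last exact: cvg_cst.
  exact: flow_continuous.
- have -> : delta (s + t) (w k) - w k = (delta s (w k) - w k) + delta s (delta t (w k) - w k).
    by rewrite (shomB (flow_shom s fd)) -(flowD fd) [RHS]addrC addrA subrK.
  by apply: le_trans (nrmD _ _) _; rewrite flow_nrm.
by rewrite -(flow_nrm t _ fd) (shomB (flow_shom t fd)) flowVK // nrmC.
Qed.

End Baire.

(** * Approximate absorption *)

Section ApproximateStep.
Context {R : realType} {A AA : cstarAlgType R} {tens : A -> A -> AA} (ht : Ctensor tens).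

Lemma norm_null (u : nat -> AA) :
  (`|u n| @[n --> \oo] --> (0 : R[i]^o)) <-> (u n @[n --> \oo] --> (0 : AA)).
Proof.
split=> /cvg_nrmP h; apply/cvg_nrmP => e e0; apply: filterS (h _ e0) => n;
by rewrite !sub0r !nrmN nrmE nrm_real ger0_norm ?nrm_ge0.
Qed.

Lemma near_seq (X : choiceType) (s : seq X) (P : nat -> X -> Prop) :
  (forall x, \forall n \near \oo, P n x) ->
  \forall n \near \oo, forall x, x \in s -> P n x.
Proof.
move=> h; elim: s => [|y s IH]; first exact: nearW.
apply: filterS (filterI (h y) IH) => n [h1 h2] x.
by rewrite inE => /orP[/eqP ->|]; [exact: h1 | exact: h2].
Qed.

Context {alpha gamma : R -> A -> A} (fa : flow alpha) (fg : flow gamma).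
Context {delta dd : R -> AA -> AA} {sigma : AA -> AA}.
Hypothesis hdelta : tensor_flow tens alpha gamma delta.
Hypothesis hdd : tensor_flow tens alpha alpha dd.
Hypothesis hsigma : flip tens sigma.
Context {u : nat -> AA} (hu : forall n, unitary (u n)).
Hypothesis u_sigma : forall z, Ad (u n) z @[n --> \oo] --> sigma z.
Hypothesis u_dd : forall t, dd t (u n) - u n @[n --> \oo] --> (0 : AA).
Context {W : nat -> A} (hW : forall k, unitary (W k)).
Hypothesis W_central :
  forall a b, (Ad (W k) a * b - b * Ad (W k) a) @[k --> \oo] --> (0 : A).
Hypothesis W_flow :
  forall t a, (gamma t (Ad (W k) a) - Ad (W k) (alpha t a)) @[k --> \oo] --> (0 : A).

Let w k := tens 1 (W k).
Let v m k := Ad (w k) (u m).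

Let hw k : unitary (w k).
Proof. by apply: (tens_unitary ht) => //; exact: unitary1. Qed.

Let hv m k : unitary (v m k). Proof. exact: Ad_unitary. Qed.

Let Ad_w k a b : Ad (w k) (tens a b) = tens a (Ad (W k) b).
Proof. by rewrite (Ad_tens ht) Ad_one. Qed.

(** On elementary tensors this is the centrality of [W]. It is applied to [z = u m], without
    uniformity in m. *)
Let w_comm z x : (Ad (w k) z * tens 1 x - tens 1 x * Ad (w k) z) @[k --> \oo] --> (0 : AA).
Proof.
move: z; apply: (tens_ind ht) => [z|| z1 z2 h1 h2|a b].
- by apply: (comm_null_closed (f := fun k => Ad (w k))) => n; exact: star_hom_Ad.
- apply: cvg_near_cst; apply: nearW => n.
  by rewrite (shom0 (star_hom_Ad (hw n))) mulr0 mul0r subrr.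
- have -> : (fun k => Ad (w k) (z1 + z2) * tens 1 x - tens 1 x * Ad (w k) (z1 + z2)) =
    fun k => (Ad (w k) z1 * tens 1 x - tens 1 x * Ad (w k) z1) +
      (Ad (w k) z2 * tens 1 x - tens 1 x * Ad (w k) z2).
    by apply/funext => k; rewrite AdD mulrDr mulrDl opprD addrACA.
  exact: nullD.
apply: (@null_le _ _ _ _ (fun k => Ad (W k) b * x - x * Ad (W k) b) (nrm a)) => //.
apply: nearW => k; rewrite Ad_w !(tensM ht) mulr1 mul1r -(tensBr ht).
exact: (nrm_tens ht).
Qed.

Let v_fixes m x : Ad (v m k) (tens 1 x) - tens 1 x @[k --> \oo] --> (0 : AA).
Proof.
apply: (@null_le _ _ _ _ _ 1) (w_comm (u m) x); apply: nearW => k.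
by rewrite nrm_Ad_comm // mul1r.
Qed.

(** In the limit [Ad (w k)] turns alpha (x) alpha into alpha (x) gamma, so that almost invariance of
    [u m] under [dd] passes to [v m k] under [delta]. *)
Let w_flow t z : delta t (Ad (w k) z) - Ad (w k) (dd t z) @[k --> \oo] --> (0 : AA).
Proof.
have dh := flow_shom t (hdelta.1); have ddh := flow_shom t (hdd.1).
have add x y k : delta t (Ad (w k) (x + y)) - Ad (w k) (dd t (x + y)) =
  (delta t (Ad (w k) x) - Ad (w k) (dd t x)) + (delta t (Ad (w k) y) - Ad (w k) (dd t y)).
  by rewrite AdD (shomD dh) (shomD ddh) AdD opprD addrACA.
move: z; apply: (tens_ind ht) => [z|| z1 z2 h1 h2|a b].
- apply: (@null_closed _ _ _ (fun k z => delta t (Ad (w k) z) - Ad (w k) (dd t z)) 2) => k x y.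
  have -> : delta t (Ad (w k) x) - Ad (w k) (dd t x) - (delta t (Ad (w k) y) - Ad (w k) (dd t y)) =
    delta t (Ad (w k) (x - y)) - Ad (w k) (dd t (x - y)).
    by apply/eqP; rewrite subr_eq -add subrK.
  apply: le_trans (nrmB _ _) _.
  rewrite (flow_nrm _ _ hdelta.1) !nrm_Ad // (flow_nrm _ _ hdd.1); lra.
- apply: cvg_near_cst; apply: nearW => k.
  by rewrite (shom0 ddh) (shom0 (star_hom_Ad (hw k))) (shom0 dh) subrr.
- have -> : (fun k => delta t (Ad (w k) (z1 + z2)) - Ad (w k) (dd t (z1 + z2))) = fun k =>
    (delta t (Ad (w k) z1) - Ad (w k) (dd t z1)) + (delta t (Ad (w k) z2) - Ad (w k) (dd t z2)).
    by apply/funext => k; exact: add.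
  exact: nullD.
apply: (@null_le _ _ _ _ (fun k => gamma t (Ad (W k) b) - Ad (W k) (alpha t b)) (nrm (alpha t a))) => //.
apply: nearW => k; rewrite hdd.2 !Ad_w hdelta.2 -(tensBr ht).
exact: (nrm_tens ht).
Qed.

(** On a (x) 1, [u m] acts almost as the flip and [Ad (w k)] sends the result to 1 (x) Ad (W k) a;
    on 1 (x) b almost nothing moves. Hence a (x) b lands near 1 (x) (Ad (W k) a * b). The range of k
    depends on m because [v_fixes] does. *)
Let v_absorbs z (e : R) : 0 < e -> \forall m \near \oo, \forall k \near \oo,
  exists x, nrm (Ad (v m k) z - tens 1 x) <= e.
Proof.
move: z e; apply: (tens_ind ht) => [z h e e0||x y hx hy e e0|a b e e0].
- have e2 : 0 < e / 2 by lra.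
  have [z' /(_ _ e2) hz' hz] := h _ e2.
  apply: filterS hz' => m; apply: filterS => k [x hx]; exists x.
  have := nrm_tri (Ad (v m k) z') (Ad (v m k) z) (tens 1 x).
  rewrite -AdB nrm_Ad //; lra.
- move=> e e0; apply: nearW => m; apply: nearW => k; exists 0.
  by rewrite (shom0 (star_hom_Ad (hv m k))) (tens0r ht) subrr nrm0 ltW.
- have e2 : 0 < e / 2 by lra.
  apply: filterS (filterI (hx _ e2) (hy _ e2)) => m [h1 h2].
  apply: filterS (filterI h1 h2) => k [[x' hx'] [y' hy']]; exists (x' + y').
  rewrite AdD (tensDr ht) opprD addrACA; apply: le_trans (nrmD _ _) _; lra.
have K0 : 0 < nrm a + nrm b + 1 by have := nrm_ge0 a; have := nrm_ge0 b; lra.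
pose d := e / (nrm a + nrm b + 1).
have d0 : 0 < d by rewrite divr_gt0.
apply: filterS (cvg_nat_lt (@u_sigma (tens a 1)) d0) => m.
rewrite (hsigma.2) nrmC => hm.
apply: filterS (cvg_nat_lt (@v_fixes m b) d0) => k; rewrite sub0r nrmN => hk.
exists (Ad (W k) a * b); pose p := Ad (v m k) (tens a 1); pose q := Ad (v m k) (tens 1 b).
have -> : Ad (v m k) (tens a b) - tens 1 (Ad (W k) a * b) =
    p * (q - tens 1 b) + (p - tens 1 (Ad (W k) a)) * tens 1 b.
  rewrite mulrBr mulrBl addrA subrK (tensE ht) AdM //; congr (_ - _).
  by rewrite (tensM ht) mulr1.
have hp : nrm (p - tens 1 (Ad (W k) a)) <= d.
  (* [Ad (w k)] fixes [tens a 1], so it can be pulled out of the conjugation by [Ad (w k) (u m)]. *)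
  have -> : p = Ad (w k) (Ad (u m) (tens a 1)).
    rewrite /p /v -{1}(Ad1 (hW k)) -Ad_w.
    by rewrite -(shom_Ad (star_hom_Ad (hw k))).
  by rewrite -Ad_w -AdB nrm_Ad // ltW.
have n1 : nrm p <= nrm a by rewrite /p nrm_Ad //; exact: (shom_le (star_hom_tensl ht)).
have n2 : nrm (tens 1 b) <= nrm b by exact: (shom_le (star_hom_tensr ht)).
apply: le_trans (nrmD _ _) _.
have g1 : nrm (p * (q - tens 1 b)) <= nrm a * d.
  by apply: le_trans (nrmM _ _) _; apply: ler_pM; rewrite ?nrm_ge0 // ltW.
have g2 : nrm ((p - tens 1 (Ad (W k) a)) * tens 1 b) <= d * nrm b.
  by apply: le_trans (nrmM _ _) _; apply: ler_pM; rewrite ?nrm_ge0.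
have : d * (nrm a + nrm b + 1) = e by rewrite /d divfK // gt_eqF.
lra.
Qed.

(* s is the adjoint of Ad (1 (x) W k) (u m) for a suitable m and then a large k. *)
Lemma absorbing_unitary (e T : R) (X : seq A) (Z : seq AA) : 0 < e -> 0 < T ->
  exists s, [/\ unitary s,
    forall x, x \in X -> nrm (Ad s (tens 1 x) - tens 1 x) <= e,
    forall z, z \in Z -> exists x, nrm (Ad (star s) z - tens 1 x) <= e &
    forall t, `|t| <= T -> nrm (delta t s - s) <= e].
Proof.
(* Each use of [flow_uniform] costs a factor 3: 3 (e / 10) + e / 30 = e / 3, and 3 (e / 3) = e. *)
move=> e0 T0; have e10 : 0 < e / 10 by lra.
have M1 : \forall m \near \oo, forall t, `|t| <= T -> nrm (dd t (u m) - u m) <= 3 * (e / 10).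
  apply: (flow_uniform hdd.1 T0) => t _.
  apply: filterS (cvg_nat_lt (@u_dd t) e10) => m.
  by rewrite sub0r nrmN => /ltW.
have M2 := near_seq Z (fun z => v_absorbs z e0).
have [m [h1 h2]] := near_oo_ex (filterI M1 M2).
have K1 : \forall k \near \oo, forall x, x \in X ->
    nrm (Ad (v m k) (tens 1 x) - tens 1 x) < e.
  apply: near_seq => x; apply: filterS (cvg_nat_lt (@v_fixes m x) e0) => k.
  by rewrite sub0r nrmN.
have K2 : \forall k \near \oo, forall z, z \in Z ->
    exists x, nrm (Ad (v m k) z - tens 1 x) <= e.
  elim: Z h2 {M2} => [|z Z IH] h2; first exact: nearW.
  have h3 : \forall k \near \oo, exists x, nrm (Ad (v m k) z - tens 1 x) <= e.
    by apply: h2; rewrite inE eqxx.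
  have h4 := IH (fun z' zZ => h2 z' (mem_behead (s := z :: Z) zZ)).
  apply: filterS (filterI h3 h4) => k [g1 g2] z'.
  by rewrite inE => /orP[/eqP ->|]; [exact: g1 | exact: g2].
have K3 : \forall k \near \oo, forall t, `|t| <= T ->
    nrm (delta t (v m k) - v m k) <= 3 * (e / 3).
  apply: (flow_uniform hdelta.1 T0) => t tT.
  have e30 : 0 < e / 30 by lra.
  apply: filterS (cvg_nat_lt (@w_flow t (u m)) e30) => k.
  rewrite sub0r nrmN => g1; have g2 := h1 t tT.
  have := nrm_tri (Ad (w k) (dd t (u m))) (delta t (v m k)) (v m k).
  rewrite -AdB nrm_Ad //; rewrite -/(v m k) in g1; lra.
have [k [[g1 g2] g3]] := near_oo_ex (filterI (filterI K1 K2) K3).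
exists (star (v m k)); split.
- exact: unitary_star.
- move=> x xX; apply: le_trans (ltW (g1 x xX)).
  have h3 := nrm_Ad (Ad (star (v m k)) (tens 1 x) - tens 1 x) (hv m k).
  by rewrite -h3 AdB AdVK // nrmC.
- by move=> z zZ; rewrite starK; exact: g2.
move=> t tT; rewrite (shom_star (flow_shom t hdelta.1)) -star_sub nrm_star.
by have := g3 t tT; lra.
Qed.

End ApproximateStep.

(** * Intertwining *)

Section Isometry.
Context {R : realType} {A B : cstarAlgType R} {f : A -> B} (fh : star_hom f).

(** The coefficients of [x] are scalars, and a scalar keeps its norm under a unital homomorphism;
    the explicit formula for a coefficient then bounds it by [nrm (f x)]. *)
Lemma mspan_shom_bound (I : finType) (e : I -> I -> A) : munits e ->
  exists C : R, forall x, mspan e x -> nrm x <= C * nrm (f x).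
Proof.
move=> he; exists (\sum_i \sum_j (\sum_p nrm (f (e p i)) * nrm (f (e j p))) * nrm (e i j)) => x ex.
rewrite {1}(mspan_decomp he x) mulr_suml.
apply: le_trans (nrm_sum _ _ _) _; apply: ler_sum => i _; rewrite mulr_suml.
apply: le_trans (nrm_sum _ _ _) _; apply: ler_sum => j _.
have [c hc] := mspan_coef he i j ex.
rewrite hc -scalerAl mul1r nrmZ mulrAC; apply: ler_wpM2r; first exact: nrm_ge0.
have -> : nrm c = nrm (f (c *: 1)) by rewrite (shomZ fh) (shom1 fh) nrmZ nrm_one mulr1.
rewrite -hc (shom_sum fh) mulr_suml.
apply: le_trans (nrm_sum _ _ _) _; apply: ler_sum => p _.
rewrite !(shomM fh) mulrAC; apply: le_trans (nrmM _ _) _.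
by apply: ler_wpM2r; [exact: nrm_ge0 | exact: nrmM].
Qed.

(** The constant of [mspan_shom_bound] is common to all powers of [h = star y * y] in [F n], so
    taking 2^m-th roots removes it. The result makes [tens 1] isometric. *)
Lemma uhf_shom_nrm (F : nat -> set A) : UHF_filtration F ->
  forall x, nrm (f x) = nrm x.
Proof.
move=> filt x; apply/eqP; rewrite eq_le (shom_le fh) /=.
apply/ler_addgt0Pl => eps eps0; have e2 : 0 < eps / 2 by lra.
have [n [y [Fy hy]]] := filt_approx filt x e2.
suff hfy : nrm y <= nrm (f y).
  have h1 := nrm_dist x y; have h2 := nrm_dist (f y) (f x).
  have h3 := shom_le fh (y - x); rewrite (shomB fh) nrmC in h3.
  rewrite (nrmC (f y)) in h2; rewrite (nrmC y) in h3; lra.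
rewrite -(@ler_pXn2r _ 2) ?nnegrE ?nrm_ge0 // -!nrm_cstar -(shom_star fh) -(shomM fh).
have [k [e [he eF]]] := full_matrix_units (filt_mx filt n) (filt1 filt n).
have [C hC] := mspan_shom_bound he.
set h := star y * y; have hs : selfadjoint h by rewrite /selfadjoint star_mul starK.
have Fh : F n h by apply: (csubM (csub_filt filt n)) => //; exact: (filt_star filt).
apply: (@pow2_le _ _ _ C); rewrite ?nrm_ge0 // => m.
have fs : selfadjoint (f h) by rewrite /selfadjoint -(shom_star fh) hs.
rewrite -!nrm_sa_pow // -(shomX fh); apply: hC; rewrite eF.
exact: (csubX (csub_filt filt n)).
Qed.

End Isometry.

Section Intertwining.
Context {R : realType}.

(** Increasing finite lists with dense linear span; density is phrased as an induction principle,
    the form in which convergence and surjectivity are proved. *)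
Definition total (B : cstarAlgType R) (C : nat -> seq B) :=
  (forall n x, x \in C n -> x \in C n.+1) /\
  forall P : B -> Prop,
    (forall z, (forall e : R, 0 < e -> exists2 z', P z' & nrm (z - z') < e) -> P z) ->
    (forall x y, P x -> P y -> P (x + y)) -> (forall (c : R[i]) x, P x -> P (c *: x)) ->
    P 0 -> (forall n x, x \in C n -> P x) -> forall x, P x.

Context {A B : cstarAlgType R} {iota : A -> B} (ih : star_hom iota).
Hypothesis iota_nrm : forall x, nrm (iota x) = nrm x.
Context {gamma : R -> A -> A} {delta : R -> B -> B} (fd : flow delta).
Hypothesis gd : forall t x, delta t (iota x) = iota (gamma t x).
Hypothesis absorb : forall (e T : R) (X : seq A) (Z : seq B), 0 < e -> 0 < T ->
  exists s, [/\ unitary s,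
    forall x, x \in X -> nrm (Ad s (iota x) - iota x) <= e,
    forall z, z \in Z -> exists x, nrm (Ad (star s) z - iota x) <= e &
    forall t, `|t| <= T -> nrm (delta t s - s) <= e].
Context {CA : nat -> seq A} {CB : nat -> seq B}.
Hypotheses (tA : total CA) (tB : total CB).

(* p = (V_n, X_n) and q = (V_{n+1}, X_{n+1}), where V_{n+1} = V_n s for some absorbing s and X_n
   lists the elements that all later unitaries approximately fix. *)
Let spec (n : nat) (p q : B * seq A) := [/\
  unitary p.1 -> unitary q.1 /\ (forall x, x \in p.2 ++ CA n -> x \in q.2),
  unitary p.1 -> forall x, x \in p.2 ->
    nrm (Ad q.1 (iota x) - Ad p.1 (iota x)) <= hpow n,
  unitary p.1 -> forall z, z \in CB n ->
    exists2 x, x \in q.2 & nrm (Ad (star q.1) z - iota x) <= hpow n &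
  unitary p.1 -> forall t, `|t| <= n.+1%:R ->
    nrm (q.1 * delta t (star q.1) - p.1 * delta t (star p.1)) <= hpow n].

Let spec_exists n p : exists q, spec n p q.
Proof.
case: p => V X.
have [s [hs s1 s2 s3]] := @absorb (hpow n) n.+1%:R X [seq Ad (star V) z | z <- CB n]
  (hpow_gt0 n) (ltr0Sn _ _).
have H z : exists x, z \in CB n -> nrm (Ad (star s) (Ad (star V) z) - iota x) <= hpow n.
  case: (boolP (z \in CB n)) => zC; last by exists 0.
  have [|x hx] := s2 (Ad (star V) z); first exact: map_f.
  by exists x.
have [g hg] := choice H.
exists (V * s, X ++ CA n ++ [seq g z | z <- CB n]); split=> /= hV.
- split; first exact: unitary_mul.
  by move=> x; rewrite catA !mem_cat => ->.
- by move=> x xX; rewrite Ad_mul -AdB nrm_Ad //; exact: s1.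
- move=> z zC; exists (g z); first by rewrite !mem_cat map_f ?orbT.
  by rewrite star_mul Ad_mul; exact: hg.
move=> t ht; have dh := flow_shom t fd.
(* The increment of the approximate cocycle is [s - delta t s] between unitaries: its size is
   exactly the failure of [s] to be invariant. *)
have -> : V * s * delta t (star (V * s)) - V * delta t (star V) =
    V * ((s - delta t s) * delta t (star s)) * delta t (star V).
  rewrite star_mul (shomM dh) mulrBl mulrBr mulrBl -(shomM dh s) hs.2 (shom1 dh) mulr1.
  by rewrite !mulrA.
rewrite nrm_mul_unitaryr; last by apply: shom_unitary => //; exact: unitary_star.
rewrite nrm_mul_unitaryl // nrm_mul_unitaryr; last by apply: shom_unitary => //; exact: unitary_star.
by rewrite nrmC; exact: s3.
Qed.

(** The isomorphism [f] is the limit of the [Ad (V n) \o iota], the cocycle [c t] that of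
    [V n * delta t (star (V n))]; the relation between them holds exactly at every stage. [f] is
    isometric, so its range is closed. It is dense because the element whose image approximates
    [Ad (star (V n.+1)) z] is put into [X n.+1] and hardly moved afterwards. *)
Lemma intertwining : cocycle_conjugate gamma delta.
Proof.
have [next hn] := choice (fun np : nat * (B * seq A) => spec_exists np.1 np.2).
pose st := fix st n := if n is m.+1 then next (m, st m) else (1 : B, [::] : seq A).
have hst n : spec n (st n) (st n.+1) by exact: hn (n, st n).
pose V n := (st n).1; pose X n := (st n).2.
have hV n : unitary (V n).
  elim: n => [|n IH]; first exact: unitary1.
  by have [h _ _ _] := hst n; case: (h IH).
have XX n x : x \in X n -> x \in X n.+1.
  by have [h _ _ _] := hst n; have [_ h1] := h (hV n) => xX; apply: h1; rewrite mem_cat xX.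
have CX n x : x \in CA n -> x \in X n.+1.
  by have [h _ _ _] := hst n; have [_ h1] := h (hV n) => xX; apply: h1; rewrite mem_cat xX orbT.
have XN n k x : x \in X n -> x \in X (k + n)%N.
  by move=> xX; elim: k => // k IH; rewrite addSn; exact: XX.
pose Phi n x := Ad (V n) (iota x).
have hPhi n : star_hom (Phi n) by exact: star_hom_comp ih (star_hom_Ad (hV n)).
have geo n x : x \in X n -> exists l : B, (Phi k x @[k --> \oo] --> l) /\
    nrm (l - Phi n x) <= 2 * hpow n.
  move=> xX; have [|l [hl hb]] := @geo_cvg _ B (fun k => Phi (k + n)%N x) (hpow n).
    move=> k; have [_ h _ _] := hst (k + n)%N.
    by rewrite addSn /hpow mulrC -exprD; apply: h; [exact: hV | exact: XN].
  exists l; split; first by have := hl; rewrite (@cvg_shiftn n _ (fun k => Phi k x)).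
  by have := hb 0%N; rewrite hpow0 mulr1 add0n.
have [|f [fh cf]] := lim_star_hom hPhi.
  case: tA => _; apply.
  - by move=> z h; exact: (shom_cvg_closed hPhi).
  - move=> x y [l hl] [m hm]; exists (l + m); under eq_fun do rewrite (shomD (hPhi _)).
    exact: cvgD.
  - move=> c x [l hl]; exists (c *: l); under eq_fun do rewrite (shomZ (hPhi _)).
    exact: cvgZr.
  - by exists 0; under eq_fun do rewrite (shom0 (hPhi _)); exact: cvg_cst.
  - by move=> n x /CX /geo[l [hl _]]; exists l.
have f_nrm x : nrm (f x) = nrm x.
  apply/eqP; rewrite eq_le (shom_le fh) /=; apply/ler_addgt0Pl => e e0.
  have [n] := near_oo_ex (cvg_nat_lt (@cf x) e0).
  have := nrm_dist (Phi n x) (f x); rewrite nrmC {1}/Phi nrm_Ad // iota_nrm; lra.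
have f_near n x : x \in X n -> nrm (f x - Phi n x) <= 2 * hpow n.
  by move=> /geo[l [hl hb]]; rewrite (cvg_eq (@cf x) hl).
have f_closed z : (forall e : R, 0 < e -> exists x, nrm (z - f x) < e) -> exists x, f x = z.
  move=> h; have [y hy] := choice (fun n => h (hpow n) (hpow_gt0 n)).
  have [|x hx] := @nrm_cauchy _ _ y.
    move=> e e0; have [N hN] := hpow_small 2 e0; exists N => n Nn.
    rewrite -f_nrm (shomB fh); apply: le_lt_trans (nrm_tri z _ _) _.
    have := hN _ (leqnn N); have := hN n Nn; have := hy n; have := hy N.
    rewrite (nrmC (f (y n))); lra.
  exists x; apply: (cvg_eq (cvg_shom fh hx)); apply/cvg_nrmP => e e0.
  have [N hN] := hpow_small 1 e0; apply/near_ooP; exists N => n /hN.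
  by rewrite mul1r; apply: lt_trans.
have f_surj z : exists x, f x = z.
  move: z; case: tB => CBS; apply.
  - move=> z h; apply: f_closed => e /h[_ [x <-] hx]; by exists x.
  - by move=> x y [a <-] [b <-]; exists (a + b); rewrite (shomD fh).
  - by move=> c x [a <-]; exists (c *: a); rewrite (shomZ fh).
  - by exists 0; rewrite (shom0 fh).
  move=> n z zC; apply: f_closed => e e0; have [N hN] := hpow_small 2 e0.
  (* As the lists increase, [z] is treated again at a later stage, where the errors are small
     enough. *)
  have zm : z \in CB (N + n)%N by elim: (N) => // k; rewrite addSn; exact: CBS.
  have [_ _ h _] := hst (N + n)%N; have [x xX hx] := h (hV _) z zm; exists x.
  have h1 := f_near _ _ xX; have h2 := hN (N + n)%N (leq_addr _ _).
  have h3 : nrm (z - Phi (N + n).+1 x) <= hpow (N + n)%N.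
    by move: hx; rewrite -(nrm_Ad _ (hV (N + n).+1)) AdB AdVK.
  have h4 := nrm_tri (Phi (N + n).+1 x) z (f x).
  rewrite (nrmC (Phi _ x)) in h4; rewrite -hpowS in h1; lra.
pose cn n t := V n * delta t (star (V n)).
have dh t := flow_shom t fd.
have geo_c t n : `|t| <= n.+1%:R -> exists l : B, (cn k t @[k --> \oo] --> l) /\
    nrm (l - cn n t) <= 2 * hpow n.
  move=> tn; have [|l [hl hb]] := @geo_cvg _ B (fun k => cn (k + n)%N t) (hpow n).
    move=> k; have [_ _ _ h] := hst (k + n)%N.
    rewrite addSn /hpow mulrC -exprD; apply: h; first exact: hV.
    by apply: le_trans tn _; rewrite ler_nat ltnS leq_addl.
  exists l; split; first by have := hl; rewrite (@cvg_shiftn n _ (fun k => cn k t)).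
  by have := hb 0%N; rewrite hpow0 mulr1 add0n.
have tb (t : R) : `|t| <= (Num.bound `|t|).+1%:R.
  by rewrite ltW // (lt_le_trans (archi_boundP (normr_ge0 t))) // ler_nat.
have [c hc] := choice (fun t => geo_c t _ (tb t)).
have cc t : cn k t @[k --> \oo] --> c t by case: (hc t).
have c_near t n : `|t| <= n.+1%:R -> nrm (c t - cn n t) <= 2 * hpow n.
  by move=> /geo_c[l [hl hb]]; rewrite (cvg_eq (@cc t) hl).
have cn_unitary n t : unitary (cn n t).
  apply: unitary_mul => //; apply: shom_unitary => //; exact: unitary_star.
have c_unitary t : unitary (c t).
  split.
    apply: (cvg_eq (cvg_mul (cvg_star (@cc t)) (@cc t))).
    by apply: cvg_near_cst; apply: nearW => n; case: (cn_unitary n t).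
  apply: (cvg_eq (cvg_mul (@cc t) (cvg_star (@cc t)))).
  by apply: cvg_near_cst; apply: nearW => n; case: (cn_unitary n t).
have c_cocycle s t : c s * delta s (c t) = c (s + t).
  apply: (cvg_eq (cvg_mul (@cc s) (cvg_shom (dh s) (@cc t)))).
  have -> : (fun n => cn n s * delta s (cn n t)) = fun n => cn n (s + t) => //.
  apply/funext => n; rewrite /cn (shomM (dh s)) -(flowD fd) mulrA -(mulrA (V n)).
  by rewrite -(shomM (dh s)) (hV n).1 (shom1 (dh s)) mulr1.
have c_continuous : continuous c.
  move=> t; apply/cvg_nrmP => e e0; have e6 : 0 < e / 3 by lra.
  have [N hN] := hpow_small 2 e6.
  (* The time window of stage n contains the ball of radius 1 around t, so [cn n] approximates [c]
     uniformly there. *)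
  pose n := (N + Num.bound `|t|)%N.
  have tn : `|t| + 1 <= n.+1%:R.
    rewrite -natr1 lerD2r ltW // (lt_le_trans (archi_boundP (normr_ge0 t))) //.
    by rewrite ler_nat leq_addl.
  have cnc : continuous (cn n).
    by move=> x; apply: cvg_mul; [exact: cvg_cst | exact: flow_continuous].
  have st1 : \forall s \near t, ball t 1 s by exact: nbhsx_ballx.
  apply: filterS2 st1 (cvg_nrm_lt (cnc t) e6) => s.
  rewrite -ball_normE /= => hs hcn.
  have sn : `|s| <= n.+1%:R.
    by have := ler_normD t (s - t); rewrite addrC subrK (distrC s); lra.
  have tn' : `|t| <= n.+1%:R by lra.
  have h1 := c_near _ _ sn; have h2 := c_near _ _ tn'; have h3 := hN n (leq_addr _ _).
  have h4 := nrm_tri (cn n t) (c t) (c s); have h5 := nrm_tri (cn n s) (cn n t) (c s).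
  rewrite (nrmC (cn n s)) in h5; lra.
have f_flow t x : f (gamma t x) = Ad (c t) (delta t (f x)).
  apply: (cvg_eq (@cf _)).
  have -> : (fun n => Phi n (gamma t x)) = fun n => Ad (cn n t) (delta t (Phi n x)).
    apply/funext => n; rewrite /Phi /cn -gd (shom_Ad (dh t)) -Ad_mul -mulrA.
    by rewrite -(shomM (dh t)) (hV n).1 (shom1 (dh t)) mulr1.
  by apply: cvg_Ad; [exact: cc | apply: (cvg_shom (dh t)); exact: cf].
have [g fg] := choice f_surj.
have gf : cancel f g.
  move=> x; apply/eqP; rewrite -subr_eq0; apply/eqP/nrm_eq0.
  by rewrite -f_nrm (shomB fh) fg subrr nrm0.
have fi : star_iso f by split=> //; exists g.
have gi := star_iso_inv fi gf fg.
have [gh _] := gi.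
exists f, g; split=> //; exists (fun t => g (c t)); split; first split.
- by move=> t; apply: (cvg_shom gh); exact: c_continuous.
- by move=> t; apply: (shom_unitary gh).
- by move=> s t; rewrite fg -(shomM gh) c_cocycle.
by move=> t x; rewrite -(shom_Ad gh) -f_flow gf.
Qed.

End Intertwining.

Section Totals.
Context {R : realType} {A AA : cstarAlgType R} {tens : A -> A -> AA} (ht : Ctensor tens).

Lemma uhf_total (F : nat -> set A) : UHF_filtration F -> exists C : nat -> seq A, total C.
Proof.
move=> filt.
have H n : exists D : seq A, forall P : A -> Prop,
    (forall x y, P x -> P y -> P (x + y)) -> (forall (c : R[i]) x, P x -> P (c *: x)) ->
    P 0 -> (forall x, x \in D -> P x) -> forall x, F n x -> P x.
  have [k [e [he eF]]] := full_matrix_units (filt_mx filt n) (filt1 filt n).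
  exists [seq e p.1 p.2 | p <- enum {: 'I_k.+1 * 'I_k.+1}] => P PD PZ P0 PD' x.
  rewrite -eF; apply: mspan_ind => // i j; apply: PD'.
  by apply/mapP; exists (i, j); rewrite // mem_enum.
have [D hD] := choice H.
pose C := fix C n := if n is m.+1 then C m ++ D n else D 0%N.
have DC n x : x \in D n -> x \in C n.
  by case: n => //= n xD; rewrite mem_cat xD orbT.
exists C; split=> [n x xC|P Pc PD PZ P0 PC]; first by rewrite /= mem_cat xC.
apply: (uhf_ind filt) => // n x; apply: hD => // y yD.
by apply: (PC n); exact: DC.
Qed.

Lemma tens_total (C : nat -> seq A) : total C ->
  total (fun n => [seq tens a b | a <- C n, b <- C n]).
Proof.
move=> [CS CP]; have CN m n x : (m <= n)%N -> x \in C m -> x \in C n.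
  by move=> /subnKC <- xC; elim: (n - m)%N => [|k IH]; rewrite ?addn0 // addnS; exact: CS.
split=> [n _ /allpairsP[[a b] /= [aC bC ->]]|P Pc PD PZ P0 PC].
  by apply: allpairs_f; exact: CS.
have small (z : A) (e : R) : 0 < e -> 0 < e / (nrm z + 1).
  by move=> e0; rewrite divr_gt0 // ltr_wpDl // nrm_ge0.
have bound (x y : A) (e : R) : 0 < e -> nrm x < e / (nrm y + 1) -> nrm x * nrm y < e.
  move=> e0; have := nrm_ge0 y; have := nrm_ge0 x => x0 y0.
  by rewrite ltr_pdivlMr ?ltr_wpDl // mulrDr mulr1; apply: le_lt_trans; rewrite lerDl.
apply: (tens_ind ht) => // a b; move: a b; apply: (CP).
- move=> a h b; apply: Pc => e e0; have [a' ha' aa'] := h _ (small b e e0).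
  exists (tens a' b) => //; rewrite -(tensBl ht); apply: le_lt_trans (nrm_tens ht _ _) _.
  exact: bound.
- by move=> x y hx hy b; rewrite (tensDl ht); exact: PD.
- by move=> c x hx b; rewrite (tensZl ht); exact: PZ.
- by move=> b; rewrite (tens0l ht).
move=> m a aC; apply: CP.
- move=> b h; apply: Pc => e e0; have [b' hb' bb'] := h _ (small a e e0).
  exists (tens a b') => //; rewrite -(tensBr ht); apply: le_lt_trans (nrm_tens ht _ _) _.
  by rewrite mulrC; exact: bound.
- by move=> x y hx hy; rewrite (tensDr ht); exact: PD.
- by move=> c x hx; rewrite (tensZr ht); exact: PZ.
- by rewrite (tens0r ht).
move=> n b bC; apply: (PC (maxn m n)); apply: allpairs_f.
  by apply: CN aC; exact: leq_maxl.
by apply: CN bC; exact: leq_maxr.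
Qed.

End Totals.

(** * Cocycle conjugacy and the flip *)

Section CocycleConjugacy.
Context {R : realType}.

(** The unitaries [star (u t)] undo the perturbation and form a cocycle for the perturbed flow. *)
Lemma cocycle_conjugate_sym (A B : cstarAlgType R) (alpha : R -> A -> A) (beta : R -> B -> B) :
  flow alpha -> flow beta ->
  cocycle_conjugate alpha beta -> cocycle_conjugate beta alpha.
Proof.
move=> fa fb [phi [phiV [ip pK pVK [u [[cu uu cocu] au]]]]].
have iV := star_iso_inv ip pK pVK; have [hp _] := ip; have [hV _] := iV.
exists phiV, phi; split=> //; exists (fun t => phi (star (u t))); split; first split.
- by move=> t; apply: (cvg_shom hp); apply: cvg_star; exact: cu.
- by move=> t; apply: (shom_unitary hp); exact: unitary_star.
- move=> s t; rewrite pK -(shomM hp) au -cocu star_mul; congr (phi _).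
  have := (flow_shom s fb) => hb.
  rewrite (shom_star hp) (shom_star hb) (shom_star hV) /Ad !mulrA.
  by rewrite (uu s).1 mul1r.
move=> t y; rewrite /Ad -(shom_star hp) -!(shomM hp) au pVK.
by rewrite -/(Ad (star (u t)) _) AdK // pVK.
Qed.

Lemma cocycle_conjugate_trans (A B C : cstarAlgType R) (alpha : R -> A -> A)
    (beta : R -> B -> B) (gamma : R -> C -> C) :
  flow gamma -> cocycle_conjugate alpha beta -> cocycle_conjugate beta gamma ->
  cocycle_conjugate alpha gamma.
Proof.
move=> fg [phi [phiV [ip pK pVK [u [[cu uu cocu] au]]]]].
move=> [psi [psiV [iq qK qVK [w [[cw uw cocw] bw]]]]].
have iV := star_iso_inv ip pK pVK; have [hp _] := ip; have [hV _] := iV.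
have jV := star_iso_inv iq qK qVK; have [hq _] := iq; have [hqV _] := jV.
exists (psi \o phi), (phiV \o psiV); split.
- exact: star_iso_comp.
- exact: can_comp.
- exact: can_comp.
exists (fun t => u t * phiV (w t)); split; first split.
- by move=> t; apply: cvg_mul; [exact: cu | apply: (cvg_shom hV); exact: cw].
- by move=> t; apply: unitary_mul => //; exact: (shom_unitary hV).
- move=> s t; have hg := flow_shom s fg.
  rewrite -cocu -cocw bw /= (shomM hp) (shomM hq) (shomM hg) (shomM hqV) !(shomM hV) pVK.
  rewrite /Ad (shom_star hV) !mulrA; congr (_ * _).
  by rewrite -[RHS]mulrA (shom_unitary hV (uw s)).1 mulr1.
by move=> t x; rewrite au bw Ad_mul (shom_Ad hV).
Qed.

End CocycleConjugacy.

Section FlipOfUHFFlow.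
Context {R : realType} {A AA : cstarAlgType R} {tens : A -> A -> AA} (ht : Ctensor tens).
Context {alpha gamma : R -> A -> A}.
Hypotheses (fa : flow alpha) (hg : UHF_flow gamma).

Lemma flip_of_cocycle_conjugate : cocycle_conjugate alpha gamma ->
  flip_invariantly_approximately_inner tens alpha.
Proof.
move=> [phi [phiV [ip pK pVK [w [[_ uw _] aw]]]]].
have [fg [F [filt gF]]] := hg.
have iV := star_iso_inv ip pK pVK; have [hV _] := iV.
have hl := star_hom_tensl ht; have hr := star_hom_tensr ht.
have hlV := star_hom_comp hV hl; have hrV := star_hom_comp hV hr.
(* The last clause quantifies over all homomorphisms acting as alpha t (x) alpha t on elementary
   tensors, because the tensor flow is constructed only afterwards. *)
have H n : exists u : AA, [/\ unitary u,
    forall a, F n a -> Ad u (tens (phiV a) 1) = tens 1 (phiV a),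
    forall a, F n a -> Ad u (tens 1 (phiV a)) = tens (phiV a) 1 &
    forall f t, star_hom f -> (forall a b, f (tens a b) = tens (alpha t a) (alpha t b)) ->
      f u = Ad (tens (w t) (w t)) u].
  have [k [e [he eF]]] := full_matrix_units (filt_mx filt n) (filt1 filt n).
  have Fe i j : F n (e i j) by rewrite -eF; exact: mspan_unit.
  pose e1 i j := tens (phiV (e i j)) 1; pose e2 i j := tens 1 (phiV (e i j)).
  have h1 : munits e1 by exact: munits_shom he hlV.
  have h2 : munits e2 by exact: munits_shom he hrV.
  have e12 i j p q : e1 i j * e2 p q = e2 p q * e1 i j by rewrite -(tensE ht) -(tensE' ht).
  have hu := mflip_unitary h1 h2 e12.
  have hA := star_hom_Ad hu.
  have u1 a : F n a -> Ad (mflip e1 e2) (tens (phiV a) 1) = tens 1 (phiV a).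
    have HA := star_hom_comp hlV hA.
    rewrite -eF; move: a; apply: mspan_ind => [|x y hx hy|c x hx|i j].
    - by rewrite [LHS](shom0 HA) [RHS](shom0 hrV).
    - by rewrite [LHS](shomD HA) [RHS](shomD hrV); exact: f_equal2 hx hy.
    - by rewrite [LHS](shomZ HA) [RHS](shomZ hrV); exact: f_equal hx.
    - exact: Ad_mflip.
  have u2 a : F n a -> Ad (mflip e1 e2) (tens 1 (phiV a)) = tens (phiV a) 1.
    by move=> /u1 <-; rewrite -{1}(mflip_star h1 h2 e12) AdK.
  exists (mflip e1 e2); split=> // f t fh ft.
  (* Invariance of [F n] gives a unitary [v] of [F n] implementing [gamma t] there, so [alpha t]
     acts on the copy of [F n] as [Ad (w t * phiV v)]. *)
  have [v [Fv hv ve]] := @full_matrix_conj _ _ _ (filt_mx filt n) (filt1 filt n) _ e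
    (fun i j => gamma t (e i j)) he (munits_shom he (flow_shom t fg)) Fe
    (fun i j => ltac:(by rewrite -(gF n t); exists (e i j))).
  have hphv := shom_unitary hV hv.
  have av i j : alpha t (phiV (e i j)) = Ad (w t * phiV v) (phiV (e i j)).
    by rewrite aw pVK -ve (shom_Ad hV) Ad_mul.
  pose q := tens (w t * phiV v) (w t * phiV v).
  have hwv : unitary (w t * phiV v) by exact: unitary_mul.
  have hq : unitary q by exact: (tens_unitary ht).
  have hAq := star_hom_Ad hq.
  have fe i j p l : f (e2 i j * e1 p l) = Ad q (e2 i j * e1 p l).
    rewrite (shomM fh) (shomM hAq) !ft !(Ad_tens ht) !av Ad1 //.
    by rewrite (shom1 (flow_shom t fa)).
  have -> : f (mflip e1 e2) = Ad q (mflip e1 e2).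
    rewrite /mflip (shom_sum fh) (shom_sum hAq); apply: eq_bigr => i _.
    by rewrite (shom_sum fh) (shom_sum hAq); apply: eq_bigr => j _.
  (* As [v] lies in [F n], the flip unitary commutes with [tens (phiV v) (phiV v)], and only the
     cocycle remains. *)
  have -> : q = tens (w t) (w t) * tens (phiV v) (phiV v) by rewrite (tensM ht).
  rewrite Ad_mul; congr (Ad _ _); apply: Ad_comm; first exact: (tens_unitary ht).
  have : Ad (mflip e1 e2) (tens (phiV v) (phiV v)) = tens (phiV v) (phiV v).
    by rewrite {1}(tensE ht) AdM // u1 // u2 // -(tensE' ht).
  by move=> h; rewrite -{1}h /Ad -(mulrA (mflip e1 e2 * _)) hu.1 mulr1.
have [u hu] := choice H.
have uu n : unitary (u n) by case: (hu n).
have hA n : star_hom (Ad (u n)) by exact: star_hom_Ad.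
have nl n a : F n a -> \forall k \near \oo, Ad (u k) (tens (phiV a) 1) = tens 1 (phiV a).
  move=> Fa; apply/near_ooP; exists n => k nk; have [_ h _ _] := hu k.
  by apply: h; exact: (filt_le filt nk).
have nr n a : F n a -> \forall k \near \oo, Ad (u k) (tens 1 (phiV a)) = tens (phiV a) 1.
  move=> Fa; apply/near_ooP; exists n => k nk; have [_ _ h _] := hu k.
  by apply: h; exact: (filt_le filt nk).
have cl a : Ad (u k) (tens (phiV a) 1) @[k --> \oo] --> tens 1 (phiV a).
  apply/null_cvg; move: a; apply: (uhf_ind filt) => [a|n a /nl h].
    apply: (@null_closed _ _ _ (fun k a => Ad (u k) (tens (phiV a) 1) - tens 1 (phiV a)) 2).
    move=> n x y; have -> : Ad (u n) (tens (phiV x) 1) - tens 1 (phiV x) -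
        (Ad (u n) (tens (phiV y) 1) - tens 1 (phiV y)) =
        Ad (u n) (tens (phiV (x - y)) 1) - tens 1 (phiV (x - y)).
      rewrite (shomB hV) (tensBl ht) (tensBr ht) AdB !opprB.
      by rewrite addrACA [RHS]addrACA; congr (_ + _); rewrite addrC.
    apply: le_trans (nrmB _ _) _; rewrite nrm_Ad //.
    have := shom_le hlV (x - y); have := shom_le hrV (x - y); rewrite /=; lra.
  by apply: cvg_near_cst; apply: filterS h => k ->; rewrite subrr.
have cr a : Ad (u k) (tens 1 (phiV a)) @[k --> \oo] --> tens (phiV a) 1.
  apply/null_cvg; move: a; apply: (uhf_ind filt) => [a|n a /nr h].
    apply: (@null_closed _ _ _ (fun k a => Ad (u k) (tens 1 (phiV a)) - tens (phiV a) 1) 2).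
    move=> n x y; have -> : Ad (u n) (tens 1 (phiV x)) - tens (phiV x) 1 -
        (Ad (u n) (tens 1 (phiV y)) - tens (phiV y) 1) =
        Ad (u n) (tens 1 (phiV (x - y))) - tens (phiV (x - y)) 1.
      rewrite (shomB hV) (tensBl ht) (tensBr ht) AdB !opprB.
      by rewrite addrACA [RHS]addrACA; congr (_ + _); rewrite addrC.
    apply: le_trans (nrmB _ _) _; rewrite nrm_Ad //.
    have := shom_le hlV (x - y); have := shom_le hrV (x - y); rewrite /=; lra.
  by apply: cvg_near_cst; apply: filterS h => k ->; rewrite subrr.
have ct a b : Ad (u k) (tens a b) @[k --> \oo] --> tens b a.
  rewrite -(pK a) -(pK b) (tensE' ht (phiV (phi b))).
  have -> : (fun k => Ad (u k) (tens (phiV (phi a)) (phiV (phi b)))) = fun k =>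
    Ad (u k) (tens (phiV (phi a)) 1) * Ad (u k) (tens 1 (phiV (phi b))).
    by apply/funext => k; rewrite (tensE ht) AdM.
  by apply: cvg_mul; [exact: cl | exact: cr].
have [|sigma [sh cs]] := lim_star_hom hA.
  apply: (tens_ind ht) => [z h||x y [l hx] [m hy]|a b].
  - exact: (shom_cvg_closed hA).
  - by exists 0; under eq_fun do rewrite (shom0 (hA _)); exact: cvg_cst.
  - by exists (l + m); under eq_fun do rewrite AdD; exact: cvgD.
  - by exists (tens b a); exact: ct.
have sE a b : sigma (tens a b) = tens b a by exact: cvg_eq (@cs _) (@ct a b).
have ss z : sigma (sigma z) = z.
  apply: (@tens_shom_eq _ _ _ _ _ ht _ (sigma \o sigma) id) => // [|a b].
    exact: star_hom_comp.
  by rewrite /= !sE.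
have [dd [fdd ddE]] := tensor_flow_exists ht filt filt fa fa.
exists sigma, dd; split=> //; first by split=> //; split=> //; exists sigma.
exists u; split=> // t; apply/norm_null.
have [q hq] : exists q, q = tens (w t) (w t) by exists (tens (w t) (w t)).
have uq : unitary q by rewrite hq; exact: (tens_unitary ht).
(* [Ad q (u n) - u n] and [Ad (u n) q - q] both have the norm of the commutator of [q] and [u n];
   the second tends to [sigma q - q = 0], [q] being symmetric. *)
apply: (@null_le _ _ _ _ (fun n => Ad (u n) q - q) 1).
  apply: nearW => n; have [_ _ _ h] := hu n.
  by rewrite mul1r (h _ _ (flow_shom t fdd) (ddE t)) -hq !nrm_Ad_comm // nrmC.
have -> : (fun n => Ad (u n) q - q) = fun n => Ad (u n) q - sigma q.
  by rewrite hq sE.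
by apply: (null_cvg _ _).1; exact: cs.
Qed.

End FlipOfUHFFlow.

Theorem theorem4p6 (R : realType) (A AA : cstarAlgType R)
    (tens : A -> A -> AA) (gamma alpha : R -> A -> A) (alpha_gamma : R -> AA -> AA)
    (hAA : Ctensor_product tens)
    (hA : UHF_algebra A)
    (hAAA : isomorphic AA A)
    (hgamma : universal_UHF_flow tens gamma)
    (halpha : flow alpha)
    (hinner : approximately_inner alpha)
    (halpha_gamma : tensor_flow tens alpha gamma alpha_gamma)
    (hconj : cocycle_conjugate alpha_gamma alpha) :
  cocycle_conjugate alpha gamma <->
  flip_invariantly_approximately_inner tens alpha.
Proof.
have [ht _] := hAA; have [hg _] := hgamma; have [fg _] := hg; have [F filt] := hA.
split; first exact: flip_of_cocycle_conjugate.
move=> [sigma [dd [hs hdd [u [uu us udd]]]]].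
have [W [hW Wc Wf]] := central_model_embedding filt ht hAAA halpha hinner hgamma.
have [CA tCA] := uhf_total filt.
(* The embedding 1 (x) x is exactly equivariant from [gamma] to alpha (x) gamma, so the intertwining
   starts from [gamma]; [alpha] enters only through [hconj]. *)
suff h : cocycle_conjugate gamma alpha_gamma.
  apply: cocycle_conjugate_sym => //; apply: cocycle_conjugate_trans h hconj.
  exact: halpha.
have ih := star_hom_tensr ht.
apply: (intertwining ih (uhf_shom_nrm ih filt) halpha_gamma.1 _ _ tCA (tens_total ht tCA)).
  by move=> t x; rewrite halpha_gamma.2 (shom1 (flow_shom t halpha)).
move=> e T X Z e0 T0.
apply: (absorbing_unitary ht halpha_gamma hdd hs uu us _ hW Wc Wf) => // t.
exact/norm_null.
Qed.
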